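(* For every choice of positive integers $n,p,d$ and every $\varepsilon>0$, $s_\lambda>0$, there exists (for each target dimension $m$) a distribution on linear sketches $\Pi^p\in\mathbb{R}^{m\times d^p}$ such that: (1) if $m=\Omega\left(p\, s_\lambda^2\,\varepsilon^{-2}\right)$, then the distribution of $\Pi^p$ is an $(\varepsilon,1/10,s_\lambda,d^p,n)$-Oblivious Subspace Embedding; (2) if $m=\Omega\left(p\,\varepsilon^{-2}\right)$, then the distribution of $\Pi^p$ has the $(\varepsilon,1/10)$-approximate matrix product property. Moreover, for any $X\in\mathbb{R}^{d\times n}$, if $A\in\mathbb{R}^{d^p\times n}$ is the matrix whose $i$-th column is $x_i^{\otimes p}$ (the $p$-fold self tensor product of the $i$-th column $x_i$ of $X$), then the matrix $\Pi^p A$ (for $\Pi^p$ sampled from this distribution) can be computed in time $\widetilde{O}\left(p\,n\,m+p\,\mathrm{nnz}(X)\right)$.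
   Context: For $v\in\mathbb{R}^d$, $v^{\otimes p}\in\mathbb{R}^{d^p}$ denotes the $p$-fold tensor (Kronecker) product of $v$ with itself, viewed as a vector. $\mathrm{nnz}(X)$ is the number of nonzero entries of $X$. The notation $\widetilde{O}$ suppresses $\mathrm{poly}(\log(nd/\varepsilon))$ factors. For $\lambda>0$ and a positive semidefinite $K\in\mathbb{R}^{n\times n}$, the $\lambda$-statistical dimension is $s_\lambda(K)=\mathrm{tr}(K(K+\lambda I_n)^{-1})$. For symmetric matrices, $K\preceq K'$ means $x^\top Kx\le x^\top K'x$ for all $x$. Given $\varepsilon,\delta,\mu>0$ and integers $D,n\ge1$, an $(\varepsilon,\delta,\mu,D,n)$-Oblivious Subspace Embedding is a distribution $\mathcal{D}$ over $m\times D$ matrices such that for every $\lambda>0$ and every $A\in\mathbb{R}^{D\times n}$ with $s_\lambda(A^\top A)\le\mu$, $\Pr_{\Pi\sim\mathcal{D}}\left[(1-\varepsilon)(A^\top A+\lambda I_n)\preceq(\Pi A)^\top\Pi A+\lambda I_n\preceq(1+\varepsilon)(A^\top A+\lambda I_n)\right]\ge1-\delta.$ A distribution $\mathcal{D}$ over $m\times D$ matrices has the $(\varepsilon,\delta)$-approximate matrix product property if for every $C,E\in\mathbb{R}^{D\times n}$, $\Pr_{\Pi\sim\mathcal{D}}\left[\|C^\top\Pi^\top\Pi E-C^\top E\|_F\le\varepsilon\|C\|_F\|E\|_F\right]\ge1-\delta$. *)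

(* Defs.v *)
From HB Require Import structures.
From mathcomp Require Import all_boot all_order all_algebra.
From mathcomp Require Import all_classical all_reals all_analysis.
From mathcomp Require Import mxtens.
Import Order.TTheory GRing.Theory Num.Theory.
Import numFieldNormedType.Exports.

Set Implicit Arguments.
Unset Strict Implicit.
Unset Printing Implicit Defensive.

Local Open Scope classical_set_scope.
Local Open Scope ring_scope.

Definition statdim (R : realType) (n : nat) (lambda : R) (K : 'M[R]_n) : R :=
  \tr (K *m invmx (K + lambda%:M)).

Definition loewner_le (R : realType) (n : nat) (K K' : 'M[R]_n) : Prop :=
  forall x : 'cV[R]_n, (x^T *m K *m x) 0 0 <= (x^T *m K' *m x) 0 0.

Definition frobenius (R : realType) (a b : nat) (M : 'M[R]_(a, b)) : R :=
  Num.sqrt (\sum_(i < a) \sum_(j < b) M i j ^+ 2).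

Definition nnz (R : realType) (a b : nat) (X : 'M[R]_(a, b)) : nat :=
  #|[set ij : 'I_a * 'I_b | X ij.1 ij.2 != 0]|.

(* Borel probability measures on the space of m x D matrices. *)
Notation sketch_dist R m D :=
  (probability (g_sigma_algebraType (@open 'M[R]_(m, D))) R).

Definition oblivious_subspace_embedding (R : realType) (m D : nat)
    (eps delta mu : R) (n : nat) (P : sketch_dist R m D) : Prop :=
  forall (lambda : R) (A : 'M[R]_(D, n)), 0 < lambda ->
    statdim lambda (A^T *m A) <= mu ->
    let K := A^T *m A + lambda%:M in
    let K' (Pi : 'M[R]_(m, D)) := (Pi *m A)^T *m (Pi *m A) + lambda%:M in
    ((1 - delta)%:E <=
      P [set Pi | loewner_le ((1 - eps)%R *: K) (K' Pi) /\
                  loewner_le (K' Pi) ((1 + eps)%R *: K)])%E.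

Definition approx_matrix_product (R : realType) (m D : nat)
    (eps delta : R) (n : nat) (P : sketch_dist R m D) : Prop :=
  forall C E : 'M[R]_(D, n),
    ((1 - delta)%:E <=
      P [set Pi : 'M[R]_(m, D) |
         (frobenius (C^T *m Pi^T *m Pi *m E - C^T *m E)
            <= eps * frobenius C * frobenius E)%R])%E.

(* The Kronecker power [v ^t p] of a column has 1 ^ p columns. *)
Definition self_tensor (R : realType) (d : nat) (p : nat) (v : 'cV[R]_d) :
    'cV[R]_(d ^ p) :=
  castmx (erefl (d ^ p)%N, exp1n p) (ntensmx v p).

Definition self_tensor_cols (R : realType) (d n p : nat) (X : 'M[R]_(d, n)) :
    'M[R]_(d ^ p, n) :=
  \matrix_(k, j) self_tensor p (col j X) k 0.

(* [P] is the law of [Pi omega] when [omega] is a string of L independent fair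
   bits. *)
Definition fair_coin_law (R : realType) (m D L : nat)
    (Pi : L.-tuple bool -> 'M[R]_(m, D)) (P : sketch_dist R m D) : Prop :=
  forall B : set (g_sigma_algebraType (@open 'M[R]_(m, D))), measurable B ->
    P B = (#|[pred omega : L.-tuple bool | `[< B (Pi omega) >]]|%:R
             / 2 ^+ L)%:E.

(* Model of computation: programs for a word RAM with real registers (the
   "real RAM").  The memory consists of arrays of machine words and arrays of
   reals, both indexed by naturals; a program mentions finitely many arrays, and
   a variable is cell 0 of an array.  Reals support exact field operations,
   square roots and comparisons; they cannot be converted to words.  *)
Inductive iexp : Type :=
| INat of nat
| IGet of nat & iexp
| IAdd of iexp & iexp
| ISub of iexp & iexp
| IMul of iexp & iexp
| IDiv of iexp & iexp
| IMod of iexp & iexp.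

Inductive rexp : Type :=
| RNat of iexp
| RGet of nat & iexp
| RAdd of rexp & rexp
| RSub of rexp & rexp
| RMul of rexp & rexp
| RDiv of rexp & rexp
| RSqrt of rexp.

Inductive bexp : Type :=
| BLeI of iexp & iexp
| BLeR of rexp & rexp
| BNot of bexp
| BAnd of bexp & bexp.

Inductive cmd : Type :=
| Skip
| SetI of nat & iexp & iexp
| SetR of nat & iexp & rexp
| Seq of cmd & cmd
| If of bexp & cmd & cmd
| While of bexp & cmd.

Record state (R : realType) : Type := State {
  words : nat -> nat -> nat;
  reals : nat -> nat -> R
}.

Definition update (T : Type) (M : nat -> nat -> T) (a i : nat) (v : T) :
    nat -> nat -> T :=
  fun b j => if (b == a) && (j == i) then v else M b j.

Section Semantics.
Variable R : realType.
Implicit Type st : state R.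

Fixpoint ieval st (e : iexp) : nat :=
  match e with
  | INat k => k
  | IGet a e => words st a (ieval st e)
  | IAdd e1 e2 => (ieval st e1 + ieval st e2)%N
  | ISub e1 e2 => (ieval st e1 - ieval st e2)%N
  | IMul e1 e2 => (ieval st e1 * ieval st e2)%N
  | IDiv e1 e2 => (ieval st e1 %/ ieval st e2)%N
  | IMod e1 e2 => (ieval st e1 %% ieval st e2)%N
  end.

Fixpoint reval st (e : rexp) : R :=
  match e with
  | RNat e => (ieval st e)%:R
  | RGet a e => reals st a (ieval st e)
  | RAdd e1 e2 => reval st e1 + reval st e2
  | RSub e1 e2 => reval st e1 - reval st e2
  | RMul e1 e2 => reval st e1 * reval st e2
  | RDiv e1 e2 => reval st e1 / reval st e2
  | RSqrt e => Num.sqrt (reval st e)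
  end.

Fixpoint beval st (b : bexp) : bool :=
  match b with
  | BLeI e1 e2 => (ieval st e1 <= ieval st e2)%N
  | BLeR e1 e2 => reval st e1 <= reval st e2
  | BNot b => ~~ beval st b
  | BAnd b1 b2 => beval st b1 && beval st b2
  end.

(* [exec W c st t st']: run from [st], [c] halts in [st'] after [t] steps, and
   every word it stores is less than [W].  Each assignment and each test is one
   step: this is the number of elementary operations up to a factor that depends
   on the program only. *)
Inductive exec (W : nat) : cmd -> state R -> nat -> state R -> Prop :=
| ExecSkip st : exec W Skip st 1 st
| ExecSetI a e1 e2 st :
    (ieval st e2 < W)%N ->
    exec W (SetI a e1 e2) st 1
      (State (update (words st) a (ieval st e1) (ieval st e2)) (reals st))
| ExecSetR a e r st :
    exec W (SetR a e r) st 1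
      (State (words st) (update (reals st) a (ieval st e) (reval st r)))
| ExecSeq c1 c2 st1 st2 st3 t1 t2 :
    exec W c1 st1 t1 st2 -> exec W c2 st2 t2 st3 ->
    exec W (Seq c1 c2) st1 (t1 + t2) st3
| ExecIfTrue b c1 c2 st st' t :
    beval st b -> exec W c1 st t st' -> exec W (If b c1 c2) st t.+1 st'
| ExecIfFalse b c1 c2 st st' t :
    ~~ beval st b -> exec W c2 st t st' -> exec W (If b c1 c2) st t.+1 st'
| ExecWhileTrue b c st1 st2 st3 t1 t2 :
    beval st1 b -> exec W c st1 t1 st2 -> exec W (While b c) st2 t2 st3 ->
    exec W (While b c) st1 (t1 + t2).+1 st3
| ExecWhileFalse b c st :
    ~~ beval st b -> exec W (While b c) st 1 st.

End Semantics.

(* Compressed sparse column format: column j of X occupies the positions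
   [csc_start X j], ..., [csc_start X j.+1 - 1] of the lists [csc_rows X] (row
   indices) and [csc_vals X] (values) of the nonzero entries of X. *)
Definition csc_col (R : realType) (d n : nat) (X : 'M[R]_(d, n)) (j : 'I_n) :
    seq 'I_d :=
  [seq i <- enum 'I_d | X i j != 0].

Definition csc_start (R : realType) (d n : nat) (X : 'M[R]_(d, n)) (k : nat) :
    nat :=
  (\sum_(j < n | j < k) size (csc_col X j))%N.

Definition csc_rows (R : realType) (d n : nat) (X : 'M[R]_(d, n)) : seq nat :=
  flatten [seq [seq nat_of_ord i | i <- csc_col X j] | j <- enum 'I_n].

Definition csc_vals (R : realType) (d n : nat) (X : 'M[R]_(d, n)) : seq R :=
  flatten [seq [seq X i j | i <- csc_col X j] | j <- enum 'I_n].

(* Word arrays: 0 = parameters, 1-2 = sparsity pattern of X, 3 = random bits.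
   Real arrays: 0 = parameters, 1 = values of X.  All other cells are 0. *)
Definition init_state (R : realType) (n p d m : nat) (eps s : R)
    (X : 'M[R]_(d, n)) (omega : seq bool) : state R :=
  State
    (fun a k => match a with
     | 0 => nth 0 [:: n; p; d; m] k
     | 1 => if (k <= n)%N then csc_start X k else 0
     | 2 => nth 0 (csc_rows X) k
     | 3 => nth false omega k : nat
     | _ => 0
     end%N)
    (fun a k => match a with
     | 0%N => nth 0 [:: eps; s] k
     | 1%N => nth 0 (csc_vals X) k
     | _ => 0
     end).

(* The result is read, in column-major order, from real array 2. *)
Definition output_is (R : realType) (m n : nat) (st : state R)
    (Y : 'M[R]_(m, n)) : Prop :=
  forall (i : 'I_m) (j : 'I_n), reals st 2 (j * m + i) = Y i j.

(* A bound poly(log(nd/eps)); the summand 2 keeps it bounded away from 0 when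
   nd/eps is small. *)
Definition polylog (R : realType) (c : nat) (n d : nat) (eps : R) : R :=
  ln (2 + (n * d)%:R / eps) ^+ c.

(* Main.v *)
(* The sketch processes the [p] tensor factors one at a time.  With M = 2^r
   buckets, a step maps a pair (y, x), where y has M entries and x has d, to
     z[w] = sum of sigma(i) tau(j) y[i] x[j] over the (i, j) with h(i) xor g(j) = w,
   where h is a pairwise independent hash function, sigma and tau are random
   signs, and g is the identity if d <= M and a random function otherwise.  The
   step preserves inner products on average, with variance O(1/M) relative to the
   norms, even tensored with an identity map.  The errors of p independent steps
   are martingale differences, so the relative variance of the whole sketch is at
   most (1 + 8/M)^p - 1 = O(p/M).  Markov's inequality then gives the approximate
   matrix product property; applied to A (A^T A + lambda)^(-1/2) it gives the
   subspace embedding.  If eps >= 1, or if M is too small for this bound, the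
   hypotheses on m force the zero sketch to have both properties.

   Since g takes few values when d is small, the convolution above splits into
   blocks of 2^l = O(d) entries, and Walsh-Hadamard transforms compute a step in
   time O(M log d): a convolution of length M would cost log M, hence log p, which
   is not bounded by a power of log(nd/eps). *)

Require Import Defs.
From HB Require Import structures.
From mathcomp Require Import all_boot all_order all_algebra.
From mathcomp Require Import all_classical all_reals all_analysis.
From mathcomp Require Import mxtens.
From mathcomp Require Import zify ring lra.
Import Order.TTheory GRing.Theory Num.Theory.
Import numFieldNormedType.Exports.
Local Open Scope ring_scope.

Set Implicit Arguments.
Unset Strict Implicit.
Unset Printing Implicit Defensive.

(** * Averages over finite types and random signs *)

(** All probability here is averaging over finite sets, and a single bound carries both guarantees:
    the second moment of [<Sx, Sy> - <x, y>] for two fixed vectors. The induction over the factors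
    cannot live on that bound alone. The variance of a later step is relative to the norms that the
    earlier steps leave behind, so the mean of a product of two squared norms has to be controlled
    along with it. The number of buckets is a power of two so that every hash value and sign is a
    string of fair bits; uniform coins then give exactly uniform hash functions. The time bound
    shapes the rest: neither log m nor log p may multiply p n m. Hence hash tables are filled by
    doubling, and a hash value of r coins is read per nonzero entry only when r < log d. The case
    eps >= 1 is set apart for time as well as accuracy, because log d is bounded by log(nd/eps) only
    when eps is not large. *)

Section Average.
Variable R : realFieldType.
Implicit Types T I : finType.

Definition avg T (f : T -> R) : R := (\sum_t f t) / #|T|%:R.

Lemma eq_avg T (f g : T -> R) : f =1 g -> avg f = avg g.
Proof. by move=> fg; rewrite /avg (eq_bigr _ (fun t _ => fg t)). Qed.

Lemma avgD T (f g : T -> R) : avg (fun t => f t + g t) = avg f + avg g.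
Proof. by rewrite /avg big_split /= mulrDl. Qed.

Lemma avgZ T a (f : T -> R) : avg (fun t => a * f t) = a * avg f.
Proof. by rewrite /avg -mulr_sumr mulrA. Qed.

Lemma avgN T (f : T -> R) : avg (fun t => - f t) = - avg f.
Proof. by rewrite /avg sumrN mulNr. Qed.

Lemma avg_sum T (J : Type) (s : seq J) (P : pred J) (f : J -> T -> R) :
  avg (fun t => \sum_(j <- s | P j) f j t) = \sum_(j <- s | P j) avg (f j).
Proof. by rewrite /avg exchange_big /= -mulr_suml. Qed.

Lemma le_avg T (f g : T -> R) : (forall t, f t <= g t) -> avg f <= avg g.
Proof.
by move=> fg; apply: ler_wpM2r; [rewrite invr_ge0 | apply: ler_sum].
Qed.

Lemma avg_ge0 T (f : T -> R) : (forall t, 0 <= f t) -> 0 <= avg f.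
Proof. by move=> f0; apply: divr_ge0 => //; apply: sumr_ge0. Qed.

Lemma avg_cst T a : (0 < #|T|)%N -> avg (fun _ : T => a) = a.
Proof.
move=> T0; rewrite /avg sumr_const -[a *+ _]mulr_natr mulfK //.
by rewrite pnatr_eq0 -lt0n.
Qed.

Lemma avg_pair T I (f : T * I -> R) : avg f = avg (fun x => avg (fun y => f (x, y))).
Proof.
rewrite /avg -mulr_suml card_prod natrM invfM mulrA mulrAC -mulrA mulrA.
rewrite (eq_bigr _ (fun t _ => congr1 f (surjective_pairing t))).
by rewrite -(pair_bigA _ (fun x y => f (x, y))) /= mulrAC.
Qed.

Lemma avg_bij T I (h : T -> I) (f : I -> R) : bijective h -> avg (f \o h) = avg f.
Proof.
move=> hb; rewrite /avg (bij_eq_card hb); congr (_ / _).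
by case: hb => k hk kh; rewrite (reindex h) //; exists k => ? _.
Qed.

Lemma avg_tupleS T n (f : n.+1.-tuple T -> R) :
  avg f = avg (fun x => avg (fun t : n.-tuple T => f [tuple of x :: t])).
Proof.
rewrite -(avg_pair (fun xt : T * n.-tuple T => f [tuple of xt.1 :: xt.2])).
rewrite -(avg_bij (h := fun xt : T * n.-tuple T => [tuple of xt.1 :: xt.2])) //.
exists (fun t : n.+1.-tuple T => (thead t, [tuple of behead t])).
  by case=> x t /=; congr pair; apply: val_inj.
by move=> t; rewrite [RHS]tuple_eta; apply: val_inj.
Qed.

Lemma sum_tupleS T n (f : n.+1.-tuple T -> R) :
  \sum_t f t = \sum_x \sum_(t : n.-tuple T) f [tuple of x :: t].
Proof.
rewrite (pair_bigA _ (fun x (t : n.-tuple T) => f [tuple of x :: t])) /=.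
rewrite (reindex (fun xt : T * n.-tuple T => [tuple of xt.1 :: xt.2])) //=.
exists (fun t : n.+1.-tuple T => (thead t, [tuple of behead t])).
  by case=> x t _ /=; congr pair; apply: val_inj.
by move=> t _; rewrite [RHS]tuple_eta; apply: val_inj.
Qed.

(** Each [sh v] preserves the uniform measure, so averaging over [v] too changes nothing, and the
    inner sum over [v] is constantly 1. Collision probabilities are computed this way, with [sh] a
    shift of one hash value. *)
Lemma avg_one_translate T I (sh : I -> T -> T) (A : pred T) :
    (forall v, injective (sh v)) ->
    (forall t, \sum_v (A (sh v t))%:R = 1 :> R) -> (0 < #|T|)%N ->
  avg (fun t => (A t)%:R) = #|I|%:R^-1.
Proof.
move=> sh_inj one T0.
have [I0|I0] := posnP #|I|.
  have /card_gt0P[t _] := T0.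
  have := one t; rewrite big1 => [/eqP|v _]; first by rewrite eq_sym oner_eq0.
  by have := fintype0 v I0.
have eqv v : avg (fun t => (A t)%:R) = avg (fun t => (A (sh v t))%:R).
  by rewrite -(avg_bij (h := sh v)) //; apply: injF_bij.
apply: (@mulfI _ #|I|%:R); first by rewrite pnatr_eq0 -lt0n.
rewrite divff ?pnatr_eq0 -?lt0n // mulr_natl -sumr_const (eq_bigr _ (fun v _ => eqv v)).
by rewrite -avg_sum (eq_avg one) avg_cst.
Qed.

Section Signs.
Variable I : finType.
Implicit Types (s : {ffun I -> bool}) (Q : I -> I -> R).

Definition sg s a : R := (-1) ^+ s a.

Lemma sgM s a : sg s a * sg s a = 1.
Proof. by rewrite -expr2 sqrr_sign. Qed.

Lemma card_signs : (0 < #|{ffun I -> bool}|)%N.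
Proof. by rewrite card_ffun card_bool expn_gt0. Qed.

Definition flip a s : {ffun I -> bool} := [ffun b => s b (+) (a == b)].

Lemma sg_flip a s b : sg (flip a s) b = (-1) ^+ (a == b) * sg s b.
Proof. by rewrite /sg ffunE signr_addb mulrC. Qed.

(** Flipping one sign is an involution of the sample space; every vanishing sign moment below
    reduces to it. *)
Lemma avg_flip0 a (f : {ffun I -> bool} -> R) :
  (forall s, f (flip a s) = - f s) -> avg f = 0.
Proof.
move=> fN; have : avg f = - avg f.
  rewrite -avgN -{1}(avg_bij (h := flip a)).
    exact/eq_avg.
  by exists (flip a) => s; apply/ffunP => b; rewrite !ffunE addbK.
lra.
Qed.

Lemma avg_sg2 a b : a != b -> avg (fun s => sg s a * sg s b) = 0.
Proof.
move=> ab; apply: (avg_flip0 (a := a)) => s.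
by rewrite !sg_flip eqxx (negPf ab) mul1r expr1 mulN1r mulNr.
Qed.

Lemma avg_sg4 a b c d : a != b -> c != d ->
  avg (fun s => sg s a * sg s b * (sg s c * sg s d)) =
  ((a == c) && (b == d))%:R + ((a == d) && (b == c))%:R.
Proof.
move=> ab cd.
have [->|ac] := eqVneq a c; have [->|bd] := eqVneq b d;
  rewrite ?eqxx ?(negPf cd) ?andbF ?andbT /= ?addr0 ?add0r.
- rewrite -(avg_cst 1 card_signs); apply: eq_avg => s.
  by rewrite mulrACA !sgM mulr1.
- apply: (avg_flip0 (a := d)) => s; rewrite !sg_flip eqxx.
  by rewrite [d == b]eq_sym [d == c]eq_sym (negPf bd) (negPf cd) !mul1r mulN1r !mulrN.
- rewrite [d == c]eq_sym (negPf cd) andbF.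
  apply: (avg_flip0 (a := c)) => s; rewrite !sg_flip eqxx (negPf cd).
  by rewrite [c == a]eq_sym (negPf ac) !mul1r expr1 mulN1r mulNr mulrN.
have [ad|ad] := eqVneq a d; last first.
  apply: (avg_flip0 (a := a)) => s; rewrite !sg_flip eqxx (negPf ab) (negPf ac).
  by rewrite (negPf ad) !mul1r expr1 mulN1r !mulNr.
have [bc|bc] /= := eqVneq b c.
  rewrite -ad -bc -(avg_cst 1 card_signs); apply: eq_avg => s.
  by rewrite [X in _ * X]mulrC mulrACA !sgM mulr1.
apply: (avg_flip0 (a := b)) => s; rewrite !sg_flip eqxx (negPf bd) (negPf bc).
by rewrite [b == a]eq_sym (negPf ab) !mul1r expr1 mulN1r mulrN mulNr.
Qed.

Lemma sum_signs_split s Q :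
  \sum_a \sum_b sg s a * sg s b * Q a b =
  \sum_a Q a a + \sum_a \sum_(b | b != a) sg s a * sg s b * Q a b.
Proof.
rewrite -big_split /=; apply: eq_bigr => a _.
by rewrite (bigD1 a) //= sgM mul1r.
Qed.

Lemma avg_chaos1 Q :
  avg (fun s => \sum_a \sum_b sg s a * sg s b * Q a b) = \sum_a Q a a.
Proof.
rewrite (eq_avg (fun s => sum_signs_split s Q)) avgD avg_cst ?card_signs //.
rewrite -[RHS]addr0; congr (_ + _).
rewrite avg_sum big1 // => a _; rewrite avg_sum big1 // => b ba.
rewrite (eq_avg (g := fun s => Q a b * (sg s a * sg s b))) => [|s]; last exact: mulrC.
by rewrite avgZ avg_sg2 ?mulr0 // eq_sym.
Qed.

(** The diagonal of the form is deterministic, since signs square to 1, and the off-diagonal part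
    [Y] has mean zero, so the cross term disappears. Among products of four signs only the pairings
    [(a, b) = (c, d)] and [(a, b) = (d, c)] survive. *)
Lemma avg_chaos2 Q z :
  avg (fun s => (\sum_a \sum_b sg s a * sg s b * Q a b - z) ^+ 2) <=
  (\sum_a Q a a - z) ^+ 2 + 2 * \sum_a \sum_(b | b != a) Q a b ^+ 2.
Proof.
set t := \sum_a Q a a - z.
pose Y s := \sum_a \sum_(b | b != a) sg s a * sg s b * Q a b.
have E s : (\sum_a \sum_b sg s a * sg s b * Q a b - z) ^+ 2 =
    t ^+ 2 + (2 * t) * Y s + Y s ^+ 2.
  by rewrite sum_signs_split -/(Y s) /t; ring.
have Y0 : avg Y = 0.
  rewrite avg_sum big1 // => a _; rewrite avg_sum big1 // => b ba.
  rewrite (eq_avg (g := fun s => Q a b * (sg s a * sg s b))) => [|s]; last exact: mulrC.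
  by rewrite avgZ avg_sg2 ?mulr0 // eq_sym.
rewrite (eq_avg E) !avgD avgZ Y0 mulr0 addr0 avg_cst ?card_signs // lerD2l.
have -> : avg (fun s => Y s ^+ 2) =
    \sum_a \sum_(b | b != a) (Q a b ^+ 2 + Q a b * Q b a).
  have E2 s : Y s ^+ 2 = \sum_a \sum_(b | b != a) \sum_c \sum_(d | d != c)
      Q a b * Q c d * (sg s a * sg s b * (sg s c * sg s d)).
    rewrite expr2 /Y big_distrl /=; apply: eq_bigr => a _.
    rewrite big_distrl /=; apply: eq_bigr => b _.
    rewrite big_distrr /=; apply: eq_bigr => c _.
    rewrite big_distrr /=; apply: eq_bigr => d _; ring.
  rewrite (eq_avg E2) avg_sum; apply: eq_bigr => a _.
  rewrite avg_sum; apply: eq_bigr => b ba; rewrite avg_sum.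
  have E3 c : avg (fun s => \sum_(d | d != c)
        Q a b * Q c d * (sg s a * sg s b * (sg s c * sg s d))) =
      \sum_(d | d != c) Q a b * Q c d *
         (((a == c) && (b == d))%:R + ((a == d) && (b == c))%:R).
    rewrite avg_sum; apply: eq_bigr => d dc.
    by rewrite avgZ avg_sg4 // eq_sym.
  have E4 (F : I -> I -> R) u v : v != u ->
      \sum_c \sum_(d | d != c) F c d * ((u == c) && (v == d))%:R = F u v.
    move=> vu; rewrite (bigD1 u) //= (bigD1 v) //= !eqxx mulr1 !big1 ?addr0 //.
      move=> c cu; rewrite big1 // => d _.
      by rewrite [u == c]eq_sym (negPf cu) mulr0.
    by move=> d /andP[_ dv]; rewrite [v == d]eq_sym (negPf dv) mulr0.
  rewrite (eq_bigr _ (fun c _ => E3 c)).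
  under eq_bigr do (under eq_bigr do rewrite mulrDr; rewrite big_split /=).
  rewrite big_split /= expr2; congr (_ + _); first exact: E4.
  under eq_bigr do under eq_bigr do rewrite andbC.
  by rewrite E4 // eq_sym.
(* AM-GM on [Q a b * Q b a]; once the indices are swapped in the second half, the weights 3/2 and
   1/2 add up to 2. *)
apply: (@le_trans _ _ (\sum_a \sum_(b | b != a) (3/2 * Q a b ^+ 2 + 1/2 * Q b a ^+ 2))).
  apply: ler_sum => a _; apply: ler_sum => b _.
  have := sqr_ge0 (Q a b - Q b a); nra.
rewrite (eq_bigr (fun a => 3/2 * (\sum_(b | b != a) Q a b ^+ 2) +
    1/2 * (\sum_(b | b != a) Q b a ^+ 2))); last first.
  by move=> a _; rewrite big_split /= !mulr_sumr.
rewrite big_split /= -!mulr_sumr.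
have -> : \sum_a \sum_(b | b != a) Q b a ^+ 2 = \sum_a \sum_(b | b != a) Q a b ^+ 2.
  rewrite (exchange_big_dep xpredT) //=; apply: eq_bigr => a _.
  by apply: eq_bigl => b; rewrite eq_sym.
lra.
Qed.

End Signs.
End Average.

(** * One step of the sketch *)

Lemma cauchy_schwarz_sum (R : realFieldType) (I : finType) (u v : I -> R) :
  (\sum_i u i * v i) ^+ 2 <= (\sum_i u i ^+ 2) * (\sum_i v i ^+ 2).
Proof.
have : 0 <= \sum_i \sum_j (u i * v j - u j * v i) ^+ 2.
  by apply: sumr_ge0 => i _; apply: sumr_ge0 => j _; apply: sqr_ge0.
have -> : \sum_i \sum_j (u i * v j - u j * v i) ^+ 2 =
    2 * ((\sum_i u i ^+ 2) * (\sum_i v i ^+ 2)) - 2 * (\sum_i u i * v i) ^+ 2.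
  have e1 : (\sum_i u i ^+ 2) * (\sum_i v i ^+ 2) =
      \sum_i \sum_j u i ^+ 2 * v j ^+ 2 by rewrite big_distrlr.
  have e2 : (\sum_i u i ^+ 2) * (\sum_i v i ^+ 2) =
      \sum_i \sum_j u j ^+ 2 * v i ^+ 2 by rewrite e1 exchange_big.
  rewrite [2 * (_ * _)]mulr_natl mulr2n {1}e1 e2 expr2 big_distrlr mulr_sumr.
  rewrite -!big_split /= -sumrB; apply: eq_bigr => i _.
  rewrite mulr_sumr -!big_split /= -sumrB; apply: eq_bigr => j _; ring.
lra.
Qed.

Section Step.
Variables (R : realFieldType) (I J TT GG : finType).
Variables (h : TT -> I -> I) (bk : GG -> I -> J -> I) (gam : R).
Variable i0 : I.
Hypotheses (TT0 : (0 < #|TT|)%N) (GG0 : (0 < #|GG|)%N) (gam_ge0 : 0 <= gam).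
(** An arbitrary injection [phi] is allowed because [(i, j)] and [(k, l)] share a bucket exactly
    when [h i = phi (h k)], with [phi] the inverse of [bk g ^~ j] after [bk g ^~ l]. *)
Hypothesis h_unif : forall i k (phi : I -> I), i != k -> injective phi ->
  avg (fun T => (h T i == phi (h T k))%:R : R) <= gam.
Hypothesis bk_inj : forall g j, injective (bk g ^~ j).
Hypothesis bk_coll : forall g u v j l,
  (bk g u j == bk g u l) = (bk g v j == bk g v l).
Hypothesis bk_unif : forall u j l, j != l ->
  avg (fun g => (bk g u j == bk g u l)%:R : R) <= gam.

Definition step_rand : finType :=
  ((GG * TT) * {ffun J -> bool} * {ffun I -> bool})%type.

(** The index [q] ranges over the tensor factors still to come. *)
Definition step (th : step_rand) (Q : Type) (U : I -> J -> Q -> R) (w : I) (q : Q) :=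
  let: (g, T, tau, sigma) := th in
  \sum_i \sum_j (bk g (h T i) j == w)%:R * (sg R sigma i * sg R tau j * U i j q).

Definition ip (A B : finType) (U V : A -> B -> R) := \sum_a \sum_b U a b * V a b.

Variable Q : finType.
Implicit Types U V : I -> J -> Q -> R.
Definition ip3 U V := \sum_i ip (U i) (V i).

Let G U V i j k l := \sum_q U i j q * V k l q.
Let B U V g T (tau : {ffun J -> bool}) i k := \sum_j \sum_l sg R tau j * sg R tau l *
  ((bk g (h T i) j == bk g (h T k) l)%:R * G U V i j k l).

(** A quadratic chaos in [sigma] whose coefficients [B] are chaoses in [tau]: the two families of
    signs can be averaged one after the other by the chaos lemmas. *)
Lemma ip_step U V g T tau sigma :
  let S := step (g, T, tau, sigma) in
  ip (S _ U) (S _ V) =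
  \sum_i \sum_k sg R sigma i * sg R sigma k * B U V g T tau i k.
Proof.
rewrite /= /ip.
pose H (a : I * J) := bk g (h T a.1) a.2.
pose s (a : I * J) := sg R sigma a.1 * sg R tau a.2.
have SE W w q : step (g, T, tau, sigma) W w q =
    \sum_a (H a == w)%:R * (s a * W a.1 a.2 q) by rewrite /step pair_bigA.
transitivity (\sum_a \sum_b s a * s b * ((H a == H b)%:R * G U V a.1 a.2 b.1 b.2)).
  transitivity (\sum_w \sum_q \sum_a \sum_b
      (H a == w)%:R * (H b == w)%:R * (s a * s b * (U a.1 a.2 q * V b.1 b.2 q))).
    apply: eq_bigr => w _; apply: eq_bigr => q _; rewrite !SE big_distrlr /=.
    apply: eq_bigr => a _; apply: eq_bigr => b _; ring.
  under eq_bigr do (rewrite exchange_big /=; under eq_bigr do rewrite exchange_big /=).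
  rewrite exchange_big; apply: eq_bigr => a _.
  rewrite exchange_big; apply: eq_bigr => b _.
  rewrite (bigD1 (H b)) //= [X in _ + X]big1 ?addr0 => [|w wb]; last first.
    by rewrite big1 // => q _; rewrite [H b == w]eq_sym (negPf wb) mulr0 mul0r.
  rewrite eqxx mulr1 -mulr_sumr -mulr_sumr -!/(G _ _ _ _ _ _); ring.
rewrite -(pair_bigA _ (fun i j => \sum_b s (i, j) * s b *
   ((H (i, j) == H b)%:R * G U V i j b.1 b.2))) /=.
apply: eq_bigr => i _.
rewrite (eq_bigr (fun j => \sum_k \sum_l s (i, j) * s (k, l) *
   ((H (i, j) == H (k, l))%:R * G U V i j k l))); last first.
  by move=> j _; rewrite pair_bigA.
rewrite exchange_big; apply: eq_bigr => k _; rewrite mulr_sumr.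
apply: eq_bigr => j _; rewrite mulr_sumr; apply: eq_bigr => l _.
rewrite /s /H /=; ring.
Qed.

Let sumG U V : \sum_i \sum_j G U V i j i j = ip3 U V. Proof. by []. Qed.

Let B_diag U V g T tau : \sum_i B U V g T tau i i =
  \sum_j \sum_l sg R tau j * sg R tau l *
    (\sum_i (bk g (h T i) j == bk g (h T i) l)%:R * G U V i j i l).
Proof.
rewrite exchange_big; apply: eq_bigr => j _; rewrite exchange_big.
by apply: eq_bigr => l _; rewrite mulr_sumr.
Qed.

Lemma card_step_rand : (0 < #|step_rand|)%N.
Proof. by rewrite !card_prod !muln_gt0 TT0 GG0 !card_signs. Qed.

Lemma step_mean U V :
  avg (fun th => ip (step th U) (step th V)) = ip3 U V.
Proof.
rewrite !avg_pair -[RHS](avg_cst _ GG0); apply: eq_avg => g.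
rewrite -[RHS](avg_cst _ TT0); apply: eq_avg => T.
under eq_avg do (under eq_avg do rewrite ip_step; rewrite avg_chaos1 B_diag).
rewrite avg_chaos1 -sumG exchange_big; apply: eq_bigr => i _.
by apply: eq_bigr => j _; rewrite eqxx mul1r.
Qed.

Let nr (A : finType) (u : A -> R) := \sum_a u a ^+ 2.
Let nr_ge0 (A : finType) (u : A -> R) : 0 <= nr u.
Proof. by apply: sumr_ge0 => a _; apply: sqr_ge0. Qed.

Let ip3E U : ip3 U U = \sum_i \sum_j nr (U i j).
Proof. by apply: eq_bigr => i _; apply: eq_bigr => j _; apply: eq_bigr => q _. Qed.

Let G_bound U V i k :
  (\sum_j G U V i j k j) ^+ 2 + 2 * \sum_j \sum_(l | l != j) G U V i j k l ^+ 2
  <= 3 * ((\sum_j nr (U i j)) * (\sum_l nr (V k l))).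
Proof.
have b1 : (\sum_j G U V i j k j) ^+ 2 <= (\sum_j nr (U i j)) * (\sum_l nr (V k l)).
  rewrite /G /nr !pair_bigA /=.
  exact: (cauchy_schwarz_sum (fun p => U i p.1 p.2) (fun p => V k p.1 p.2)).
have b2 : \sum_j \sum_(l | l != j) G U V i j k l ^+ 2 <=
    (\sum_j nr (U i j)) * (\sum_l nr (V k l)).
  rewrite mulr_suml; apply: ler_sum => j _; rewrite mulr_sumr.
  rewrite [leRHS](bigID (fun l => l != j)) /= -[leLHS]addr0; apply: lerD.
    by apply: ler_sum => l _; apply: cauchy_schwarz_sum.
  by apply: sumr_ge0 => l _; apply: mulr_ge0.
lra.
Qed.

Let diag_bound U V :
  \sum_j \sum_(l | l != j) (\sum_i G U V i j i l) ^+ 2 <= ip3 U U * ip3 V V.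
Proof.
rewrite !ip3E [X in X * _]exchange_big [X in _ * X]exchange_big /=.
rewrite mulr_suml; apply: ler_sum => j _; rewrite mulr_sumr.
rewrite [leRHS](bigID (fun l => l != j)) /= -[leLHS]addr0; apply: lerD.
  apply: ler_sum => l _; rewrite /G /nr !pair_bigA /=.
  exact: (cauchy_schwarz_sum (fun p => U p.1 j p.2) (fun p => V p.1 l p.2)).
by apply: sumr_ge0 => l _; apply: mulr_ge0; apply: sumr_ge0.
Qed.

Let natb_sqr (b : bool) : b%:R ^+ 2 = b%:R :> R.
Proof. by case: b; rewrite ?expr1n ?expr0n. Qed.

(** For [i = k] whether two terms meet depends on [g] alone, by [bk_coll]. The terms [j = l] add up
    to [ip3 U V] and cancel; the others survive with probability at most [gam]. *)
Let diag_part U V : avg (fun g => avg (fun T => avg (fun tau =>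
    (\sum_i B U V g T tau i i - ip3 U V) ^+ 2))) <=
  2 * gam * (ip3 U U * ip3 V V).
Proof.
pose e g j l : R := (bk g i0 j == bk g i0 l)%:R.
apply: (@le_trans _ _ (avg (fun g => 2 * \sum_j \sum_(l | l != j)
    (\sum_i G U V i j i l) ^+ 2 * e g j l))).
  apply: le_avg => g; rewrite -[leRHS](avg_cst _ TT0); apply: le_avg => T.
  under eq_avg do rewrite B_diag.
  apply: le_trans (avg_chaos2 _ _) _.
  have E j l : \sum_i (bk g (h T i) j == bk g (h T i) l)%:R * G U V i j i l =
      e g j l * \sum_i G U V i j i l.
    by rewrite mulr_sumr; apply: eq_bigr => i _; rewrite (bk_coll _ _ i0).
  rewrite (eq_bigr _ (fun j _ => E j j)).
  rewrite (eq_bigr (fun j => \sum_i G U V i j i j)); last first.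
    by move=> j _; rewrite /e eqxx mul1r.
  rewrite exchange_big subrr expr0n add0r ler_wpM2l //.
  apply: ler_sum => j _; apply: ler_sum => l _.
  by rewrite E exprMn natb_sqr mulrC.
rewrite avgZ -mulrA ler_wpM2l // avg_sum.
apply: le_trans (_ : _ <= \sum_j \sum_(l | l != j) gam * (\sum_i G U V i j i l) ^+ 2) _.
  apply: ler_sum => j _; rewrite avg_sum; apply: ler_sum => l lj.
  by rewrite avgZ [leLHS]mulrC ler_wpM2r ?sqr_ge0 // bk_unif // eq_sym.
under eq_bigr do rewrite -mulr_sumr.
by rewrite -mulr_sumr ler_wpM2l ?diag_bound.
Qed.

(** For [i != k] the terms [j = l] and [j != l] alike need a collision of [h], hence the factor
    [gam]. The 3 is 1 for the squared trace plus 2 for the off-diagonal terms of the chaos in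
    [tau]. *)
Let offdiag_part U V i k : k != i -> avg (fun g => avg (fun T => avg (fun tau =>
    B U V g T tau i k ^+ 2))) <=
  3 * gam * ((\sum_j nr (U i j)) * (\sum_l nr (V k l))).
Proof.
move=> ki; rewrite -[leRHS](avg_cst _ GG0); apply: le_avg => g.
pose F j l T := (bk g (h T i) j == bk g (h T k) l)%:R : R.
have F_le j l : avg (F j l) <= gam.
  have bK : bijective (bk g ^~ j) by apply: injF_bij.
  case: bK => bi b1 b2.
  have phi_inj : injective (fun u => bi (bk g u l)).
    by move=> u v /(can_inj b2); apply: bk_inj.
  have ik : i != k by rewrite eq_sym.
  apply: le_trans (h_unif ik phi_inj).
  apply: le_avg => T; rewrite /F.
  have := inj_eq (@bk_inj g j) (h T i) (bi (bk g (h T k) l)).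
  by rewrite /= b2 => ->.
(* All diagonal collisions are the one event [h T i = h T k], so a common indicator leaves the
   squared sum. *)
have F0 T j j' : F j j T = F j' j' T.
  have eqh j1 : (bk g (h T i) j1 == bk g (h T k) j1) = (h T i == h T k).
    exact: (inj_eq (@bk_inj g j1)).
  by rewrite /F !eqh.
apply: (@le_trans _ _ (avg (fun T => 0 +
   ((\sum_j F j j T * G U V i j k j) ^+ 2 +
    2 * \sum_j \sum_(l | l != j) G U V i j k l ^+ 2 * F j l T)))).
  apply: le_avg => T; rewrite add0r.
  have := avg_chaos2 (fun j l => F j l T * G U V i j k l) 0.
  rewrite subr0; under eq_avg do rewrite subr0.
  move/le_trans; apply; rewrite lerD2l ler_wpM2l //.
  apply: ler_sum => j _; apply: ler_sum => l _.
  by rewrite exprMn natb_sqr mulrC.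
have [j0 _|noJ] := pickP (@predT J); last first.
  rewrite (eq_avg (g := fun=> 0)) => [|T].
    by rewrite avg_cst // big_pred0 // mul0r mulr0.
  by rewrite !big_pred0 // expr0n mulr0 !addr0.
rewrite (eq_avg (g := fun T => (\sum_j G U V i j k j) ^+ 2 * F j0 j0 T +
    2 * \sum_j \sum_(l | l != j) G U V i j k l ^+ 2 * F j l T)); last first.
  move=> T; rewrite add0r; congr (_ + _).
  rewrite (eq_bigr (fun j => F j0 j0 T * G U V i j k j)) => [|j _]; last first.
    by rewrite (F0 _ _ j0).
  by rewrite -mulr_sumr exprMn natb_sqr mulrC.
rewrite avgD !avgZ [3 * gam]mulrC -[leRHS]mulrA.
apply: le_trans (_ : _ <= gam * ((\sum_j G U V i j k j) ^+ 2 +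
   2 * \sum_j \sum_(l | l != j) G U V i j k l ^+ 2)) _.
  rewrite mulrDr; apply: lerD; first by rewrite [leLHS]mulrC ler_wpM2r ?sqr_ge0.
  rewrite [gam * _]mulrCA ler_wpM2l // avg_sum mulr_sumr; apply: ler_sum => j _.
  rewrite avg_sum mulr_sumr; apply: ler_sum => l _.
  by rewrite avgZ [leLHS]mulrC ler_wpM2r ?sqr_ge0.
by rewrite ler_wpM2l.
Qed.

Lemma step_variance U V :
  avg (fun th => (ip (step th U) (step th V) - ip3 U V) ^+ 2) <=
  8 * gam * (ip3 U U * ip3 V V).
Proof.
rewrite !avg_pair.
apply: (@le_trans _ _ (avg (fun g => avg (fun T => avg (fun tau =>
   (\sum_i B U V g T tau i i - ip3 U V) ^+ 2 +
   2 * \sum_i \sum_(k | k != i) B U V g T tau i k ^+ 2))))).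
  apply: le_avg => g; apply: le_avg => T; apply: le_avg => tau.
  under eq_avg do rewrite ip_step.
  exact: avg_chaos2.
under eq_avg do under eq_avg do rewrite avgD avgZ avg_sum.
under eq_avg do rewrite avgD avgZ avg_sum.
rewrite avgD avgZ avg_sum.
(* 8 = 2 + 2 * 3: the part [i = k], and twice the part [i != k] by the chaos bound for [sigma]. *)
have -> : 8 * gam * (ip3 U U * ip3 V V) = 2 * gam * (ip3 U U * ip3 V V) +
    2 * (3 * gam * (ip3 U U * ip3 V V)) by ring.
apply: lerD; first exact: diag_part.
rewrite ler_wpM2l //.
rewrite {1}ip3E ip3E mulr_suml mulr_sumr; apply: ler_sum => i _.
under eq_avg do (under eq_avg do rewrite avg_sum; rewrite avg_sum).
rewrite avg_sum !mulr_sumr [leRHS](bigID (fun k => k != i)) /= -[leLHS]addr0.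
apply: lerD.
  by apply: ler_sum => k ki; apply: offdiag_part.
apply: sumr_ge0 => k _.
by apply: mulr_ge0; [apply: mulr_ge0 | apply: mulr_ge0; apply: sumr_ge0].
Qed.

End Step.

(** * Composing independent steps *)

Lemma avg_cauchy_schwarz (R : realFieldType) (T : finType) (f g : T -> R) :
  avg (fun t => f t * g t) ^+ 2 <= avg (fun t => f t ^+ 2) * avg (fun t => g t ^+ 2).
Proof.
rewrite /avg exprMn [leRHS]mulrACA -[_^-1 * _]expr2; apply: ler_wpM2r; first exact: sqr_ge0.
exact: cauchy_schwarz_sum.
Qed.

Section Chain.
Variables (R : realFieldType) (I J TT GG : finType).
Variables (h : TT -> I -> I) (bk : GG -> I -> J -> I) (gam : R).
Variable i0 : I.
Hypotheses (TT0 : (0 < #|TT|)%N) (GG0 : (0 < #|GG|)%N) (gam_ge0 : 0 <= gam).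
Hypothesis h_unif : forall i k (phi : I -> I), i != k -> injective phi ->
  avg (fun T => (h T i == phi (h T k))%:R : R) <= gam.
Hypothesis bk_inj : forall g j, injective (bk g ^~ j).
Hypothesis bk_coll : forall g u v j l,
  (bk g u j == bk g u l) = (bk g v j == bk g v l).
Hypothesis bk_unif : forall u j l, j != l ->
  avg (fun g => (bk g u j == bk g u l)%:R : R) <= gam.

Local Notation rand := (step_rand I J TT GG).
Local Notation stp := (step (R := R) h bk).

(** The mean of a product is the product of the means plus a covariance, which Cauchy-Schwarz bounds
    by the geometric mean of the two variances. This controls the norms that the later steps start
    from. *)
Lemma step_norms (Q : finType) (U V : I -> J -> Q -> R) :
  avg (fun th => ip (stp th U) (stp th U) * ip (stp th V) (stp th V)) <=
  (1 + 8 * gam) * (ip3 U U * ip3 V V).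
Proof.
set x := ip3 U U; set y := ip3 V V.
have sq_ge0 (W : I -> J -> Q -> R) : 0 <= ip3 W W.
  apply: sumr_ge0 => i _; apply: sumr_ge0 => j _; apply: sumr_ge0 => q _.
  by rewrite -expr2 sqr_ge0.
have x0 : 0 <= x by apply: sq_ge0.
have y0 : 0 <= y by apply: sq_ge0.
pose a th := ip (stp th U) (stp th U) - x; pose b th := ip (stp th V) (stp th V) - y.
have mean0 (W : I -> J -> Q -> R) : avg (fun th => ip (stp th W) (stp th W) - ip3 W W) = 0.
  by rewrite avgD step_mean // avg_cst ?subrr // card_step_rand.
have va : avg (fun th => a th ^+ 2) <= 8 * gam * (x * x) by apply: step_variance.
have vb : avg (fun th => b th ^+ 2) <= 8 * gam * (y * y) by apply: step_variance.
rewrite (eq_avg (g := fun th => x * y + (x * b th + (y * a th + a th * b th)))); last first.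
  by move=> th; rewrite /a /b; ring.
rewrite !avgD !avgZ !mean0 !mulr0 !add0r avg_cst ?card_step_rand //.
rewrite mulrDl mul1r lerD2l.
have c0 : 0 <= 8 * gam * (x * y) by rewrite !mulr_ge0.
apply: le_trans (ler_norm _) _; rewrite -(@ler_pXn2r _ 2) ?nnegrE //.
rewrite real_normK ?num_real //; apply: le_trans (avg_cauchy_schwarz _ _) _.
have -> : (8 * gam * (x * y)) ^+ 2 = (8 * gam * (x * x)) * (8 * gam * (y * y)).
  by ring.
by apply: ler_pM => //; apply: avg_ge0 => th; apply: sqr_ge0.
Qed.

Fixpoint bucket (ths : seq rand) (js : seq J) (i : I) : I :=
  match ths, js with
  | (g, T, _, _) :: ths', j :: js' => bucket ths' js' (bk g (h T i) j)
  | _, _ => i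
  end.

Fixpoint csign (ths : seq rand) (js : seq J) (i : I) : R :=
  match ths, js with
  | (g, T, tau, sigma) :: ths', j :: js' =>
      sg R sigma i * sg R tau j * csign ths' js' (bk g (h T i) j)
  | _, _ => 1
  end.

(** In closed form each index [(i, js)] goes to one bucket with one sign, from which the matrix of
    the sketch can be read off; [chain_cons] recovers the composition of steps. *)
Definition chain (ths : seq rand) (p : nat) (U : I -> p.-tuple J -> R) (w : I) : R :=
  \sum_i \sum_(js : p.-tuple J) (bucket ths js i == w)%:R * csign ths js i * U i js.

Lemma chain0 (U : I -> 0.-tuple J -> R) w : chain [::] U w = U w [tuple].
Proof.
have E i : \sum_(js : 0.-tuple J) (bucket [::] js i == w)%:R * csign [::] js i * U i js =
    (i == w)%:R * U i [tuple].
  rewrite (bigD1 [tuple]) //= big1 ?addr0 ?mulr1 // => js.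
  by case/eqP; apply: tuple0.
rewrite /chain (eq_bigr _ (fun i _ => E i)) (bigD1 w) //= eqxx mul1r big1 ?addr0 //.
by move=> i /negPf->; rewrite mul0r.
Qed.

Lemma chain_cons th ths p (U : I -> p.+1.-tuple J -> R) w :
  chain (th :: ths) U w =
  chain ths (stp th (fun i j (js : p.-tuple J) => U i [tuple of j :: js])) w.
Proof.
case: th => [[[g T] tau] sigma]; rewrite /chain.
under eq_bigr do rewrite sum_tupleS.
transitivity (\sum_i \sum_j \sum_(js : p.-tuple J) \sum_u (bucket ths js u == w)%:R *
   csign ths js u * ((bk g (h T i) j == u)%:R *
     (sg R sigma i * sg R tau j * U i [tuple of j :: js]))).
  apply: eq_bigr => i _; apply: eq_bigr => j _; apply: eq_bigr => js _ /=.
  rewrite (bigD1 (bk g (h T i) j)) //= eqxx big1 ?addr0 => [|u]; first by rewrite mul1r; ring.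
  by rewrite eq_sym => /negPf->; rewrite mul0r mulr0.
rewrite /step.
under [RHS]eq_bigr do (under eq_bigr do
  (rewrite mulr_sumr; under eq_bigr do rewrite mulr_sumr)).
symmetry; rewrite exchange_big /=.
under eq_bigr do rewrite exchange_big /=.
rewrite exchange_big /=; apply: eq_bigr => i _.
under eq_bigr do (under eq_bigr do rewrite big_mkcond).
under eq_bigr do rewrite exchange_big /=.
rewrite exchange_big /=; apply: eq_bigr => j _.
by apply: eq_bigr.
Qed.

Definition dotp (A : finType) (u v : A -> R) := \sum_a u a * v a.

(** The first step is peeled off. Given it, the error of the others has mean zero around [y th], by
    the first half of the statement, so the two mean squares add. With [x = 1 + 8 * gam] the bounds
    combine as [x * (x ^+ p - 1) + (x - 1) = x ^+ p.+1 - 1]. *)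
Lemma chain_moments p (U V : I -> p.-tuple J -> R) :
  avg (fun ths : p.-tuple rand => dotp (chain ths U) (chain ths V)) = ip U V /\
  avg (fun ths : p.-tuple rand =>
    (dotp (chain ths U) (chain ths V) - ip U V) ^+ 2) <=
  ((1 + 8 * gam) ^+ p - 1) * (ip U U * ip V V).
Proof.
elim: p U V => [|p IH] U V.
  have E (W : I -> 0.-tuple J -> R) (ths : 0.-tuple rand) w : chain ths W w = W w [tuple].
    by rewrite [ths]tuple0 chain0.
  have E2 (ths : 0.-tuple rand) : dotp (chain ths U) (chain ths V) = ip U V.
    apply: eq_bigr => w _; rewrite !E (bigD1 [tuple]) //= big1 ?addr0 // => js.
    by case/eqP; apply: tuple0.
  under eq_avg do rewrite E2; under [X in _ /\ X <= _]eq_avg do rewrite E2 subrr expr0n.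
  rewrite !avg_cst ?card_tuple // subrr mul0r; split=> //.
pose U' i j (js : p.-tuple J) := U i [tuple of j :: js].
pose V' i j (js : p.-tuple J) := V i [tuple of j :: js].
have ipE (W W' : I -> p.+1.-tuple J -> R) : ip W W' =
    ip3 (fun i j (js : p.-tuple J) => W i [tuple of j :: js])
        (fun i j (js : p.-tuple J) => W' i [tuple of j :: js]).
  by apply: eq_bigr => i _; rewrite sum_tupleS.
have E th (ths : p.-tuple rand) :
    dotp (chain [tuple of th :: ths] U) (chain [tuple of th :: ths] V) =
    dotp (chain ths (stp th U')) (chain ths (stp th V')).
  by apply: eq_bigr => w _; rewrite !chain_cons.
rewrite !ipE -/U' -/V' !avg_tupleS; split.
  under eq_avg do (under eq_avg do rewrite E; rewrite (IH _ _).1).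
  by rewrite step_mean.
set z := ip3 U' V'; set N := _ * ip3 V' V'.
pose y th := ip (stp th U') (stp th V').
apply: (@le_trans _ _ (avg (fun th => ((1 + 8 * gam) ^+ p - 1) *
    (ip (stp th U') (stp th U') * ip (stp th V') (stp th V')) + (y th - z) ^+ 2))).
  apply: le_avg => th.
  pose Z (ths : p.-tuple rand) := dotp (chain ths (stp th U')) (chain ths (stp th V')).
  rewrite (eq_avg (g := fun ths => (Z ths - y th) ^+ 2 +
     ((2 * (y th - z)) * (Z ths - y th) + (y th - z) ^+ 2))); last first.
    by move=> ths; rewrite E -/(Z ths); ring.
  have rand0 : (0 < #|{: p.-tuple rand}|)%N.
    by rewrite card_tuple expn_gt0 card_step_rand.
  rewrite !avgD avgZ avgD (IH _ _).1 !avg_cst // subrr mulr0 add0r lerD2r.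
  exact: (IH _ _).2.
rewrite avgD avgZ exprS.
have -> : ((1 + 8 * gam) * (1 + 8 * gam) ^+ p - 1) * N =
   ((1 + 8 * gam) ^+ p - 1) * ((1 + 8 * gam) * N) + 8 * gam * N by ring.
apply: lerD; last exact: step_variance.
apply: ler_wpM2l; last exact: step_norms.
by rewrite subr_ge0 exprn_ege1 // lerDl mulr_ge0.
Qed.

End Chain.

(** * The hash functions *)

(* Bitwise exclusive or of the [l] lowest bits of [i] with those of [j]. *)
Fixpoint xr (l i j : nat) : nat :=
  if l is l'.+1 then ((xr l' i./2 j./2).*2 + (odd i (+) odd j))%N else i.

Lemma half_double_bit x (b : bool) : (x.*2 + b)./2 = x.
Proof. by rewrite addnC half_bit_double. Qed.

Lemma odd_double_bit x (b : bool) : odd (x.*2 + b) = b.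
Proof. by rewrite oddD odd_double oddb. Qed.

Lemma xrK l i j : xr l (xr l i j) j = i.
Proof.
elim: l i j => //= l IH i j.
by rewrite half_double_bit odd_double_bit addbK IH addnC odd_double_half.
Qed.

Lemma xr_inj l j : injective (xr l ^~ j).
Proof. by apply: (can_inj (g := xr l ^~ j)) => i; apply: xrK. Qed.

Lemma xr_eqr l i j k : (j < 2 ^ l)%N -> (k < 2 ^ l)%N ->
  (xr l i j == xr l i k) = (j == k).
Proof.
move=> jl kl; apply/eqP/eqP => [|->] //.
elim: l i j k jl kl => [|l IH] i j k /=; first by rewrite expn0; case: j k => [|?] [].
rewrite !expnS => jl kl E.
have /(congr1 odd) := E; rewrite !odd_double_bit => /addbI ojk.
have /(congr1 half) := E; rewrite !half_double_bit.
move=> /IH h; rewrite -(odd_double_half j) -(odd_double_half k) ojk h //; lia.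
Qed.

Lemma xr_lt l r i j : (l <= r)%N -> (i < 2 ^ r)%N -> (xr l i j < 2 ^ r)%N.
Proof.
elim: l r i j => //= l IH [|r] // i j lr ir; rewrite expnS in ir *.
have := IH r i./2 j./2 lr; case: (_ (+) _) => /=; lia.
Qed.

Section Hash.
Variables (R : realFieldType) (M' r l d : nat).
Local Notation M := M'.+1.

(* Any two indices differ in some bit [b], and the entry [T b] then makes their
   hash values independent.  The whole table of [h] costs O(1) per entry, by
   [hshD]. *)
Definition hsh (T : {ffun 'I_r -> 'I_M}) (i : nat) : 'I_M :=
  \sum_(b < r) T b *+ odd (i %/ 2 ^ b).

Lemma hsh0 T : hsh T 0 = 0.
Proof. by rewrite /hsh big1 // => b _; rewrite div0n. Qed.

Lemma hshD T (b : 'I_r) i : (i < 2 ^ b)%N -> hsh T (2 ^ b + i) = hsh T i + T b.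
Proof.
move=> ib; rewrite /hsh (bigD1 b) //= [in RHS](bigD1 b) //=.
rewrite divnDl // divnn expn_gt0 /= divn_small // addn0 mulr1n mulr0n add0r addrC.
congr (_ + _); apply: eq_bigr => c cb; congr (_ *+ nat_of_bool _).
have [cb'|bc] := ltnP c b.
  rewrite divnDl ?dvdn_exp2l 1?ltnW // -expnB ?(ltnW cb') // oddD.
  by rewrite oddX subn_eq0 leqNgt cb'.
have {cb bc} bc : (b < c)%N by rewrite ltn_neqAle bc andbT eq_sym.
have := leq_pexp2l (isT : (0 < 2)%N) bc; rewrite expnS => bc2.
by rewrite !divn_small //; lia.
Qed.

Lemma bits_inj i k : (i < 2 ^ r)%N -> (k < 2 ^ r)%N ->
  (forall b : 'I_r, odd (i %/ 2 ^ b) = odd (k %/ 2 ^ b)) -> i = k.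
Proof.
move=> ir kr H.
have {}H b : (b < r)%N -> odd (i %/ 2 ^ b) = odd (k %/ 2 ^ b).
  by move=> br; apply: (H (Ordinal br)).
elim: r i k ir kr H => [|s IH] i k; first by rewrite expn0; case: i k => [|?] [].
rewrite !expnS => ir kr H.
have o := H 0 isT; rewrite expn0 !divn1 in o.
rewrite -(odd_double_half i) -(odd_double_half k) o; congr (_ + _.*2)%N.
apply: IH; [lia | lia |] => b bs.
by have := H b.+1 bs; rewrite expnS !divnMA !divn2.
Qed.

Definition shift (A : finType) (b : A) (v : 'I_M) (T : {ffun A -> 'I_M}) :=
  [ffun c => T c + (if c == b then v else 0)].

Lemma shift_inj (A : finType) (b : A) v : injective (shift b v).
Proof.
move=> S T /ffunP e; apply/ffunP => c; have := e c; rewrite !ffunE.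
exact: addIr.
Qed.

Lemma hsh_shift b v T i : hsh (shift b v T) i = hsh T i + v *+ odd (i %/ 2 ^ b).
Proof.
rewrite /hsh.
under eq_bigr do rewrite ffunE mulrnDl.
rewrite big_split /=; congr (_ + _); rewrite (bigD1 b) //= eqxx big1 ?addr0 //.
by move=> c /negPf->; rewrite mul0rn.
Qed.

Lemma one_of (u w : 'I_M) (f : 'I_M -> 'I_M) : injective f ->
  \sum_v (u == f (w + v))%:R = 1 :> R.
Proof.
move=> finj; have [f' ff' f'f] := injF_bij finj.
rewrite (bigD1 (f' u - w)) //= [w + _]addrC subrK f'f eqxx big1 ?addr0 // => v vn.
case: eqP => // e; case/eqP: vn; rewrite e ff'.
by rewrite addrC addrA addNr add0r.
Qed.

Hypotheses (HM : M = (2 ^ r)%N) (lr : (l <= r)%N).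
(** The [l] low bits must hold every value of the second hash function: below [d] if coordinates are
    kept, below [M] if they are hashed. *)
Hypothesis Hd : if (d <= M)%N then (d <= 2 ^ l)%N else l == r.

(** Shifting [T b] moves exactly one of the two hash values, and exactly one of the [M] shifts
    produces a collision. *)
Lemma hsh_unif (i k : 'I_M) (phi : 'I_M -> 'I_M) : i != k -> injective phi ->
  avg (fun T => (hsh T i == phi (hsh T k))%:R : R) <= M%:R^-1.
Proof.
move=> ik phi_inj.
have [b bik] : exists b : 'I_r, odd (i %/ 2 ^ b) != odd (k %/ 2 ^ b).
  apply/existsP; apply: contraNT ik; rewrite negb_exists => /forallP h.
  apply/eqP/val_inj/bits_inj; rewrite -?HM //= => b.
  by apply/eqP; have := h b; rewrite negbK.
rewrite (avg_one_translate (I := 'I_M) (sh := shift b)) ?card_ord //.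
- exact: shift_inj.
- move=> T; under eq_bigr do rewrite !hsh_shift.
  move: bik; case: (odd (i %/ _)); case: (odd (k %/ _)) => // _.
    under eq_bigr do rewrite mulr1n mulr0n addr0 eq_sym.
    exact: (one_of _ _ (f := id)).
  under eq_bigr do rewrite mulr1n mulr0n addr0.
  exact: one_of.
- by rewrite card_ffun !card_ord expn_gt0.
Qed.

(* When the coordinates of the input fit into the buckets they are not hashed:
   a collision then needs two distinct values of the other hash function. *)
Definition gidx (g : {ffun 'I_d -> 'I_M}) (j : 'I_d) : nat :=
  if (d <= M)%N then val j else val (g j).

Lemma gidx_lt g j : (gidx g j < 2 ^ l)%N.
Proof.
rewrite /gidx; move: Hd; case: ifP => [_|_ /eqP->]; last by rewrite -HM ltn_ord.
exact: leq_trans (ltn_ord j).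
Qed.

Definition bk (g : {ffun 'I_d -> 'I_M}) (u : 'I_M) (j : 'I_d) : 'I_M :=
  inord (xr l u (gidx g j)).

Lemma val_bk g u j : bk g u j = xr l u (gidx g j) :> nat.
Proof. by rewrite inordK // [X in (_ < X)%N]HM xr_lt // -HM. Qed.

Lemma bk_inj g j : injective (bk g ^~ j).
Proof. by move=> u v /(congr1 val); rewrite /= !val_bk => /xr_inj/val_inj. Qed.

Lemma bk_eq g u j k : (bk g u j == bk g u k) = (gidx g j == gidx g k).
Proof. by rewrite -val_eqE /= !val_bk xr_eqr // gidx_lt. Qed.

Lemma bk_coll g u v j k : (bk g u j == bk g u k) = (bk g v j == bk g v k).
Proof. by rewrite !bk_eq. Qed.

Lemma bk_unif u j k : j != k ->
  avg (fun g => (bk g u j == bk g u k)%:R : R) <= M%:R^-1.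
Proof.
move=> jk; under eq_avg do rewrite bk_eq.
have card0 : (0 < #|{: {ffun 'I_d -> 'I_M}}|)%N by rewrite card_ffun !card_ord expn_gt0.
rewrite /gidx; case: (d <= M)%N.
  by rewrite avg_cst // (_ : (_ == _) = false) ?invr_ge0 //; apply: negbTE.
rewrite (eq_avg (g := fun g : {ffun 'I_d -> 'I_M} => (g j == g k)%:R)) //.
rewrite (avg_one_translate (I := 'I_M) (sh := shift k)) ?card_ord //.
  exact: shift_inj.
move=> g; under eq_bigr do rewrite !ffunE (negPf jk) eqxx addr0.
exact: (one_of _ _ (f := id)).
Qed.

Definition sketch_rand := step_rand 'I_M 'I_d {ffun 'I_r -> 'I_M} {ffun 'I_d -> 'I_M}.
Definition hash (T : {ffun 'I_r -> 'I_M}) (i : 'I_M) := hsh T i.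

Definition hchain (p : nat) (ths : seq sketch_rand) :=
  @chain R 'I_M 'I_d _ _ hash bk ths p.

Lemma hchain_moments p (U V : 'I_M -> p.-tuple 'I_d -> R) :
  avg (fun ths : p.-tuple sketch_rand => dotp (hchain ths U) (hchain ths V)) = ip U V /\
  avg (fun ths : p.-tuple sketch_rand =>
    (dotp (hchain ths U) (hchain ths V) - ip U V) ^+ 2) <=
  ((1 + 8 / M%:R) ^+ p - 1) * (ip U U * ip V V).
Proof.
apply: chain_moments.
- exact: ord0.
- by rewrite card_ffun !card_ord expn_gt0.
- by rewrite card_ffun !card_ord expn_gt0.
- by rewrite invr_ge0.
- by move=> *; apply: hsh_unif.
- exact: bk_inj.
- exact: bk_coll.
- exact: bk_unif.
Qed.

Lemma hchain_variance p (U V : 'I_M -> p.-tuple 'I_d -> R) : 16 * p%:R <= M%:R :> R ->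
  avg (fun ths : p.-tuple sketch_rand =>
    (dotp (hchain ths U) (hchain ths V) - ip U V) ^+ 2) <=
  16 * p%:R / M%:R * (ip U U * ip V V).
Proof.
move=> pM; apply: le_trans (hchain_moments U V).2 _.
have ip0 (W : 'I_M -> p.-tuple 'I_d -> R) : 0 <= ip W W.
  by apply: sumr_ge0 => i _; apply: sumr_ge0 => j _; rewrite -expr2 sqr_ge0.
apply: ler_wpM2r; first exact: mulr_ge0.
have M0 : 0 < M%:R :> R by [].
set a := 8 / M%:R; have a0 : 0 <= a by rewrite divr_ge0.
(* The condition on [M] puts [p * a] below 1/2, where [(1 + a) ^+ p - 1] is at most [2 * (p * a)];
   16 is 2 * 8. *)
have -> : 16 * p%:R / M%:R = 2 * (p%:R * a) by rewrite /a; set Mi := _^-1; ring.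
have pa : p%:R * a <= 1 / 2.
  by rewrite /a mulrA ler_pdivrMr //; lra.
suff : forall k : nat, k%:R * a <= 1 / 2 -> (1 + a) ^+ k <= 1 + 2 * (k%:R * a).
  by move/(_ p pa); lra.
(* [(1 + a) ^ k <= 1 / (1 - k a)] by induction, and [1 / (1 - x) <= 1 + 2 x] on [0, 1/2] *)
move=> k ka; have H : (1 + a) ^+ k * (1 - k%:R * a) <= 1.
  elim: k ka => [|k IH] ka; first by rewrite expr0 mul0r subr0 mulr1.
  rewrite -natr1 in ka *; have ka' : 0 <= k%:R * a by rewrite mulr_ge0.
  have kk := IH ltac:(lra); have pos : 0 <= (1 + a) ^+ k by rewrite exprn_ge0 //; lra.
  have le0 : 0 <= (1 + a) ^+ k * ((k%:R * a + a) * a) by rewrite !mulr_ge0 // addr_ge0.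
  rewrite exprSr; move: kk le0; set P := _ ^+ k; set x := k%:R; lra.
have ka' : 0 <= k%:R * a by rewrite mulr_ge0.
have pos : 0 <= (1 + a) ^+ k by rewrite exprn_ge0 //; lra.
nra.
Qed.

End Hash.

(** * From Frobenius errors to spectral guarantees *)

Section Cholesky.
Variable R : realType.

Definition posdef n (K : 'M[R]_n) := forall x : 'cV[R]_n, x != 0 -> 0 < (x^T *m K *m x) 0 0.

(** The factor serves as a square root of [K]: the embedding reduction relies only on [K = L *m L^T]
    with [L] invertible. The induction passes to the Schur complement [S]. *)
Lemma cholesky n (K : 'M[R]_n) : K^T = K -> posdef K ->
  exists L : 'M[R]_n, L \in unitmx /\ K = L *m L^T.
Proof.
elim: n K => [|n IH] K symK posK.
  by exists 1%:M; rewrite unitmx1; split=> //; rewrite [LHS]flatmx0 [RHS]flatmx0.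
rewrite -[n.+1]/(1 + n)%N in K symK posK *.
pose b : 'M[R]_(n, 1) := dlsubmx K; pose C : 'M[R]_n := drsubmx K; pose a := ulsubmx K 0 0.
have KE : K = block_mx a%:M b^T b C.
  by rewrite -[LHS]submxK -mx11_scalar /b trmx_dlsub symK.
have symC : C^T = C by rewrite /C trmx_drsub symK.
have form t (y : 'cV[R]_n) : ((col_mx t%:M y)^T *m K *m col_mx t%:M y) 0 0 =
    a * t ^+ 2 + 2 * t * (b^T *m y) 0 0 + (y^T *m C *m y) 0 0.
  rewrite KE tr_col_mx mul_row_block mul_row_col tr_scalar_mx.
  rewrite !mulmxDl !mul_scalar_mx -!scalemxAl !mul_mx_scalar.
  have -> : y^T *m b = (b^T *m y)^T by rewrite trmx_mul trmxK.
  rewrite !mxE /= !mulr1n; ring.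
have a0 : 0 < a.
  have := posK (col_mx 1%:M 0); rewrite form !mulmx0 mxE mulr0 !addr0 expr1n mulr1.
  apply; apply/eqP => /(congr1 (fun v : 'cV_(1 + n) => v (lshift n 0) 0)).
  by rewrite col_mxEu !mxE => /eqP; rewrite oner_eq0.
pose S := C - a^-1 *: (b *m b^T).
have [||L' [L'u SE]] := IH S.
- by rewrite /S linearB /= linearZ /= trmx_mul trmxK symC.
(* For given [y] this top entry minimizes the form of [K], and the minimum is the form of [S]. *)
- move=> y y0; have := posK (col_mx (- (b^T *m y) 0 0 / a)%:M y); rewrite form.
  have -> : (y^T *m S *m y) 0 0 = (y^T *m C *m y) 0 0 - (b^T *m y) 0 0 ^+ 2 / a.
    have -> : y^T *m S *m y = y^T *m C *m y - a^-1 *: ((b^T *m y)^T *m (b^T *m y)).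
      by rewrite /S mulmxBr mulmxBl -scalemxAr -scalemxAl trmx_mul trmxK !mulmxA.
    rewrite [LHS]mxE; congr (_ + _); rewrite [LHS]mxE [X in - X]mxE; congr (- _).
    by rewrite [X in _ * X]mxE big_ord1 [(_^T) _ _]mxE expr2 mulrC.
  have -> : a * (- (b^T *m y) 0 0 / a) ^+ 2 + 2 * (- (b^T *m y) 0 0 / a) * (b^T *m y) 0 0 +
      (y^T *m C *m y) 0 0 = (y^T *m C *m y) 0 0 - (b^T *m y) 0 0 ^+ 2 / a.
    by field; rewrite gt_eqF.
  apply; apply: contraNneq y0 => /(congr1 (@dsubmx _ 1 n 1)).
  by rewrite col_mxKd => ->; rewrite linear0.
pose s := Num.sqrt a; have s0 : 0 < s by rewrite sqrtr_gt0.
have ss : s * s = a by rewrite -expr2 sqr_sqrtr // ltW.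
exists (block_mx s%:M 0 (s^-1 *: b) L'); split.
  rewrite unitmxE det_lblock det_scalar1 unitrM unitfE gt_eqF //=.
rewrite KE tr_block_mx mulmx_block !trmx0 tr_scalar_mx !mulmx0 !mul0mx !addr0.
congr block_mx.
- by rewrite -scalar_mxM ss.
- by rewrite mul_scalar_mx linearZ /= scalerA divff ?gt_eqF // scale1r.
- by rewrite mul_mx_scalar scalerA divff ?gt_eqF // scale1r.
rewrite linearZ /= -scalemxAl -scalemxAr scalerA -invfM ss -SE /S.
by rewrite addrC subrK.
Qed.

End Cholesky.

Section Loewner.
Variable R : realType.

Lemma frobenius_sqr a b (M : 'M[R]_(a, b)) :
  frobenius M ^+ 2 = \sum_i \sum_j M i j ^+ 2.
Proof.
by rewrite sqr_sqrtr //; apply: sumr_ge0 => i _; apply: sumr_ge0 => j _; apply: sqr_ge0.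
Qed.

Lemma frobenius_ge0 a b (M : 'M[R]_(a, b)) : 0 <= frobenius M.
Proof. exact: sqrtr_ge0. Qed.

Lemma frobenius_tr a b (M : 'M[R]_(a, b)) : frobenius M ^+ 2 = \tr (M^T *m M).
Proof.
rewrite frobenius_sqr /mxtrace exchange_big; apply: eq_bigr => j _.
by rewrite mxE; apply: eq_bigr => i _; rewrite mxE expr2.
Qed.

(** Cauchy-Schwarz between [N] and the rank-one matrix of the products [y i * y j]. *)
Lemma form_le_frobenius n (N : 'M[R]_n) (y : 'cV[R]_n) :
  `|(y^T *m N *m y) 0 0| <= frobenius N * (y^T *m y) 0 0.
Proof.
have yy : (y^T *m y) 0 0 = \sum_i y i 0 ^+ 2.
  by rewrite mxE; apply: eq_bigr => i _; rewrite mxE expr2.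
have yy0 : 0 <= (y^T *m y) 0 0 by rewrite yy sumr_ge0 // => i _; apply: sqr_ge0.
rewrite -(@ler_pXn2r _ 2) ?nnegrE ?mulr_ge0 ?frobenius_ge0 //.
rewrite real_normK ?num_real // exprMn frobenius_sqr.
have -> : (y^T *m N *m y) 0 0 = \sum_(p : 'I_n * 'I_n) N p.1 p.2 * (y p.1 0 * y p.2 0).
  rewrite -(pair_bigA _ (fun i j => N i j * (y i 0 * y j 0))) exchange_big mxE /=.
  apply: eq_bigr => j _; rewrite mxE mulr_suml; apply: eq_bigr => i _.
  by rewrite mxE; ring.
apply: le_trans (cauchy_schwarz_sum _ _) _.
rewrite -(pair_bigA _ (fun i j => N i j ^+ 2)) /= ler_wpM2l //.
  by apply: sumr_ge0 => i _; apply: sumr_ge0 => j _; apply: sqr_ge0.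
rewrite -(pair_bigA _ (fun i j => (y i 0 * y j 0) ^+ 2)) /= yy expr2 big_distrlr /=.
by apply: ler_sum => i _; apply: ler_sum => j _; rewrite exprMn.
Qed.

Lemma form_gram a n (A : 'M[R]_(a, n)) (x : 'cV[R]_n) :
  0 <= (x^T *m (A^T *m A) *m x) 0 0.
Proof.
rewrite mulmxA -mulmxA -trmx_mul mxE sumr_ge0 // => i _.
by rewrite mxE -expr2 sqr_ge0.
Qed.

Lemma form_shift n (N : 'M[R]_n) (lambda : R) (x : 'cV[R]_n) :
  (x^T *m (N + lambda%:M) *m x) 0 0 = (x^T *m N *m x) 0 0 + lambda * (x^T *m x) 0 0.
Proof. by rewrite mulmxDr mulmxDl mul_mx_scalar -scalemxAl !mxE. Qed.

(* With [A^T A + lambda = L L^T] and [U = A L^-T], the approximation error of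
   [A^T A] relative to [A^T A + lambda] is the Frobenius error on [U^T U], and
   [|U|_F^2] is the statistical dimension. *)
Lemma embedding_reduction D n (A : 'M[R]_(D, n)) (lambda : R) : 0 < lambda ->
  let K := A^T *m A + lambda%:M in
  exists2 U : 'M[R]_(D, n), frobenius U ^+ 2 = statdim lambda (A^T *m A) &
  forall m (Pi : 'M[R]_(m, D)) (eps : R),
    frobenius (U^T *m Pi^T *m Pi *m U - U^T *m U) <= eps ->
    let K' := (Pi *m A)^T *m (Pi *m A) + lambda%:M in
    loewner_le ((1 - eps) *: K) K' /\ loewner_le K' ((1 + eps) *: K).
Proof.
move=> l0 K.
have [||L [Lu KE]] := @cholesky R n K.
- by rewrite linearD /= trmx_mul trmxK tr_scalar_mx.
- move=> x x0; rewrite form_shift ltr_wpDl ?form_gram // mulr_gt0 //.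
  rewrite mxE; have [i xi] : exists i, x i 0 != 0.
    apply/existsP; apply: contraNT x0; rewrite negb_exists => /forallP h.
    by apply/eqP/colP => i; have := h i; rewrite negbK mxE => /eqP.
  rewrite (bigD1 i) //= mxE ltr_pwDl //.
    by rewrite -expr2 exprn_even_gt0.
  by rewrite sumr_ge0 // => j _; rewrite mxE -expr2 sqr_ge0.
have Lut : L^T \in unitmx by rewrite unitmx_tr.
pose U := A *m invmx L^T; have UL : U *m L^T = A by rewrite /U mulmxKV.
exists U.
  have Ku : K \in unitmx by rewrite KE unitmx_mul Lu Lut.
  have KV : invmx K = invmx L^T *m invmx L.
    rewrite -[RHS](mulKmx Ku) [in X in _ *m X]KE -mulmxA [L^T *m _]mulmxA.
    by rewrite mulmxV // mul1mx mulmxV // mulmx1.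
  rewrite frobenius_tr /statdim -/K KV /U trmx_mul trmx_inv trmxK.
  by rewrite -!mulmxA mxtrace_mulC !mulmxA.
move=> m Pi eps Ple.
have formE (x : 'cV[R]_n) : (x^T *m ((Pi *m A)^T *m (Pi *m A) + lambda%:M) *m x) 0 0 =
    (x^T *m K *m x) 0 0 +
    ((L^T *m x)^T *m (U^T *m Pi^T *m Pi *m U - U^T *m U) *m (L^T *m x)) 0 0.
  rewrite /K !form_shift addrAC; congr (_ + _); rewrite -{1 2}UL -{1 2}UL.
  have addB (P Q : 'M[R]_1) : P 0 0 = Q 0 0 + (P - Q) 0 0.
    by rewrite !mxE; ring.
  by rewrite mulmxBr mulmxBl !trmx_mul !trmxK !mulmxA; apply: addB.
have KL (x : 'cV[R]_n) : (x^T *m K *m x) 0 0 = ((L^T *m x)^T *m (L^T *m x)) 0 0.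
  by rewrite KE trmx_mul trmxK !mulmxA.
have bnd (x : 'cV[R]_n) : `|((L^T *m x)^T *m (U^T *m Pi^T *m Pi *m U - U^T *m U) *m (L^T *m x)) 0 0| <=
    eps * (x^T *m K *m x) 0 0.
  apply: le_trans (form_le_frobenius _ _) _; rewrite KL ler_wpM2r //.
  by rewrite mxE sumr_ge0 // => i _; rewrite mxE -expr2 sqr_ge0.
have scal (x : 'cV[R]_n) c : (x^T *m (c *: K) *m x) 0 0 = c * (x^T *m K *m x) 0 0.
  by rewrite -scalemxAr -scalemxAl mxE.
by split=> x; rewrite scal formE; have := bnd x; rewrite ler_norml => /andP[]; lra.
Qed.

(** On the whitened matrix [U] the zero sketch errs by [U^T *m U], whose Frobenius norm is at most
    the square of that of [U], the statistical dimension. *)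
Lemma zero_embedding D n m (A : 'M[R]_(D, n)) (lambda eps : R) : 0 < lambda ->
  statdim lambda (A^T *m A) <= eps ->
  let K := A^T *m A + lambda%:M in
  let K' := ((0 : 'M[R]_(m, D)) *m A)^T *m (0 *m A) + lambda%:M in
  loewner_le ((1 - eps) *: K) K' /\ loewner_le K' ((1 + eps) *: K).
Proof.
move=> l0 sd; have [U Usd H] := embedding_reduction A l0.
apply: H; rewrite !(mulmx0, mul0mx) sub0r.
have sd0 : 0 <= eps by apply: le_trans sd; rewrite -Usd sqr_ge0.
rewrite -(@ler_pXn2r _ 2) ?nnegrE ?frobenius_ge0 // frobenius_sqr.
apply: (@le_trans _ _ ((frobenius U ^+ 2) ^+ 2)); last first.
  by rewrite ler_pXn2r ?nnegrE ?sqr_ge0 // Usd.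
have UE : frobenius U ^+ 2 = \sum_j \sum_k U k j ^+ 2.
  by rewrite frobenius_sqr exchange_big.
rewrite [leRHS]expr2 UE big_distrlr /=.
apply: ler_sum => i _; apply: ler_sum => j _; rewrite !mxE sqrrN.
apply: le_trans (_ : _ <= (\sum_k U^T i k ^+ 2) * (\sum_k U k j ^+ 2)) _.
  exact: cauchy_schwarz_sum.
by rewrite (eq_bigr (fun k => U k i ^+ 2)) // => k _; rewrite mxE.
Qed.

(** The factor [1 - eps] is at most 0, and [lambda] times the identity lies below [K]. *)
Lemma zero_embedding_eps1 D n m (A : 'M[R]_(D, n)) (lambda eps : R) : 0 < lambda -> 1 <= eps ->
  let K := A^T *m A + lambda%:M in
  let K' := ((0 : 'M[R]_(m, D)) *m A)^T *m (0 *m A) + lambda%:M in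
  loewner_le ((1 - eps) *: K) K' /\ loewner_le K' ((1 + eps) *: K).
Proof.
move=> l0 e1 K K'.
have xx (x : 'cV[R]_n) : 0 <= lambda * (x^T *m x) 0 0.
  apply: mulr_ge0 (ltW l0) _; rewrite mxE sumr_ge0 // => i _.
  by rewrite mxE -expr2 sqr_ge0.
have K'E (x : 'cV[R]_n) : (x^T *m K' *m x) 0 0 = lambda * (x^T *m x) 0 0.
  by rewrite form_shift mul0mx mulmx0 mulmx0 mul0mx [X in X + _]mxE add0r.
have KE (x : 'cV[R]_n) c : (x^T *m (c *: K) *m x) 0 0 =
    c * ((x^T *m (A^T *m A) *m x) 0 0 + lambda * (x^T *m x) 0 0).
  by rewrite -form_shift -scalemxAr -scalemxAl mxE.
by split=> x; rewrite K'E KE; have := xx x; have := form_gram A x; nra.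
Qed.

End Loewner.

(** * The random matrix and its law *)

Section RandomMatrix.
Variables (R : realType) (T : finType) (m D : nat) (Pi : T -> 'M[R]_(m, D)) (gam : R).
Hypothesis T0 : (0 < #|T|)%N.
Hypothesis moment : forall x y : 'cV[R]_D,
  avg (fun t => (\sum_w (Pi t *m x) w 0 * (Pi t *m y) w 0 - \sum_a x a 0 * y a 0) ^+ 2) <=
  gam * ((\sum_a x a 0 ^+ 2) * (\sum_a y a 0 ^+ 2)).

(** Each entry of the error matrix is the inner product error of a pair of columns, and the sum of
    the bounds over all pairs factors. *)
Lemma frobenius_moment n (C E : 'M[R]_(D, n)) :
  avg (fun t => frobenius (C^T *m (Pi t)^T *m Pi t *m E - C^T *m E) ^+ 2) <=
  gam * (frobenius C ^+ 2 * frobenius E ^+ 2).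
Proof.
have cE (F : 'M[R]_(D, n)) : frobenius F ^+ 2 = \sum_j \sum_a (col j F) a 0 ^+ 2.
  rewrite frobenius_sqr exchange_big; apply: eq_bigr => j _.
  by apply: eq_bigr => a _; rewrite mxE.
rewrite !cE big_distrlr /= mulr_sumr; under eq_avg do rewrite frobenius_sqr.
rewrite avg_sum; apply: ler_sum => i _; rewrite avg_sum mulr_sumr; apply: ler_sum => j _.
apply: le_trans (moment _ _); rewrite le_eqVlt; apply/orP; left; apply/eqP.
apply: eq_avg => t; congr (_ ^+ 2).
have -> : C^T *m (Pi t)^T *m Pi t *m E = (Pi t *m C)^T *m (Pi t *m E).
  by rewrite trmx_mul !mulmxA.
rewrite mxE; congr (_ + _); first rewrite mxE; last rewrite mxE [in LHS]mxE; last congr (- _).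
  by apply: eq_bigr => w _; rewrite !mxE; congr (_ * _); apply: eq_bigr => a _; rewrite mxE.
by apply: eq_bigr => w _; rewrite !mxE.
Qed.

Lemma markov_avg (f : T -> R) (A : T -> Prop) (b delta : R) : 0 < b -> (forall t, 0 <= f t) ->
  avg f <= delta * b -> (forall t, f t <= b -> A t) ->
  1 - delta <= avg (fun t => (`[< A t >])%:R).
Proof.
move=> b0 f0 fb fA.
have H : 1 - avg f / b <= avg (fun t => (`[< A t >])%:R).
  have -> : 1 - avg f / b = avg (fun t => 1 + - (b^-1 * f t)).
    by rewrite avgD avg_cst // avgN avgZ mulrC.
  apply: le_avg => t; have [ft|ft] := leP (f t) b.
    have -> : `[< A t >] by apply/asboolP/fA.
    by rewrite gerBl mulr_ge0 ?invr_ge0 // ltW.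
  apply: (@le_trans _ _ 0); last exact: ler0n.
  by rewrite subr_le0 mulrC ler_pdivlMr // mul1r ltW.
apply: le_trans H; rewrite lerB // ler_pdivrMr //; exact: fb.
Qed.

End RandomMatrix.

(** * Coordinates of a tensor power *)

Section TensorIndex.
Variables (R : realType) (d : nat).

(** The sketch is defined through the bijection [f], so the order in which the Kronecker power lists
    its coordinates never has to be computed. *)
Lemma ntensmx_rec_index k : exists2 f : 'I_(d ^ k.+1) -> k.+1.-tuple 'I_d, bijective f &
  forall (v : 'cV[R]_d) a b, ntensmx_rec v k a b = \prod_(j <- f a) v j 0.
Proof.
elim: k => [|k [f f_bij fE]].
  exists (fun a : 'I_(d ^ 1) => [tuple (a : 'I_d)]).
    exists (fun t : 1.-tuple 'I_d => tnth t ord0) => [a //|t].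
    by apply: val_inj; case: t => [[|x [|]]].
  by move=> v a b; rewrite /= big_seq1 [b]ord1.
case: f_bij => f' ff' f'f.
exists (fun a : 'I_(d * d ^ k.+1) =>
   [tuple of (mxtens_unindex a).1 :: f (mxtens_unindex a).2]).
  exists (fun t : k.+2.-tuple 'I_d => mxtens_index (thead t, f' [tuple of behead t])).
    move=> a; rewrite -[RHS]mxtens_unindexK; congr mxtens_index.
    rewrite [RHS]surjective_pairing; congr pair.
    by rewrite -[RHS]ff'; congr f'; apply: val_inj.
  by move=> t; rewrite mxtens_indexK f'f [RHS]tuple_eta; apply: val_inj.
move=> v a b; rewrite [LHS]mxE big_cons fE; congr (v _ _ * _).
by apply: val_inj => /=; rewrite -[LHS]/(b %/ 1 ^ k.+1)%N; case: b => b /=; rewrite !exp1n; case: b.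
Qed.

Lemma self_tensor_index p : exists2 f : 'I_(d ^ p) -> p.-tuple 'I_d, bijective f &
  forall (v : 'cV[R]_d) a, self_tensor p v a 0 = \prod_(j <- f a) v j 0.
Proof.
case: p => [|p].
  exists (fun=> [tuple]).
    exists (fun=> ord0) => [a|t]; last by rewrite [RHS]tuple0.
    by rewrite [a]ord1.
  by move=> v a; rewrite big_nil castmxE /= mxE [cast_ord _ a]ord1 [cast_ord _ 0]ord1.
have [f f_bij fE] := ntensmx_rec_index p; exists f => // v a.
by rewrite castmxE fE cast_ord_id.
Qed.

End TensorIndex.

(** * The sketching matrix and its second moment *)

Section Sketch.
Variables (R : realType) (M' r l d : nat).
Local Notation M := M'.+1.
Hypotheses (HM : M = (2 ^ r)%N) (lr : (l <= r)%N).
Hypothesis Hd : if (d <= M)%N then (d <= 2 ^ l)%N else l == r.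
Variables (m p : nat) (f : 'I_(d ^ p) -> p.-tuple 'I_d).
Hypotheses (Mm : (M <= m)%N) (f_bij : bijective f).
Local Notation rand := (sketch_rand M' r d).
Local Notation hash := (@hash M' r).
Local Notation bk := (@bk M' l d).

(** The chain starts from the unit vector at bucket [ord0]. Rows from [M] on are zero, as [m] may
    fall between two powers of two. *)
Definition sketch_mx (ths : p.-tuple rand) : 'M[R]_(m, d ^ p) :=
  \matrix_(w, a) ((val (bucket hash bk ths (f a) ord0) == w)%:R *
    csign R hash bk ths (f a) ord0).

(** Stated for any [u] that agrees with the unit vector tensored with [x], so that it also applies
    to a pure tensor written as a product. *)
Lemma sketch_mxE ths (x : 'cV[R]_(d ^ p)) (u : 'I_M -> p.-tuple 'I_d -> R) w :
  (forall i a, u i (f a) = (i == ord0)%:R * x a 0) ->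
  (sketch_mx ths *m x) w 0 =
  if insub (val w) is Some w' then hchain l (p := p) ths u w' else 0.
Proof.
move=> uE; rewrite mxE.
case: insubP => [w' _ ww'|wM]; last first.
  rewrite big1 // => a _; rewrite mxE; case: eqP => [e|_]; last by rewrite !mul0r.
  by case/negP: wM; rewrite /= -e ltn_ord.
rewrite /hchain /chain (bigD1 ord0) //= [X in _ + X]big1 ?addr0; last first.
  move=> i /negPf i0; rewrite (reindex f) /=; last exact: onW_bij.
  by rewrite big1 // => a _; rewrite uE i0 mul0r mulr0.
rewrite [RHS](reindex f) /=; last exact: onW_bij.
apply: eq_bigr => a _; rewrite mxE uE eqxx mul1r -ww'.
by rewrite -val_eqE.
Qed.

Lemma sketch_moment (x y : 'cV[R]_(d ^ p)) : 16 * p%:R <= M%:R :> R ->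
  avg (fun ths => (\sum_w (sketch_mx ths *m x) w 0 * (sketch_mx ths *m y) w 0
                   - \sum_a x a 0 * y a 0) ^+ 2) <=
  16 * p%:R / M%:R * ((\sum_a x a 0 ^+ 2) * (\sum_a y a 0 ^+ 2)).
Proof.
move=> pM; have [f' ff' f'f] := f_bij.
pose emb (z : 'cV[R]_(d ^ p)) (i : 'I_M) js := (i == ord0)%:R * z (f' js) 0.
have embE z i a : emb z i (f a) = (i == ord0)%:R * z a 0 by rewrite /emb ff'.
have ipE (z z' : 'cV[R]_(d ^ p)) : ip (emb z) (emb z') = \sum_a z a 0 * z' a 0.
  rewrite /ip (bigD1 ord0) //= [X in _ + X]big1 ?addr0; last first.
    by move=> i /negPf i0; rewrite big1 // => js _; rewrite /emb i0 !mul0r.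
  rewrite (reindex f) /=; last exact: onW_bij.
  by apply: eq_bigr => a _; rewrite !embE !mul1r.
have dotE ths : \sum_w (sketch_mx ths *m x) w 0 * (sketch_mx ths *m y) w 0 =
    dotp (hchain l (p := p) ths (emb x)) (hchain l (p := p) ths (emb y)).
  pose F w := if insub w is Some w' then
    hchain l (p := p) ths (emb x) w' * hchain l (p := p) ths (emb y) w' else 0.
  transitivity (\sum_(w < m) F w).
    apply: eq_bigr => w _; rewrite (sketch_mxE _ _ (embE x)) (sketch_mxE _ _ (embE y)) /F.
    by case: insubP => //= _; rewrite mulr0.
  rewrite -(big_mkord xpredT) (big_cat_nat (n := M)) //= [X in _ + X]big_nat_cond.
  rewrite [X in _ + X]big1 ?addr0 => [|w /andP[/andP[Mw _] _]]; last first.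
    by rewrite /F insubF // ltnNge Mw.
  by rewrite big_mkord; apply: eq_bigr => w _; rewrite /F valK.
under eq_avg do rewrite dotE -ipE.
have -> : (\sum_a x a 0 ^+ 2) * (\sum_a y a 0 ^+ 2) = ip (emb x) (emb x) * ip (emb y) (emb y).
  by rewrite !ipE.
exact: hchain_variance.
Qed.

End Sketch.

(** * The law of a matrix drawn with fair coins *)

Section CoinLaw.
Variables (R : realType) (m D L : nat) (Pi : L.-tuple bool -> 'M[R]_(m, D)).
Local Notation mxT := (g_sigma_algebraType (@open 'M[R]_(m, D))).

Let coins_ge0 : 0 <= (2 ^+ L)^-1 :> R.
Proof. by rewrite invr_ge0 exprn_ge0. Qed.

(** [msum] takes its summands from a sequence; the default string of [nth] is never reached below
    the number of strings. *)
Definition coin_law : set mxT -> \bar R :=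
  mscale (NngNum coins_ge0)
    (msum (fun k => dirac (Pi (nth [tuple of nseq L false] (enum {: L.-tuple bool}) k) : mxT))
      #|{: L.-tuple bool}|).

HB.instance Definition _ := Measure.on coin_law.

(** A finite sum of Dirac masses has this value on every set, so the events of both guarantees can
    be evaluated directly. *)
Lemma coin_lawE B :
  coin_law B = (#|[pred omega : L.-tuple bool | `[< B (Pi omega) >]]|%:R / 2 ^+ L)%:E.
Proof.
rewrite /coin_law /mscale /msum /= mulrC EFinM; congr (_ * _)%E.
rewrite /msum (eq_bigr (fun k : 'I_#|{: L.-tuple bool}| =>
   ((`[< B (Pi (enum_val k)) >])%:R)%:E)); last first.
  by move=> k _; rewrite (enum_val_nth [tuple of nseq L false]); exact: diracE.
rewrite sumEFin -(big_enum_val (fun w => (`[< B (Pi w) >])%:R)) /=; congr (_%:E).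
rewrite -sum1_card natr_sum [RHS]big_mkcond /=; apply: eq_bigr => w _.
by rewrite inE; case: asboolP.
Qed.

Let coin_law_setT : coin_law setT = 1%E.
Proof.
rewrite coin_lawE (eq_card (B := predT)) => [|w]; last by rewrite !inE; apply/asboolP.
by rewrite card_tuple card_bool natrX divff // expf_neq0.
Qed.

HB.instance Definition _ := Measure_isProbability.Build _ _ _ coin_law coin_law_setT.

End CoinLaw.

(** * Guarantees under the law, and decoding of the coins *)

Section Guarantees.
Variables (R : realType) (m D L : nat) (Pi : L.-tuple bool -> 'M[R]_(m, D)).

Lemma coin_law_avg (B : 'M[R]_(m, D) -> Prop) :
  coin_law Pi [set x | B x] = (avg (fun w => (`[< B (Pi w) >])%:R : R))%:E.
Proof.
rewrite coin_lawE /avg card_tuple card_bool natrX; congr ((_ / _)%:E).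
rewrite -sum1_card natr_sum [LHS]big_mkcond /=; apply: eq_bigr => w _.
by rewrite inE; case: asboolP.
Qed.

Lemma coin_law_ge (B : 'M[R]_(m, D) -> Prop) c :
  c <= avg (fun w => (`[< B (Pi w) >])%:R : R) ->
  (c%:E <= (coin_law Pi : sketch_dist R m D) [set x | B x]%classic)%E.
Proof. by move=> cB; rewrite [leRHS](coin_law_avg B) lee_fin. Qed.

Lemma fair_coin_law_coin_law : fair_coin_law Pi (coin_law Pi).
Proof. by move=> B _; apply: coin_lawE. Qed.

Variable gam : R.
Hypothesis moment : forall x y : 'cV[R]_D,
  avg (fun t => (\sum_w (Pi t *m x) w 0 * (Pi t *m y) w 0 - \sum_a x a 0 * y a 0) ^+ 2) <=
  gam * ((\sum_a x a 0 ^+ 2) * (\sum_a y a 0 ^+ 2)).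

Let card_coins : (0 < #|{: L.-tuple bool}|)%N.
Proof. by rewrite card_tuple card_bool expn_gt0. Qed.

Lemma frobenius_concentration n (C E : 'M[R]_(D, n)) t (A : L.-tuple bool -> Prop) :
    0 < t -> gam * (frobenius C ^+ 2 * frobenius E ^+ 2) <= 1 / 10 * t ^+ 2 ->
    (forall w, frobenius (C^T *m (Pi w)^T *m Pi w *m E - C^T *m E) <= t -> A w) ->
  1 - 1 / 10 <= avg (fun w => (`[< A w >])%:R : R).
Proof.
move=> t0 gt tA.
apply: (@markov_avg R _ card_coins
  (fun w => frobenius (C^T *m (Pi w)^T *m Pi w *m E - C^T *m E) ^+ 2) A (t ^+ 2)).
- exact: exprn_gt0.
- by move=> w; apply: sqr_ge0.
- exact: le_trans (frobenius_moment moment C E) gt.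
by move=> w; rewrite ler_pXn2r ?nnegrE ?frobenius_ge0 ?(ltW t0) //; apply: tA.
Qed.

Lemma coin_law_amp n eps : 0 < eps -> gam <= eps ^+ 2 / 10 ->
  approx_matrix_product eps (1 / 10) n (coin_law Pi).
Proof.
move=> e0 ge C E; apply: coin_law_ge.
have C0 := frobenius_ge0 C; have E0 := frobenius_ge0 E.
(* Markov's inequality needs a positive threshold; if it vanishes, then [C] or [E] is zero and so is
   the error. *)
have [CE|CE] := eqVneq (frobenius C * frobenius E) 0.
  apply: (@le_trans _ _ 1); first by lra.
  rewrite -[leLHS](avg_cst 1 card_coins).
  have /eq_avg -> // : (fun w => (`[< frobenius (C^T *m (Pi w)^T *m Pi w *m E - C^T *m E)
      <= eps * frobenius C * frobenius E >])%:R : R) =1 fun=> 1.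
  move=> w; case: asboolP => //; case; rewrite -mulrA CE mulr0.
  have frob0 (F : 'M[R]_(D, n)) : frobenius F = 0 -> F = 0.
    move=> F0; have := frobenius_sqr F; rewrite F0 expr0n => /esym/eqP.
    rewrite psumr_eq0 => [/allP h|i _]; last by apply: sumr_ge0 => j _; apply: sqr_ge0.
    apply/matrixP => i j; have := h i; rewrite mem_index_enum => /(_ isT).
    rewrite psumr_eq0 => [/allP h'|k _]; last by apply: sqr_ge0.
    by have := h' j; rewrite mem_index_enum sqrf_eq0 => /(_ isT)/eqP->; rewrite mxE.
  have z : frobenius (0 : 'M[R]_n) = 0.
    by rewrite /frobenius big1 ?sqrtr0 // => i _; rewrite big1 // => j _; rewrite mxE expr0n.
  by move/eqP: CE; rewrite mulf_eq0 => /orP[]/eqP/frob0->;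
    rewrite ?(trmx0, mul0mx, mulmx0) subrr z.
have CE0 : 0 < frobenius C * frobenius E by rewrite lt_neqAle eq_sym CE mulr_ge0.
apply: (@frobenius_concentration n C E (eps * (frobenius C * frobenius E))).
- exact: mulr_gt0.
- have -> : 1 / 10 * (eps * (frobenius C * frobenius E)) ^+ 2 =
      eps ^+ 2 / 10 * (frobenius C ^+ 2 * frobenius E ^+ 2) by ring.
  by rewrite ler_wpM2r // mulr_ge0 ?sqr_ge0.
- by move=> w; rewrite mulrA.
Qed.

Lemma coin_law_ose n eps s : 0 < eps -> 0 < s -> gam * s ^+ 2 <= eps ^+ 2 / 10 ->
  oblivious_subspace_embedding eps (1 / 10) s n (coin_law Pi).
Proof.
move=> e0 s0 ge lambda A l0 sd; apply: coin_law_ge.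
have [U Usd H] := embedding_reduction A l0.
apply: (@frobenius_concentration n U U eps) => //; last by move=> w /H.
have U0 : 0 <= frobenius U ^+ 2 by apply: sqr_ge0.
rewrite Usd in U0 *.
have [g0|g0] := leP gam 0.
  apply: (@le_trans _ _ 0); last by rewrite mulr_ge0 ?sqr_ge0.
  by rewrite mulr_le0_ge0 // mulr_ge0.
apply: (@le_trans _ _ (gam * s ^+ 2)); last by lra.
by rewrite ler_wpM2l ?(ltW g0) // expr2 ler_pM.
Qed.

End Guarantees.

(** Most significant coin first, so that the program can read the number by Horner's rule. *)
Fixpoint bval (bits : nat -> bool) (q n : nat) : nat :=
  if n is n'.+1 then ((bval bits q n').*2 + bits (q + n'))%N else 0.

Lemma bval_lt bits q n : (bval bits q n < 2 ^ n)%N.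
Proof. by elim: n => //= n IH; rewrite expnS; case: (bits _) => /=; lia. Qed.

Lemma bval_inj b1 b2 q n c : bval b1 q n = bval b2 q n -> (c < n)%N -> b1 (q + c)%N = b2 (q + c)%N.
Proof.
elim: n => //= n IH e; rewrite ltnS leq_eqVlt => /orP[/eqP->|].
  by have := congr1 odd e; rewrite !odd_double_bit.
by apply: IH; have := congr1 half e; rewrite !half_double_bit.
Qed.

Section Decode.
Variables (M' r d : nat).
Local Notation M := M'.+1.
Hypothesis HM : M = (2 ^ r)%N.
Local Notation rand := (sketch_rand M' r d).

(* Layout of the coins of step [k]: signs of the buckets, table of [hsh], signs of
   the coordinates, hash values of the coordinates. *)
Definition step_bits := (M + r * r + d + d * r)%N.
Definition sigma_at k i := (k * step_bits + i)%N.
Definition table_at k b := (k * step_bits + M + b * r)%N.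
Definition tau_at k j := (k * step_bits + M + r * r + j)%N.
Definition g_at k j := (k * step_bits + M + r * r + d + j * r)%N.

Definition decode1 (bits : nat -> bool) (k : nat) : rand :=
  ([ffun j : 'I_d => inord (bval bits (g_at k j) r)],
   [ffun b : 'I_r => inord (bval bits (table_at k b) r)],
   [ffun j : 'I_d => bits (tau_at k j)],
   [ffun i : 'I_M => bits (sigma_at k i)]).

Definition decode_bits p (omega : (p * step_bits).-tuple bool) : p.-tuple rand :=
  [tuple decode1 (nth false omega) k | k < p].

Lemma decode1_inj b1 b2 k q : decode1 b1 k = decode1 b2 k -> (q < step_bits)%N ->
  b1 (k * step_bits + q)%N = b2 (k * step_bits + q)%N.
Proof.
case=> eg eT et es qS.
have [qM|Mq] := ltnP q M.
  by have /ffunP/(_ (Ordinal qM)) := es; rewrite !ffunE.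
have val_inord x : (x < 2 ^ r)%N -> (inord x : 'I_M) = x :> nat.
  by move=> xr; rewrite inordK // HM.
have [qr|rq] := ltnP q (M + r * r).
  have r0 : (0 < r)%N by case: (r) qr => // ; rewrite addn0 ltnNge Mq.
  have br : ((q - M) %/ r < r)%N by rewrite ltn_divLR //; lia.
  have /ffunP/(_ (Ordinal br)) := eT; rewrite !ffunE => /(congr1 val) /=.
  rewrite !val_inord ?bval_lt // => /bval_inj - /(_ ((q - M) %% r)%N).
  rewrite ltn_mod r0 => /(_ isT).
  have -> // : (table_at k ((q - M) %/ r) + (q - M) %% r)%N = (k * step_bits + q)%N.
  by rewrite /table_at -addnA -divn_eq; lia.
have [qd|dq] := ltnP q (M + r * r + d).
  have jd : (q - (M + r * r) < d)%N by lia.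
  have /ffunP/(_ (Ordinal jd)) := et; rewrite !ffunE.
  by have -> : tau_at k (Ordinal jd) = (k * step_bits + q)%N by rewrite /tau_at /=; lia.
have qE : (q - (M + r * r + d) < d * r)%N by rewrite /step_bits in qS; lia.
have r0 : (0 < r)%N by case: (r) qE => //; rewrite !muln0.
have jd : ((q - (M + r * r + d)) %/ r < d)%N by rewrite ltn_divLR.
have /ffunP/(_ (Ordinal jd)) := eg; rewrite !ffunE => /(congr1 val) /=.
rewrite !val_inord ?bval_lt // => /bval_inj - /(_ ((q - (M + r * r + d)) %% r)%N).
rewrite ltn_mod r0 => /(_ isT).
have -> // : (g_at k ((q - (M + r * r + d)) %/ r) + (q - (M + r * r + d)) %% r)%N =
  (k * step_bits + q)%N.
by rewrite /g_at -addnA -divn_eq; lia.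
Qed.

(** Every coin can be recovered from the decoded data, and both sets have the same size because [M]
    is a power of two. Averages over coins are thus averages over the step randomness, without
    rounding. *)
Lemma decode_bij p : bijective (@decode_bits p).
Proof.
apply: inj_card_bij => [w1 w2 e|].
  apply/val_inj/(@eq_from_nth _ false) => [|q]; rewrite !size_tuple // => qL.
  have S0 : (0 < step_bits)%N by rewrite /step_bits.
  have kp : (q %/ step_bits < p)%N by rewrite ltn_divLR.
  have := congr1 (fun t => tnth t (Ordinal kp)) e; rewrite !tnth_mktuple /=.
  move/decode1_inj => /(_ (q %% step_bits)%N); rewrite ltn_mod -divn_eq.
  exact.
rewrite !card_tuple card_bool !card_prod !card_ffun !card_ord card_bool HM.
rewrite -!expnM -!expnD -expnM; apply/eq_leq; congr (2 ^ _)%N.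
by rewrite /step_bits HM; lia.
Qed.

End Decode.

(** * The Walsh-Hadamard transform *)

Section WalshHadamard.
Variable R : realFieldType.
Implicit Types (A y x : nat -> R) (l b i q : nat).

(** Defined on all naturals: the stages below [l] transform every aligned block of length [2 ^ l] at
    once, so one pass treats all blocks of the working area. *)
Definition stage b A i : R :=
  if odd (i %/ 2 ^ b) then A (i - 2 ^ b)%N - A i else A (i + 2 ^ b)%N + A i.

Fixpoint wht l A : nat -> R := if l is l'.+1 then stage l' (wht l' A) else A.

Definition conv l y x i : R := \sum_(j < 2 ^ l) y (xr l i j) * x j.

Let part (c : bool) A q := A (q.*2 + c)%N.

Lemma stageS b A (c : bool) q : stage b.+1 A (q.*2 + c) = stage b (part c A) q.
Proof.
rewrite /stage /part expnS divnMA divn2 half_double_bit.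
case: ifP => o.
  have qb : (2 ^ b <= q)%N.
    by case: leqP => // qb; rewrite divn_small in o.
  by congr (A _ - _); lia.
by congr (A _ + _); lia.
Qed.

(** The definition of [wht] exposes the stage of the highest bit, whereas [xr] and [conv] recurse on
    the lowest one; this extracts the stage of bit 0 instead. *)
Lemma whtS l A (c : bool) q :
  wht l.+1 A (q.*2 + c) = wht l (fun q => stage 0 A (q.*2 + c)) q.
Proof.
elim: l q => [//|l IH] q; rewrite [LHS]/= stageS /=; congr (stage l _ q).
by apply/funext => q'; apply: IH.
Qed.

Lemma stage0 A (c : bool) q : stage 0 A (q.*2 + c) =
  part false A q + (if c then - part true A q else part true A q).
Proof.
rewrite /stage /part expn0 divn1 odd_double_bit addn0.
by case: c; rewrite ?addnK // addn0 [RHS]addrC.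
Qed.

Lemma whtD l A B a i : wht l (fun i => A i + a * B i) i = wht l A i + a * wht l B i.
Proof.
elim: l i => //= l IH i; rewrite /stage !IH; case: ifP => _; ring.
Qed.

Lemma whtZ l A a i : wht l (fun i => a * A i) i = a * wht l A i.
Proof. by elim: l i => //= l IH i; rewrite /stage !IH; case: ifP => _; ring. Qed.

Lemma wht_involution l A i : wht l (wht l A) i = 2 ^+ l * A i.
Proof.
elim: l A i => [|l IH] A i; first by rewrite expr0 mul1r.
rewrite -(odd_double_half i) addnC; set q := i./2; set c := odd i.
rewrite whtS (_ : (fun q => _) = fun q => 2 * wht l (part c A) q); last first.
  apply/funext => q'; rewrite stage0 /part !whtS.
  have e0 : (fun q : nat => stage 0 A (q.*2 + true)) =
      fun q => part false A q + (-1) * part true A q.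
    by apply/funext => ?; rewrite stage0 mulN1r.
  have e1 : (fun q : nat => stage 0 A (q.*2 + false)) =
      fun q => part false A q + 1 * part true A q.
    by apply/funext => ?; rewrite stage0 mul1r.
  by rewrite e0 e1 !whtD; case: c; rewrite /part /=; ring.
by rewrite whtZ IH exprS mulrA.
Qed.

Lemma sum_double n (F : nat -> R) :
  \sum_(j < n.*2) F j = \sum_(j < n) (F j.*2 + F (j.*2 + 1)%N).
Proof.
elim: n => [|n IH]; first by rewrite !big_ord0.
by rewrite doubleS !big_ord_recr /= IH addrA addn1.
Qed.

Lemma convS l y x (c : bool) q : conv l.+1 y x (q.*2 + c) =
  conv l (part c y) (part false x) q + conv l (part (~~ c) y) (part true x) q.
Proof.
rewrite /conv expnS mul2n (sum_double _ (fun j => y (xr l.+1 (q.*2 + c) j) * x j)).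
rewrite -big_split /=; apply: eq_bigr => j _; rewrite /part.
rewrite half_double_bit odd_double_bit doubleK odd_double addbF addn0.
by rewrite (half_double_bit j true) (odd_double_bit j true) addbT.
Qed.

Lemma convDl l y y' x a q :
  conv l (fun i => y i + a * y' i) x q = conv l y x q + a * conv l y' x q.
Proof. by rewrite /conv mulr_sumr -big_split; apply: eq_bigr => j _ /=; ring. Qed.

Lemma convDr l y x x' a q :
  conv l y (fun i => x i + a * x' i) q = conv l y x q + a * conv l y x' q.
Proof. by rewrite /conv mulr_sumr -big_split; apply: eq_bigr => j _ /=; ring. Qed.

Lemma wht_conv l y x i : wht l (conv l y x) i = wht l y i * wht l x (i %% 2 ^ l)%N.
Proof.
elim: l y x i => [|l IH] y x i; first by rewrite /= /conv expn0 modn1 big_ord1.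
rewrite -(odd_double_half i) addnC; set q := i./2; set c := odd i.
have -> : ((q.*2 + c) %% 2 ^ l.+1 = (q %% 2 ^ l).*2 + c)%N.
  have q2 : (q %% 2 ^ l < 2 ^ l)%N by rewrite ltn_mod expn_gt0.
  have -> : (q.*2 + c = q %/ 2 ^ l * 2 ^ l.+1 + ((q %% 2 ^ l).*2 + c))%N.
    by rewrite {1}(divn_eq q (2 ^ l)) expnS; lia.
  by rewrite modnMDl modn_small // expnS; case: c; lia.
rewrite !whtS -IH; congr (wht l _ q); apply/funext => q'.
have -> : (fun q => stage 0 y (q.*2 + c)) =
    fun q => part false y q + (if c then -1 else 1) * part true y q.
  by apply/funext => ?; rewrite stage0; case: c; ring.
have -> : (fun q => stage 0 x (q.*2 + c)) =
    fun q => part false x q + (if c then -1 else 1) * part true x q.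
  by apply/funext => ?; rewrite stage0; case: c; ring.
rewrite stage0 /part !convS !convDl !convDr /part; case: c => /=; ring.
Qed.

Lemma odd_divn_block l b K i : (b < l)%N ->
  odd ((K * 2 ^ l + i) %/ 2 ^ b) = odd (i %/ 2 ^ b).
Proof.
move=> bl; have -> : (K * 2 ^ l = K * 2 ^ (l - b) * 2 ^ b)%N.
  by rewrite -mulnA -expnD subnK // ltnW.
by rewrite divnMDl ?expn_gt0 // oddD oddM oddX subn_eq0 leqNgt bl andbF.
Qed.

Lemma wht_block l l' A K i : (l' <= l)%N ->
  wht l' (fun i => A (K * 2 ^ l + i)%N) i = wht l' A (K * 2 ^ l + i).
Proof.
elim: l' i => //= l' IH i ll; rewrite /stage !IH ?(ltnW ll) // odd_divn_block //.
case: ifP => o; last by rewrite addnA.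
congr (wht l' A _ - _); rewrite addnBA //.
by case: leqP => // ib; rewrite divn_small in o.
Qed.

(** An index whose bit [b] is 0 has its partner in the same aligned block, and no block straddles
    [N]. Hence unknown cells from [N] on never enter the transform of the cells below. *)
Lemma stage_partner l b N i : (b < l)%N -> (2 ^ l %| N)%N -> (i < N)%N ->
  ~~ odd (i %/ 2 ^ b) -> (i + 2 ^ b < N)%N.
Proof.
move=> bl /dvdnP[K ->] iN o.
have e : (K * 2 ^ l = K * 2 ^ (l - b.+1) * 2 * 2 ^ b)%N.
  by rewrite -!mulnA -expnS -expnD subnK.
rewrite e in iN *; set u := (i %/ 2 ^ b)%N in o.
have uK : (u < K * 2 ^ (l - b.+1) * 2)%N by rewrite ltn_divLR ?expn_gt0.
have {}uK : (u.+1 < K * 2 ^ (l - b.+1) * 2)%N.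
  rewrite ltn_neqAle uK andbT; apply: contra o => /eqP/(congr1 odd) /=.
  by rewrite oddM andbF => /negbFE.
apply: (@leq_trans (u.+2 * 2 ^ b)); last by rewrite leq_mul2r uK orbT.
have P0 : (0 < 2 ^ b)%N by rewrite expn_gt0.
have := divn_eq i (2 ^ b); have := ltn_pmod i P0; rewrite -/u !mulSn; lia.
Qed.

Lemma eq_stage l b N A B i : (b < l)%N -> (2 ^ l %| N)%N ->
  (forall i, (i < N)%N -> A i = B i) -> (i < N)%N -> stage b A i = stage b B i.
Proof.
move=> bl lN AB iN; rewrite /stage; case: ifPn => o.
  by rewrite !AB // (leq_ltn_trans _ iN) // leq_subr.
by rewrite !AB // (stage_partner bl).
Qed.

Lemma eq_wht l l' N A B i : (l' <= l)%N -> (2 ^ l %| N)%N ->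
  (forall i, (i < N)%N -> A i = B i) -> (i < N)%N -> wht l' A i = wht l' B i.
Proof.
elim: l' i => [|l' IH] i ll lN AB iN; first exact: AB.
by apply: (eq_stage ll lN _ iN) => j jN; apply: (IH _ (ltnW ll)).
Qed.

(* [conv l] is the convolution over the group (Z/2)^l, which the transform turns
   into a pointwise product. *)
Lemma wht_product l K (A : nat -> R) i : (i < K * 2 ^ l)%N ->
  wht l (fun i => wht l A i * wht l A (K * 2 ^ l + i %% 2 ^ l)%N / 2 ^+ l) i =
  conv l A (fun v => A (K * 2 ^ l + v)%N) i.
Proof.
move=> iK; rewrite (_ : (fun i => _) = fun i => (2 ^+ l)^-1 *
    wht l (conv l A (fun v => A (K * 2 ^ l + v)%N)) i); last first.
  by apply/funext => j; rewrite wht_conv wht_block // mulrC.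
by rewrite whtZ wht_involution mulKf // expf_neq0.
Qed.

End WalshHadamard.

(** * Timed weakest preconditions *)

Section Programs.
Variables (R : realType) (W : nat).
Implicit Types (st : state R) (c : cmd) (Q : state R -> Prop).

Definition wp c (T : nat) Q st :=
  exists t st', [/\ exec W c st t st', (t <= T)%N & Q st'].

Lemma wp_weaken c T T' Q Q' st : wp c T Q st -> (T <= T')%N ->
  (forall st', Q st' -> Q' st') -> wp c T' Q' st.
Proof.
by case=> t [st' [e tT q]] TT' QQ'; exists t, st'; split; [| exact: leq_trans TT' | exact: QQ'].
Qed.

Lemma wp_setI a e1 e2 Q st : (ieval st e2 < W)%N ->
  Q (State (update (words st) a (ieval st e1) (ieval st e2)) (reals st)) ->
  wp (SetI a e1 e2) 1 Q st.
Proof. by move=> eW q; exists 1%N; eexists; split; [exact: ExecSetI | | exact: q]. Qed.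

Lemma wp_setR a e r Q st :
  Q (State (words st) (update (reals st) a (ieval st e) (reval st r))) ->
  wp (SetR a e r) 1 Q st.
Proof. by move=> q; exists 1%N; eexists; split; [exact: ExecSetR | | exact: q]. Qed.

Lemma wp_seq c1 c2 T1 T2 Q st :
  wp c1 T1 (wp c2 T2 Q) st -> wp (Seq c1 c2) (T1 + T2) Q st.
Proof.
case=> t1 [st1 [e1 tT1 [t2 [st2 [e2 tT2 q]]]]].
by exists (t1 + t2)%N, st2; split; [exact: ExecSeq e1 e2 | exact: leq_add |].
Qed.

Lemma wp_if b c1 c2 T Q st : (beval st b -> wp c1 T Q st) ->
  (~~ beval st b -> wp c2 T Q st) -> wp (If b c1 c2) T.+1 Q st.
Proof.
move=> h1 h2; have [bt|bf] := boolP (beval st b).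
  by have [t [st' [e tT q]]] := h1 bt; exists t.+1, st'; split=> //; exact: ExecIfTrue.
by have [t [st' [e tT q]]] := h2 bf; exists t.+1, st'; split=> //; exact: ExecIfFalse.
Qed.

(** The number of rounds is fixed in advance and the invariant is indexed by the round, so
    termination and time come along with correctness. *)
Lemma wp_while b c N (Tb : nat -> nat) (I : nat -> state R -> Prop) Q st :
  I 0%N st ->
  (forall i st', (i <= N)%N -> I i st' -> beval st' b = (i < N)%N) ->
  (forall i st', (i < N)%N -> I i st' -> wp c (Tb i) (I i.+1) st') ->
  (forall st', I N st' -> Q st') ->
  wp (While b c) (1 + \sum_(i < N) (Tb i + 1))%N Q st.
Proof.
move=> I0 guard body IQ.
suff H k i st' : (i + k)%N = N -> I i st' ->
    wp (While b c) (1 + \sum_(i <= j < N) (Tb j + 1))%N Q st'.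
  by rewrite -(big_mkord xpredT (fun i => Tb i + 1)%N); apply: (H N).
elim: k i st' => [|k IH] i st' ikN Ii.
  rewrite addn0 in ikN; rewrite ikN in Ii *.
  exists 1%N, st'; split; [|by rewrite big_geq | exact: IQ].
  by apply: ExecWhileFalse; rewrite (guard N) // ltnn.
have iN : (i < N)%N by lia.
have [t1 [st1 [e1 tT1 I1]]] := body i st' iN Ii.
have [|t2 [st2 [e2 tT2 q]]] := IH i.+1 st1 _ I1; first lia.
exists (t1 + t2).+1, st2; split=> //.
  by apply: ExecWhileTrue e1 e2; rewrite (guard i) // ltnW.
by rewrite big_ltn //; lia.
Qed.

(** Whole arrays suffice as footprints, because each scalar variable is an array of its own. *)
Definition frame (ws rs : seq nat) st st' :=
  (forall a, a \notin ws -> words st' a = words st a) /\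
  (forall a, a \notin rs -> reals st' a = reals st a).

Lemma frame_refl ws rs st : frame ws rs st st. Proof. by []. Qed.

Lemma frame_trans ws rs st1 st2 st3 : frame ws rs st1 st2 -> frame ws rs st2 st3 ->
  frame ws rs st1 st3.
Proof.
by move=> [w1 r1] [w2 r2]; split=> a na; [rewrite w2 // w1 | rewrite r2 // r1].
Qed.

Lemma frame_sub ws ws' rs rs' st st' : subseq ws ws' -> subseq rs rs' ->
  frame ws rs st st' -> frame ws' rs' st st'.
Proof.
move=> /mem_subseq sw /mem_subseq sr [w r].
by split=> a na; [apply: w | apply: r]; apply: contra na; [apply: sw | apply: sr].
Qed.

Lemma frame_setI a i v st :
  frame [:: a] [::] st (State (update (words st) a i v) (reals st)).
Proof.
split=> // b; rewrite inE => /negPf ba; apply/funext => j.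
by rewrite /= /update ba.
Qed.

Lemma frame_setR a i v st :
  frame [::] [:: a] st (State (words st) (update (reals st) a i v)).
Proof.
split=> // b; rewrite inE => /negPf ba; apply/funext => j.
by rewrite /= /update ba.
Qed.

Lemma updateE (T : Type) (M : nat -> nat -> T) a i v :
  update M a i v a = fun j => if j == i then v else M a j.
Proof. by rewrite /update eqxx. Qed.

Definition For (v : nat) (e : iexp) (c : cmd) : cmd :=
  Seq (SetI v (INat 0) (INat 0))
      (While (BNot (BLeI e (IGet v (INat 0))))
             (Seq c (SetI v (INat 0) (IAdd (IGet v (INat 0)) (INat 1))))).

(** The leading 2 pays for the initialization and the last test, the 2 in the sum for a test and an
    increment. The bound [e] is evaluated anew in each round, and the invariant must survive the
    increment of [v], hence the quantification over [st2]. *)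
Lemma wp_for v e c N (Tb : nat -> nat) (I : nat -> state R -> Prop) Q st :
  (N < W)%N ->
  (forall st', frame [:: v] [::] st st' -> I 0%N st') ->
  (forall i st', (i <= N)%N -> words st' v 0 = i -> I i st' -> ieval st' e = N) ->
  (forall i st', (i < N)%N -> words st' v 0 = i -> I i st' ->
     wp c (Tb i) (fun st1 => words st1 v 0 = i /\
       forall st2, frame [:: v] [::] st1 st2 -> I i.+1 st2) st') ->
  (forall st', I N st' -> Q st') ->
  wp (For v e c) (2 + \sum_(i < N) (Tb i + 2))%N Q st.
Proof.
move=> NW I0 bound body IQ.
rewrite -[2%N]/(1 + 1)%N -addnA; apply: wp_seq; apply: wp_setI => /=; first lia.
have -> : (\sum_(i < N) (Tb i + (1 + 1)) = \sum_(i < N) (Tb i + 1 + 1))%N.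
  by apply: eq_bigr => i _; rewrite addnA.
apply: (wp_while (N := N) (Tb := fun i => (Tb i + 1)%N)
  (I := fun i st' => words st' v 0 = i /\ I i st')).
- by split; [rewrite /= updateE | apply: I0; apply: frame_setI].
- by move=> i st' iN [vi Ii] /=; rewrite (bound i) // vi -ltnNge.
- move=> i st' iN [vi Ii]; apply: wp_seq.
  apply: wp_weaken (body i st' iN vi Ii) (leqnn _) _ => st1 [vi1 I1].
  apply: wp_setI => /=; rewrite vi1 addn1; first lia.
  by split; [rewrite /= updateE | apply: I1; apply: frame_setI].
- by move=> st' [_ /IQ].
Qed.

Lemma wp_for_setR v e a idx rhs N (P : nat -> (nat -> R) -> Prop) st :
  (N < W)%N -> P 0%N (reals st a) ->
  (forall st', frame [:: v] [:: a] st st' -> ieval st' e = N) ->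
  (forall i st', (i < N)%N -> frame [:: v] [:: a] st st' -> words st' v 0 = i ->
     P i (reals st' a) ->
     P i.+1 (fun j => if j == ieval st' idx then reval st' rhs else reals st' a j)) ->
  wp (For v e (SetR a idx rhs)) (2 + 3 * N)
     (fun st' => frame [:: v] [:: a] st st' /\ P N (reals st' a)) st.
Proof.
move=> NW P0 bound step.
have -> : (2 + 3 * N = 2 + \sum_(i < N) (1 + 2))%N.
  by rewrite sum_nat_const card_ord mulnC.
apply: (wp_for (Tb := fun=> 1%N)
  (I := fun i st' => frame [:: v] [:: a] st st' /\ P i (reals st' a))) => //.
- by move=> st' fr; split; [exact: frame_sub fr | rewrite fr.2].
- by move=> i st' _ _ [/bound].
move=> i st' iN vi [fr Pi]; apply: wp_setR; split=> //= st2 fr2; split.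
  apply: frame_trans fr _; apply: frame_trans (frame_sub _ _ fr2) => //.
  exact: frame_sub (frame_setR _ _ _ _).
by rewrite fr2.2 //= updateE; apply: step.
Qed.

Lemma wp_for_setI v e a idx rhs N (P : nat -> (nat -> nat) -> Prop) st :
  (N < W)%N -> a != v -> P 0%N (words st a) ->
  (forall st', frame [:: a; v] [::] st st' -> ieval st' e = N) ->
  (forall i st', (i < N)%N -> frame [:: a; v] [::] st st' -> words st' v 0 = i ->
     P i (words st' a) ->
     (ieval st' rhs < W)%N /\
     P i.+1 (fun j => if j == ieval st' idx then ieval st' rhs else words st' a j)) ->
  wp (For v e (SetI a idx rhs)) (2 + 3 * N)
     (fun st' => frame [:: a; v] [::] st st' /\ P N (words st' a)) st.
Proof.
move=> NW av P0 bound step.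
have -> : (2 + 3 * N = 2 + \sum_(i < N) (1 + 2))%N.
  by rewrite sum_nat_const card_ord mulnC.
apply: (wp_for (Tb := fun=> 1%N)
  (I := fun i st' => frame [:: a; v] [::] st st' /\ P i (words st' a))) => //.
- move=> st' fr; split; last by rewrite fr.1 // inE.
  by apply: frame_sub fr => //; apply: suffix_subseq [:: a] [:: v].
- by move=> i st' _ _ [/bound].
move=> i st' iN vi [fr Pi]; have [rW Pi1] := step i st' iN fr vi Pi.
apply: wp_setI => //; split; first by rewrite /= /update eq_sym (negPf av).
move=> st2 fr2; split; last by rewrite fr2.1 ?inE //= updateE.
apply: frame_trans fr _; apply: (@frame_trans _ _ _ (State
   (update (words st') a (ieval st' idx) (ieval st' rhs)) (reals st'))).
  by apply: frame_sub (frame_setI _ _ _ _) => //=; rewrite eqxx.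
by apply: frame_sub fr2 => //; apply: suffix_subseq [:: a] [:: v].
Qed.

End Programs.

(** * The sketching program *)

(* Word variables: 4 = the number M = 2^r of buckets, 5 = r, 6 = 2^l, 7 = l,
   8 = column, 9 = step, 10 = hash table (an array), 11 = bit or butterfly stage,
   12 = 2^stage, 13 and 15 = loop counters, 14 = last number read from the coins.
   Real arrays: 3 = current vector, 4 = working area, 5 = scratch.  The working
   area holds the hashed current vector in its first M cells, then the hashed
   input column in 2^l cells. *)
Definition iv (a : nat) : iexp := IGet a (INat 0).
Definition seek (off : iexp) : iexp :=
  IAdd (IMul (iv 9) (IAdd (IAdd (IAdd (iv 4) (IMul (iv 5) (iv 5))) (IGet 0 (INat 2)))
    (IMul (IGet 0 (INat 2)) (iv 5)))) off.
Definition rsign (e : iexp) : rexp := RSub (RNat (INat 1)) (RMul (RNat (INat 2)) (RNat e)).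

Definition read_prog (addr : iexp) : cmd :=
  Seq (SetI 14 (INat 0) (INat 0))
      (For 15 (iv 5) (SetI 14 (INat 0)
         (IAdd (IMul (INat 2) (iv 14)) (IGet 3 (IAdd addr (iv 15)))))).

Definition hash_prog : cmd :=
  Seq (SetI 10 (INat 0) (INat 0)) (Seq (SetI 12 (INat 0) (INat 1))
    (For 11 (iv 5)
      (Seq (read_prog (IAdd (seek (iv 4)) (IMul (iv 11) (iv 5))))
      (Seq (For 13 (iv 12) (SetI 10 (IAdd (iv 12) (iv 13))
              (IMod (IAdd (IGet 10 (iv 13)) (iv 14)) (iv 4))))
           (SetI 12 (INat 0) (IMul (INat 2) (iv 12))))))).

Definition clear_prog : cmd :=
  For 13 (IAdd (iv 4) (iv 6)) (SetR 4 (iv 13) (RNat (INat 0))).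

Definition scatter_y_prog : cmd :=
  For 13 (iv 4) (SetR 4 (IGet 10 (iv 13)) (RAdd (RGet 4 (IGet 10 (iv 13)))
    (RMul (rsign (IGet 3 (seek (iv 13)))) (RGet 3 (iv 13))))).

Definition entry : iexp := IAdd (IGet 1 (iv 8)) (iv 13).
Definition tau_off : iexp := IAdd (iv 4) (IMul (iv 5) (iv 5)).

(** The [r] coins of a hash value are read at a nonzero entry only if [d] exceeds [M], that is, if
    [r] is below the logarithm of [d]. *)
Definition scatter_x_prog : cmd :=
  For 13 (ISub (IGet 1 (IAdd (iv 8) (INat 1))) (IGet 1 (iv 8)))
    (Seq (If (BLeI (IGet 0 (INat 2)) (iv 4)) (SetI 14 (INat 0) (IGet 2 entry))
             (read_prog (IAdd (seek (IAdd tau_off (IGet 0 (INat 2))))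
                              (IMul (IGet 2 entry) (iv 5)))))
         (SetR 4 (IAdd (iv 4) (iv 14)) (RAdd (RGet 4 (IAdd (iv 4) (iv 14)))
            (RMul (rsign (IGet 3 (IAdd (seek tau_off) (IGet 2 entry))))
                  (RGet 1 entry))))).

Definition upper_half : iexp := IMod (IDiv (iv 13) (iv 12)) (INat 2).

(** A stage goes to array 5 and is copied back, since writing in place would destroy the partner of
    a later index. The address [i + 2^b - 2 * 2^b * bit] finds the partner without a branch. *)
Definition wht_prog : cmd :=
  Seq (SetI 12 (INat 0) (INat 1))
    (For 11 (iv 7)
      (Seq (For 13 (IAdd (iv 4) (iv 6)) (SetR 5 (iv 13)
              (RAdd (RGet 4 (ISub (IAdd (iv 13) (iv 12))
                                  (IMul (IMul (INat 2) (iv 12)) upper_half)))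
                    (RMul (rsign upper_half) (RGet 4 (iv 13))))))
      (Seq (For 13 (IAdd (iv 4) (iv 6)) (SetR 4 (iv 13) (RGet 5 (iv 13))))
           (SetI 12 (INat 0) (IMul (INat 2) (iv 12)))))).

Definition product_prog : cmd :=
  For 13 (iv 4) (SetR 4 (iv 13)
    (RDiv (RMul (RGet 4 (iv 13)) (RGet 4 (IAdd (iv 4) (IMod (iv 13) (iv 6)))))
          (RNat (iv 6)))).

Definition copy_prog : cmd := For 13 (iv 4) (SetR 3 (iv 13) (RGet 4 (iv 13))).

Definition step_prog : cmd :=
  Seq hash_prog (Seq clear_prog (Seq scatter_y_prog (Seq scatter_x_prog
    (Seq wht_prog (Seq product_prog (Seq wht_prog copy_prog)))))).

(** * Addresses in the compressed column format *)

Section CompressedColumns.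
Variables (R : realType) (d n : nat) (X : 'M[R]_(d, n)).

Lemma filter_enum_ord (c : nat) : (c <= n)%N ->
  [seq j : 'I_n <- enum 'I_n | (j < c)%N] = take c (enum 'I_n).
Proof.
move=> cn; apply: (inj_map val_inj).
rewrite -(filter_map val (fun j => (j < c)%N)) map_take val_enum_ord.
by rewrite (filter_iota_ltn 0 cn) take_iota (minn_idPl cn).
Qed.

Lemma nth_flatten_enum (T : Type) (x0 : T) (F : 'I_n -> seq T) (c : 'I_n) q :
  (q < size (F c))%N ->
  nth x0 (flatten [seq F j | j <- enum 'I_n]) (\sum_(j < n | j < c) size (F j) + q)%N =
  nth x0 (F c) q.
Proof.
move=> qc; rewrite -[enum 'I_n](cat_take_drop c) map_cat flatten_cat nth_cat.
have sz : size (flatten [seq F j | j <- take c (enum 'I_n)]) =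
    (\sum_(j < n | j < c) size (F j))%N.
  rewrite size_flatten /shape -map_comp sumnE big_map -filter_enum_ord 1?ltnW //.
  by rewrite big_filter big_enum_cond.
rewrite sz -ltn_subRL subnn ltn0 addKn (drop_nth c) ?size_enum_ord // nth_ord_enum /=.
by rewrite nth_cat qc.
Qed.

Lemma csc_startS (c : 'I_n) : csc_start X c.+1 = (csc_start X c + size (csc_col X c))%N.
Proof.
rewrite /csc_start (bigD1 c) //= addnC; congr (_ + _)%N.
by apply: eq_bigl => j; rewrite ltnS ltn_neqAle andbC.
Qed.

Lemma nth_csc_rows (c : 'I_n) q (j0 : 'I_d) : (q < size (csc_col X c))%N ->
  nth 0%N (csc_rows X) (csc_start X c + q) = nth j0 (csc_col X c) q.
Proof.
move=> qc.
have := @nth_flatten_enum _ 0%N (fun j => [seq nat_of_ord i | i <- csc_col X j]) c q.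
rewrite size_map => /(_ qc); rewrite (nth_map j0) // => <-.
by congr (nth _ _ (_ + _)); apply: eq_bigr => j _; rewrite size_map.
Qed.

Lemma nth_csc_vals (c : 'I_n) q (j0 : 'I_d) : (q < size (csc_col X c))%N ->
  nth 0 (csc_vals X) (csc_start X c + q) = X (nth j0 (csc_col X c) q) c.
Proof.
move=> qc.
have := @nth_flatten_enum _ 0 (fun j => [seq X i j | i <- csc_col X j]) c q.
rewrite size_map => /(_ qc); rewrite (nth_map j0) // => <-.
by congr (nth _ _ (_ + _)); apply: eq_bigr => j _; rewrite size_map.
Qed.

Lemma size_csc_col (c : 'I_n) : (size (csc_col X c) <= d)%N.
Proof. by rewrite size_filter -[leqRHS]size_enum_ord count_size. Qed.

Lemma sum_csc_col (c : 'I_n) (F : 'I_d -> R) : (forall j, X j c = 0 -> F j = 0) ->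
  \sum_(j <- csc_col X c) F j = \sum_j F j.
Proof.
move=> F0; rewrite /csc_col big_filter big_enum_cond /= big_mkcond /=.
by apply: eq_bigr => j _; case: eqP => // /F0.
Qed.

Lemma sum_size_csc_col : (\sum_(c < n) size (csc_col X c) = nnz X)%N.
Proof.
have -> : nnz X = #|[pred ij : 'I_d * 'I_n | X ij.1 ij.2 != 0]|.
  by apply: eq_card => ij; rewrite [RHS]inE; apply/idP/idP; rewrite inE.
rewrite -sum1_card [RHS]big_mkcond /=.
transitivity (\sum_(i < d) \sum_(c < n) nat_of_bool (X i c != 0%R))%N.
  rewrite exchange_big /=; apply: eq_bigr => c _.
  by rewrite size_filter -sum1_count big_mkcond /= big_enum; apply: eq_bigr => i _; case: ifP.
by rewrite pair_bigA /=; apply: eq_bigr => ij _; rewrite inE; case: ifP.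
Qed.

End CompressedColumns.

(** * Correctness and time of the pieces of a step *)

Section StepSpec.
Variables (R : realType) (W M' r l n p d m : nat) (X : 'M[R]_(d, n)) (bits : nat -> bool).
Local Notation M := M'.+1.
Hypotheses (HM : M = (2 ^ r)%N) (lr : (l <= r)%N).
Hypothesis Hd : if (d <= M)%N then (d <= 2 ^ l)%N else l == r.
Hypotheses (MW : (2 * M < W)%N) (dW : (d < W)%N) (pW : (p < W)%N) (nW : (n < W)%N).
Hypothesis (Mm : (M <= m)%N).
Implicit Types st : state R.

Definition base st :=
  [/\ [/\ words st 0 0 = n, words st 0 1 = p, words st 0 2 = d & words st 0 3 = m],
      [/\ forall k, (k <= n)%N -> words st 1 k = csc_start X k,
          forall k, words st 2 k = nth 0 (csc_rows X) k,
          forall k, words st 3 k = bits k &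
          forall k, (reals st 1%N k = nth 0 (csc_vals X) k)%R] &
      [/\ words st 4 0 = M, words st 5 0 = r, words st 6 0 = 2 ^ l & words st 7 0 = l]]%N.

(** Word arrays below 8 and real arrays below 2 hold the input and the sizes; after the setup
    nothing writes there. *)
Lemma base_frame ws rs st st' : frame ws rs st st' ->
  all (leq 8) ws -> all (leq 2) rs -> base st -> base st'.
Proof.
move=> [fw fr] /allP hw /allP hr.
have w a : (a < 8)%N -> words st' a = words st a.
  by move=> a8; apply: fw; apply: contraL a8 => /hw; rewrite leqNgt.
have r1 : reals st' 1 = reals st 1 by apply: fr; apply/negP => /hr.
by rewrite /base !w // r1.
Qed.

Lemma rsignE st e (b : bool) : ieval st e = b -> reval st (rsign e) = (-1) ^+ b.
Proof. by move=> /= ->; case: b => /=; rewrite ?expr1 ?expr0 ?mulr1n ?mulr0n; ring. Qed.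

Lemma read_spec addr q st : base st ->
  (forall st', frame [:: 14; 15] [::] st st' -> ieval st' addr = q) ->
  wp W (read_prog addr) (3 + 3 * r)
    (fun st' => frame [:: 14; 15] [::] st st' /\ words st' 14 0 = bval bits q r) st.
Proof.
move=> bs ad; have -> : (3 + 3 * r = 1 + (2 + 3 * r))%N by lia.
apply: wp_seq; apply: wp_setI; first by rewrite /=; lia.
set st1 := State _ _.
have fr1 : frame [:: 14; 15] [::] st st1.
  by apply: frame_sub (frame_setI _ _ _ _).
have b1 : base st1 by apply: (base_frame fr1).
have rW : (2 ^ r < W)%N by rewrite -HM; lia.
have rr : (r < 2 ^ r)%N by apply: ltn_expl.
apply: wp_weaken (_ : wp W _ _ (fun st' => frame [:: 14; 15] [::] st1 st' /\
   words st' 14 0 = bval bits q r) st1) (leqnn _) _; last first.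
  by move=> st' [fr2 e]; split=> //; apply: frame_trans fr1 fr2.
apply: (wp_for_setI (P := fun i A => A 0%N = bval bits q i)) => //.
- lia.
- by move=> st' fr; have [_ _ [_ h _ _]] := base_frame fr isT isT b1.
move=> i st' ir fr vi Ai.
have [_ [_ _ hb _] _] := base_frame fr isT isT b1.
have -> : ieval st' (IAdd (IMul (INat 2) (iv 14)) (IGet 3 (IAdd addr (iv 15)))) =
   bval bits q i.+1.
  by rewrite /= hb vi Ai mul2n ad //; apply: frame_trans fr1 fr.
split; last by rewrite eqxx.
by apply: leq_ltn_trans rW; rewrite ltnW // (leq_trans (bval_lt _ _ _)) // leq_exp2l.
Qed.

Definition table k : {ffun 'I_r -> 'I_M} :=
  [ffun b : 'I_r => inord (bval bits (table_at M' r d k b) r)].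

(** Doubling: round [b] fills the cells from [2 ^ b] to [2 ^ b.+1 - 1] out of the first [2 ^ b], by
    [hshD]. The copies form a geometric sum, and [r * r] coins are read. *)
Lemma hash_spec k st : base st -> words st 9 0 = k ->
  wp W hash_prog (4 + \sum_(b < r) (8 + 3 * r + 3 * 2 ^ b))
    (fun st' => frame [:: 10; 11; 12; 13; 14; 15] [::] st st' /\
       forall i, (i < M)%N -> words st' 10 i = hsh (table k) i) st.
Proof.
move=> bs wk; have rr : (r < 2 ^ r)%N by apply: ltn_expl.
set Th := (\sum_(b < r) _)%N; have -> : (4 + Th = 1 + (1 + (2 + Th)))%N by lia.
rewrite {}/Th.
apply: wp_seq; apply: wp_setI; first by rewrite /=; lia.
set st1 := State _ _; have fr1 : frame [:: 10] [::] st st1 by apply: frame_setI.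
apply: wp_seq; apply: wp_setI; first by rewrite /=; lia.
set st2 := State _ _; have fr2 : frame [:: 12] [::] st1 st2 by apply: frame_setI.
have -> : (\sum_(b < r) (8 + 3 * r + 3 * 2 ^ b) =
    \sum_(b < r) ((3 + 3 * r) + ((2 + 3 * 2 ^ b) + 1) + 2))%N.
  by apply: eq_bigr => b _; lia.
have fr : frame [:: 10; 11; 12; 13; 14; 15] [::] st st2.
  by apply: frame_trans (frame_sub _ _ fr1) (frame_sub _ _ fr2).
apply: (wp_for (I := fun b st' => [/\ frame [:: 10; 11; 12; 13; 14; 15] [::] st st',
    words st' 12 0 = 2 ^ b & forall i, i < 2 ^ b -> words st' 10 i = hsh (table k) i]%N)
  (Tb := fun b => ((3 + 3 * r) + ((2 + 3 * 2 ^ b) + 1))%N)).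
- lia.
- move=> st' fr'; split; first by apply: frame_trans fr _; apply: frame_sub fr'.
    by rewrite fr'.1 // /st2 /= updateE.
  move=> i; rewrite expn0 ltnS leqn0 => /eqP->; rewrite fr'.1 //.
  by rewrite fr2.1 // /st1 /= updateE /= hsh0.
- by move=> i st' _ _ [fr' _ _]; have [_ _ [_ h _ _]] := base_frame fr' isT isT bs.
- move=> b st3 br b3 [fr3 len3 H3].
  have bs3 := base_frame fr3 isT isT bs.
  apply: wp_seq; apply: wp_weaken (read_spec (q := table_at M' r d k b) bs3 _) (leqnn _) _.
    move=> st4 fr4; have [[_ _ e2 _] _ [e4 e5 _ _]] := base_frame fr4 isT isT bs3.
    by rewrite /= e2 e4 e5 !fr4.1 // b3 fr3.1 // wk.
  move=> st4 [fr4 v4].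
  have bs4 := base_frame fr4 isT isT bs3.
  have e4 : words st4 4 0 = M by case: bs4 => _ _ [].
  have lenM : (2 ^ b.+1 <= M)%N by rewrite HM leq_exp2l.
  rewrite expnS in lenM.
  have len4 : words st4 12 0 = (2 ^ b)%N by rewrite fr4.1.
  apply: wp_seq.
  apply: wp_weaken (wp_for_setI (N := (2 ^ b)%N)
    (P := fun i A => forall j, (j < 2 ^ b + i)%N -> A j = hsh (table k) j) _ _ _ _ _)
    (leqnn _) _ => //.
  + by lia.
  + by move=> j; rewrite addn0 fr4.1 //; apply: H3.
  + by move=> st5 fr5 /=; rewrite fr5.1.
  + move=> i st5 ib fr5 i5 H5 /=; rewrite i5 (fr5.1 12%N isT) (fr5.1 14%N isT) (fr5.1 4%N isT) len4 v4 e4 H5; last by lia.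
    split; first by apply: leq_trans (ltn_pmod _ _) _ => //; lia.
    move=> j jb; case: eqP => [->|/eqP ne]; last by apply: H5; lia.
    (* Addition in ['I_M] is addition modulo [M], which is what [IMod] computes. *)
    have -> := hshD (table k) (b := Ordinal br) ib; rewrite /= ffunE; congr (_ %% _)%N; congr (_ + _)%N.
    by rewrite inordK // HM bval_lt.
  move=> st5 [fr5 H5]; apply: wp_setI => /=; rewrite fr5.1 // len4; first lia.
  split; first by rewrite /update /= fr5.1 // fr4.1.
  move=> st6 fr6; split.
  + apply: frame_trans fr3 _; apply: frame_trans (frame_sub _ _ fr4) _ => //.
    apply: frame_trans (frame_sub _ _ fr5) _ => //.
    by apply: frame_trans (frame_sub _ _ (frame_setI _ _ _ _)) (frame_sub _ _ fr6).
  + by rewrite fr6.1 //= updateE expnS.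
  by move=> i ib; rewrite fr6.1 // /update /= H5 // addnn -mul2n -expnS.
by move=> st' [fr' _ H']; split=> // i iM; apply: H'; rewrite -HM.
Qed.

Definition gtab k : {ffun 'I_d -> 'I_M} :=
  [ffun j : 'I_d => inord (bval bits (g_at M' r d k j) r)].
Definition col_sum k (c : 'I_n) v :=
  \sum_(j < d) (gidx (gtab k) j == v)%:R * ((-1) ^+ bits (tau_at M' r d k j) * X j c).

Let bound4 st : base st -> ieval st (iv 4) = M.
Proof. by case=> _ _ []. Qed.

Let bound46 st : base st -> ieval st (IAdd (iv 4) (iv 6)) = (M + 2 ^ l)%N.
Proof. by case=> _ _ [/= -> _ ->]. Qed.

Let l_le_M : (2 ^ l <= M)%N.
Proof. by rewrite HM leq_exp2l. Qed.

Lemma seekE st k off : base st -> words st 9 0 = k ->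
  ieval st (seek off) = (k * step_bits M' r d + ieval st off)%N.
Proof. by move=> [[_ _ e2 _] _ [e4 e5 _ _]] e9; rewrite /= e9 e2 e4 e5. Qed.

Lemma clear_spec st : base st ->
  wp W clear_prog (2 + 3 * (M + 2 ^ l))
    (fun st' => frame [:: 13] [:: 4] st st' /\
       forall j, (j < M + 2 ^ l)%N -> reals st' 4%N j = 0) st.
Proof.
move=> bs; apply: (wp_for_setR (P := fun i A => forall j, (j < i)%N -> A j = 0)) => //.
- have := l_le_M; lia.
- by move=> st' fr; apply: bound46; apply: base_frame fr isT isT bs.
move=> i st' _ fr vi Ai j ji /=; rewrite vi; case: eqP => // ne.
by apply: Ai; lia.
Qed.

Lemma scatter_y_spec k st : base st -> words st 9 0 = k ->
    (forall i, (i < M)%N -> words st 10 i = hsh (table k) i) ->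
    (forall j, (j < M + 2 ^ l)%N -> reals st 4%N j = 0) ->
  wp W scatter_y_prog (2 + 3 * M)
    (fun st' => frame [:: 13] [:: 4] st st' /\
       forall j, (j < M + 2 ^ l)%N -> reals st' 4%N j = \sum_(i < M)
         (val (hsh (table k) i) == j)%:R *
         ((-1) ^+ bits (sigma_at M' r d k i) * reals st 3%N i)) st.
Proof.
move=> bs wk Hh A0; apply: (wp_for_setR (P := fun i A => forall j, (j < M + 2 ^ l)%N ->
  A j = \sum_(i' < i) (val (hsh (table k) i') == j)%:R *
         ((-1) ^+ bits (sigma_at M' r d k i') * reals st 3%N i'))) => //.
- lia.
- by move=> j jM; rewrite big_ord0 A0.
- by move=> st' fr; apply: bound4; apply: base_frame fr isT isT bs.
move=> i st' iM fr vi Ai j jM.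
have bs' := base_frame fr isT isT bs.
have k' : words st' 9 0 = k by rewrite fr.1.
have b3 : ieval st' (IGet 3 (seek (iv 13))) = bits (sigma_at M' r d k i).
  by have [_ [_ _ h _] _] := bs'; rewrite -[LHS]/(words st' 3 (ieval st' (seek (iv 13)))) h (seekE _ bs' k') /= vi.
have hi : ieval st' (IGet 10 (iv 13)) = hsh (table k) i by rewrite /= vi fr.1 // Hh.
rewrite big_ord_recr /= -Ai // [val _ == j]eq_sym.
rewrite -[reals st' 4%N (words st' 10 _)]/(reals st' 4%N (ieval st' (IGet 10 (iv 13)))).
rewrite -[words st' 10 _]/(ieval st' (IGet 10 (iv 13))) hi.
case: eqP => [->|_]; last by rewrite mul0r addr0.
rewrite mul1r -(rsignE b3); congr (_ + _ * _); by rewrite vi fr.2.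
Qed.

Lemma scatter_x_spec k (c : 'I_n) st : base st -> words st 9 0 = k -> words st 8 0 = c ->
    (forall v, (v < 2 ^ l)%N -> reals st 4%N (M + v)%N = 0) ->
  wp W scatter_x_prog
    (2 + size (csc_col X c) * (7 + 3 * (if (d <= M)%N then 0 else r)))
    (fun st' => [/\ frame [:: 13; 14; 15] [:: 4] st st',
       forall j, (j < M)%N -> reals st' 4%N j = reals st 4%N j &
       forall v, (v < 2 ^ l)%N -> reals st' 4%N (M + v)%N = col_sum k c v]) st.
Proof.
move=> bs wk wc A0; set rr := if _ then _ else _.
set col := csc_col X c.
have -> : (size col * (7 + 3 * rr) = \sum_(q < size col) ((4 + 3 * rr + 1) + 2))%N.
  by rewrite sum_nat_const card_ord; lia.
pose S (s : seq 'I_d) v : R :=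
  \sum_(j <- s) (gidx (gtab k) j == v)%:R * ((-1) ^+ bits (tau_at M' r d k j) * X j c).
have fr_start st' : frame [:: 13; 14; 15] [:: 4] st st' ->
    ieval st' (IGet 1 (iv 8)) = csc_start X c.
  move=> fr; rewrite /= fr.1 // fr.1 // wc; case: bs => _ [h _ _ _] _.
  by rewrite h // ltnW.
apply: (wp_for (Tb := fun=> (4 + 3 * rr + 1)%N) (I := fun q st' =>
    [/\ frame [:: 13; 14; 15] [:: 4] st st',
       forall j, (j < M)%N -> reals st' 4%N j = reals st 4%N j &
       forall v, (v < 2 ^ l)%N -> reals st' 4%N (M + v)%N = S (take q col) v])).
- by apply: leq_ltn_trans dW; apply: size_csc_col.
- move=> st' fr; split; first by apply: frame_sub fr.
    by move=> j _; rewrite fr.2.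
  by move=> v vl; rewrite fr.2 // A0 // /S take0 big_nil.
- move=> q st' _ _ [fr _ _]; have e := fr_start st' fr.
  rewrite [LHS]/= -[words st' 1 (words st' 8 0)]/(ieval st' (IGet 1 (iv 8))) e.
  rewrite fr.1 // fr.1 // wc; case: bs => _ [h _ _ _] _.
  by rewrite addn1 h // csc_startS addKn.
- move=> q st' qs q13 [fr Alow Ax].
  have bs' := base_frame fr isT isT bs.
  have /hasP[j0 _ _] : has predT col by rewrite has_predT (leq_ltn_trans _ qs).
  pose j := nth j0 col q.
  have entryE st2 : frame [:: 14; 15] [::] st' st2 ->
      ieval st2 entry = (csc_start X c + q)%N.
    move=> fr2; rewrite [LHS]/=.
    rewrite -[words st2 1 (words st2 8 0)]/(ieval st2 (IGet 1 (iv 8))) (fr_start st2).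
      by rewrite fr2.1 // q13.
    by apply: frame_trans fr (frame_sub _ _ fr2).
  have rowE st2 : frame [:: 14; 15] [::] st' st2 -> ieval st2 (IGet 2 entry) = j.
    move=> fr2; have [_ [_ h _ _] _] := base_frame fr2 isT isT bs'.
    by rewrite -(nth_csc_rows j0 qs) -(entryE _ fr2) -h.
  apply: wp_seq; apply: wp_weaken (_ : wp W _ _ (fun st2 =>
    frame [:: 14; 15] [::] st' st2 /\ words st2 14 0 = gidx (gtab k) j) st') (leqnn _) _.
    have cond : beval st' (BLeI (IGet 0 (INat 2)) (iv 4)) = (d <= M)%N.
      by case: bs' => [[_ _ e2 _] _ [e4 _ _ _]] /=; rewrite e2 e4.
    rewrite -[(4 + 3 * rr)%N]/(3 + 3 * rr).+1; apply: wp_if => ht.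
      rewrite cond in ht; apply: wp_weaken (_ : wp W _ 1 _ _) _ (fun _ h => h); last by lia.
      have jE := rowE st' (@frame_refl _ _ _ _).
      apply: wp_setI; first by rewrite jE; apply: ltn_trans dW.
      split; first by apply: frame_sub (frame_setI _ _ _ _).
      by rewrite /= updateE /= -[LHS]/(ieval st' (IGet 2 entry)) jE /gidx ht.
    rewrite cond in ht; rewrite /rr (negPf ht).
    apply: wp_weaken (read_spec (q := g_at M' r d k j) bs' _) (leqnn _) _.
      move=> st2 fr2; have bs2 := base_frame fr2 isT isT bs'.
      have k2 : words st2 9 0 = k by rewrite fr2.1 // fr.1.
      rewrite -[LHS]/(ieval st2 (seek (IAdd tau_off (IGet 0 (INat 2)))) + ieval st2 (IGet 2 entry) * words st2 5 0)%N.
      rewrite (seekE _ bs2 k2) (rowE _ fr2); case: bs2 => [[_ _ e2 _] _ [e4 e5 _ _]].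
      by rewrite /= e2 e4 e5 /g_at !addnA.
    move=> st2 [fr2 v2]; split=> //; rewrite v2 /gidx (negPf ht) ffunE.
    by rewrite /= inordK // HM bval_lt.
  move=> st2 [fr2 v2]; have bs2 := base_frame fr2 isT isT bs'.
  have k2 : words st2 9 0 = k by rewrite fr2.1 // fr.1.
  apply: wp_setR; split; first by rewrite /= fr2.1.
  move=> st3 fr3.
  have idx : ieval st2 (IAdd (iv 4) (iv 14)) = (M + gidx (gtab k) j)%N.
    by case: bs2 => _ _ [e4 _ _ _]; rewrite /= e4 v2.
  have sgn : ieval st2 (IGet 3 (IAdd (seek tau_off) (IGet 2 entry))) =
      bits (tau_at M' r d k j).
    have -> : ieval st2 (IGet 3 (IAdd (seek tau_off) (IGet 2 entry))) =
      words st2 3 (ieval st2 (seek tau_off) + ieval st2 (IGet 2 entry))%N by [].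
    rewrite (seekE _ bs2 k2) (rowE _ fr2); case: bs2 => _ [_ _ h _] [e4 e5 _ _].
    by rewrite h /= e4 e5 /tau_at !addnA.
  have val : reval st2 (RGet 1 entry) = X j c.
    have -> : reval st2 (RGet 1 entry) = reals st2 1%N (ieval st2 entry) by [].
    rewrite (entryE _ fr2); case: bs2 => _ [_ _ _ h] _.
    by rewrite h (nth_csc_vals j0 qs).
  have A3 i : reals st3 4%N i = if i == (M + gidx (gtab k) j)%N then
      reals st' 4%N i + (-1) ^+ bits (tau_at M' r d k j) * X j c else reals st' 4%N i.
    rewrite fr3.2 //= updateE -[(_ + words st2 14 0)%N]/(ieval st2 (IAdd (iv 4) (iv 14))).
    rewrite idx -(rsignE sgn) -val /= fr2.2 //; case: eqP => // ->.
    by rewrite -v2; case: bs2 => _ _ [-> _ _ _].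
  split.
  + apply: frame_trans fr _; apply: frame_trans (frame_sub _ _ fr2) _ => //.
    by apply: frame_trans (frame_sub _ _ (frame_setR _ _ _ _)) (frame_sub _ _ fr3).
  + move=> i iM; rewrite A3 Alow //; case: eqP => // e.
    by rewrite e -ltn_subRL subnn in iM.
  move=> v vl; rewrite A3 Ax // /S (take_nth j0) // -cats1 big_cat big_seq1 /= -/j.
  rewrite eqn_add2l eq_sym; case: eqP => _; last by rewrite mul0r addr0.
  by rewrite mul1r.
move=> st' [fr Alow Ax]; split=> // v vl; rewrite Ax // take_size /S sum_csc_col // => j ->.
by rewrite !mulr0.
Qed.

Lemma wht_spec st : base st ->
  wp W wht_prog (3 + l * (7 + 6 * (M + 2 ^ l)))
    (fun st' => frame [:: 11; 12; 13] [:: 4; 5] st st' /\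
       forall i, (i < M + 2 ^ l)%N -> reals st' 4%N i = wht l (reals st 4%N) i) st.
Proof.
move=> bs; set N := (M + 2 ^ l)%N.
have NW : (N < W)%N by have := l_le_M; rewrite /N; lia.
have lN : (2 ^ l %| N)%N by rewrite dvdn_add // HM dvdn_exp2l.
have lW : (l < W)%N.
  by apply: leq_ltn_trans lr (leq_ltn_trans (ltnW (ltn_expl r (isT : 1 < 2)%N)) _);
    rewrite -HM; lia.
set T := (l * _)%N; have -> : (3 + T = 1 + (2 + T))%N by lia.
apply: wp_seq; apply: wp_setI; first by rewrite /=; lia.
set st1 := State _ _; have fr1 : frame [:: 12] [::] st st1 by apply: frame_setI.
have -> : T = (\sum_(b < l) ((2 + 3 * N) + ((2 + 3 * N) + 1) + 2))%N.
  by rewrite sum_nat_const card_ord /T; congr (_ * _)%N; lia.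
apply: (wp_for (Tb := fun b => ((2 + 3 * N) + ((2 + 3 * N) + 1))%N) (I := fun b st' =>
  [/\ frame [:: 11; 12; 13] [:: 4; 5] st st', words st' 12 0 = (2 ^ b)%N &
      forall i, (i < N)%N -> reals st' 4%N i = wht b (reals st 4%N) i])) => //.
- move=> st' fr'; split; last by move=> i _; rewrite fr'.2.
    by apply: frame_trans (frame_sub _ _ fr1) (frame_sub _ _ fr').
  by rewrite fr'.1 //= updateE.
- by move=> b st' _ _ [fr _ _]; have [_ _ []] := base_frame fr isT isT bs.
- move=> b st2 bl b2 [fr2 len2 A2].
  have bs2 := base_frame fr2 isT isT bs.
  have lenM : (2 ^ b.+1 <= M)%N by rewrite HM leq_exp2l // (leq_trans bl).
  apply: wp_seq; apply: wp_weaken (wp_for_setR (N := N)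
    (P := fun i A => forall j, (j < i)%N -> A j = stage b (reals st2 4%N) j)
    NW _ _ _) (leqnn _) _ => //.
  + by move=> st3 fr3; apply: bound46; apply: base_frame fr3 isT isT bs2.
  + move=> i st3 iN fr3 i3 B3 j ji.
    have -> : ieval st3 (iv 13) = i by [].
    case: eqP => [ji'|ne]; last by apply: B3; lia.
    have up : ieval st3 upper_half = odd (i %/ 2 ^ b).
      by rewrite /= i3 fr3.1 // len2 modn2.
    have pt : ieval st3 (ISub (IAdd (iv 13) (iv 12)) (IMul (IMul (INat 2) (iv 12)) upper_half))
        = (if odd (i %/ 2 ^ b) then i - 2 ^ b else i + 2 ^ b)%N.
      rewrite -[LHS]/(words st3 13 0 + words st3 12 0 -
        2 * words st3 12 0 * ieval st3 upper_half)%N up i3 fr3.1 // len2.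
      by case: odd; lia.
    rewrite -[LHS]/(reals st3 4%N (ieval st3 (ISub (IAdd (iv 13) (iv 12))
      (IMul (IMul (INat 2) (iv 12)) upper_half))) + reval st3 (rsign upper_half) *
      reals st3 4%N (words st3 13 0)) pt (rsignE up) i3 fr3.2 // ji' /stage.
    by case: odd; rewrite ?expr0 ?expr1 ?mul1r ?mulN1r.
  move=> st3 [fr3 B3]; have bs3 := base_frame fr3 isT isT bs2.
  apply: wp_seq; apply: wp_weaken (wp_for_setR (N := N)
    (P := fun i A => forall j, (j < i)%N -> A j = stage b (reals st2 4%N) j)
    NW _ _ _) (leqnn _) _ => //.
  + by move=> st4 fr4; apply: bound46; apply: base_frame fr4 isT isT bs3.
  + move=> i st4 iN fr4 i4 A4 j ji /=; rewrite i4 fr4.2 //.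
    case: eqP => [->|ne]; first exact: B3.
    by apply: A4; lia.
  move=> st4 [fr4 A4]; apply: wp_setI => /=; rewrite fr4.1 // fr3.1 // len2.
    by rewrite -expnS (leq_ltn_trans lenM) //; lia.
  split; first by rewrite /update /= fr4.1 // fr3.1.
  move=> st5 fr5; split.
  + apply: frame_trans fr2 _; apply: frame_trans (frame_sub _ _ fr3) _ => //.
    apply: frame_trans (frame_sub _ _ fr4) _ => //.
    by apply: frame_trans (frame_sub _ _ (frame_setI _ _ _ _)) (frame_sub _ _ fr5).
  + by rewrite fr5.1 //= updateE expnS.
  move=> i iN; rewrite fr5.2 //= A4 //; exact: eq_stage bl lN A2 iN.
by move=> st' [].
Qed.

Lemma product_spec st : base st ->
  wp W product_prog (2 + 3 * M)
    (fun st' => frame [:: 13] [:: 4] st st' /\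
       forall i, (i < M)%N -> reals st' 4%N i =
         reals st 4%N i * reals st 4%N (M + i %% 2 ^ l)%N / (2 ^ l)%:R) st.
Proof.
(* The invariant also keeps track of the cells not yet overwritten: both factors, cell [i] and a
   cell from [M] on, are read from the array being written. *)
move=> bs; apply: wp_weaken (wp_for_setR (N := M) (P := fun i A =>
   (forall j, (j < i)%N -> A j =
      reals st 4%N j * reals st 4%N (M + j %% 2 ^ l)%N / (2 ^ l)%:R) /\
   (forall j, (i <= j)%N -> A j = reals st 4%N j)) _ _ _ _) (leqnn _) _ => //.
- lia.
- by move=> st' fr; apply: bound4; apply: base_frame fr isT isT bs.
- move=> i st' iM fr vi [A1 A2].
  have [_ _ [e4 _ e6 _]] := base_frame fr isT isT bs.
  rewrite /= vi e4 e6; split=> j ji; case: eqP => ne.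
  + by rewrite !A2 ?ne //; lia.
  + by apply: A1; lia.
  + by rewrite ne ltnn in ji.
  + by apply: A2; lia.
by move=> st' [fr [A1 _]].
Qed.

Lemma copy_spec st : base st ->
  wp W copy_prog (2 + 3 * M)
    (fun st' => frame [:: 13] [:: 3] st st' /\
       forall i, (i < M)%N -> reals st' 3%N i = reals st 4%N i) st.
Proof.
move=> bs; apply: (wp_for_setR (P := fun i A => forall j, (j < i)%N -> A j = reals st 4%N j)) => //.
- lia.
- by move=> st' fr; apply: bound4; apply: base_frame fr isT isT bs.
move=> i st' iM fr vi A1 j ji /=; rewrite vi fr.2 //.
by case: eqP => [->|ne] //; apply: A1; lia.
Qed.

End StepSpec.

(** * The program on one column and on all columns *)

Definition column_prog : cmd :=
  Seq (For 13 (iv 4) (SetR 3 (iv 13) (RNat (INat 0))))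
  (Seq (SetR 3 (INat 0) (RNat (INat 1)))
  (Seq (For 9 (IGet 0 (INat 1)) step_prog)
       (For 13 (iv 4) (SetR 2 (IAdd (IMul (iv 8) (IGet 0 (INat 3))) (iv 13)) (RGet 3 (iv 13)))))).

Definition sizes_prog : cmd :=
  Seq (SetI 4 (INat 0) (INat 1)) (Seq (SetI 5 (INat 0) (INat 0))
  (Seq (While (BLeI (IMul (INat 2) (iv 4)) (IGet 0 (INat 3)))
          (Seq (SetI 4 (INat 0) (IMul (INat 2) (iv 4))) (SetI 5 (INat 0) (IAdd (iv 5) (INat 1)))))
  (Seq (SetI 6 (INat 0) (INat 1)) (Seq (SetI 7 (INat 0) (INat 0))
     (While (BAnd (BNot (BLeI (IGet 0 (INat 2)) (iv 6))) (BLeI (IMul (INat 2) (iv 6)) (iv 4)))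
        (Seq (SetI 6 (INat 0) (IMul (INat 2) (iv 6))) (SetI 7 (INat 0) (IAdd (iv 7) (INat 1)))))))))
.

Definition sketch_prog : cmd :=
  If (BAnd (BNot (BLeR (RNat (INat 1)) (RGet 0 (INat 0))))
           (BLeI (IMul (INat 320) (IGet 0 (INat 1))) (IGet 0 (INat 3))))
     (Seq sizes_prog (For 8 (IGet 0 (INat 0)) column_prog)) Skip.

Section Top.
Variables (R : realType) (W M' r l n p d m : nat) (X : 'M[R]_(d, n)) (bits : nat -> bool).
Local Notation M := M'.+1.
Hypotheses (HM : M = (2 ^ r)%N) (lr : (l <= r)%N).
Hypothesis Hd : if (d <= M)%N then (d <= 2 ^ l)%N else l == r.
Hypotheses (MW : (2 * M < W)%N) (dW : (d < W)%N) (pW : (p < W)%N) (nW : (n < W)%N).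
Hypothesis (Mm : (M <= m)%N).
Implicit Types (st : state R) (y : 'I_M -> R).
Local Notation base := (@base R M' r l n p d m X bits).

Definition ystep k (c : 'I_n) y (w : 'I_M) : R :=
  step (@hash M' r) (@bk M' l d) (decode1 M' r d bits k) (fun i j (_ : unit) => y i * X j c) w tt.

Fixpoint ysteps k (c : 'I_n) : 'I_M -> R :=
  if k is k'.+1 then ystep k' c (ysteps k' c) else fun i => (i == ord0)%:R.

(** For a pair [(i, j)] the only nonzero term has [v = gidx g j]; moving the exclusive or to the
    other side turns its condition into the bucket condition. *)
Lemma conv_buckets (h : 'I_M -> 'I_M) (g : {ffun 'I_d -> 'I_M}) (al : 'I_M -> R) (be : 'I_d -> R)
    (w : 'I_M) :
  \sum_(v < 2 ^ l) (\sum_i (val (h i) == xr l w v)%:R * al i) *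
     (\sum_j (gidx g j == v)%:R * be j) =
  \sum_i \sum_j (bk l g (h i) j == w)%:R * (al i * be j).
Proof.
transitivity (\sum_(v < 2 ^ l) \sum_i \sum_j
    (val (h i) == xr l w v)%:R * (gidx g j == v)%:R * (al i * be j)).
  apply: eq_bigr => v _; rewrite big_distrlr /=; apply: eq_bigr => i _.
  by apply: eq_bigr => j _; ring.
rewrite exchange_big /=; apply: eq_bigr => i _.
rewrite exchange_big /=; apply: eq_bigr => j _.
rewrite (bigD1 (Ordinal (gidx_lt HM Hd g j))) //= eqxx big1 ?addr0; last first.
  move=> v vg; rewrite [gidx g j == v](_ : _ = false) ?mulr0 ?mul0r //.
  by apply/negbTE; apply: contra vg => /eqP e; apply/eqP/val_inj.
rewrite mulr1; congr (_%:R * _); congr nat_of_bool.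
rewrite -val_eqE /= (val_bk HM lr); apply/eqP/eqP => [->|<-]; by rewrite xrK.
Qed.

Definition step_time (c : 'I_n) : nat :=
  ((4 + \sum_(b < r) (8 + 3 * r + 3 * 2 ^ b)) +
  ((2 + 3 * (M + 2 ^ l)) + ((2 + 3 * M) +
  ((2 + size (csc_col X c) * (7 + 3 * (if (d <= M)%N then 0 else r))) +
  ((3 + l * (7 + 6 * (M + 2 ^ l))) + ((2 + 3 * M) +
  ((3 + l * (7 + 6 * (M + 2 ^ l))) + (2 + 3 * M))))))))%N.

Lemma step_spec k (c : 'I_n) y st : base st -> words st 9 0 = k -> words st 8 0 = c ->
    (forall i : 'I_M, reals st 3%N i = y i) ->
  wp W step_prog (step_time c)
    (fun st' => frame [:: 10; 11; 12; 13; 14; 15] [:: 3; 4; 5] st st' /\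
       forall w : 'I_M, reals st' 3%N w = ystep k c y w) st.
Proof.
move=> bs wk wc Y0.
apply: wp_seq; apply: wp_weaken (hash_spec HM lr Hd MW dW pW nW Mm bs wk) (leqnn _) _ => st1 [fr1 H1].
have b1 := base_frame fr1 isT isT bs.
apply: wp_seq; apply: wp_weaken (clear_spec HM lr Hd MW dW pW nW Mm b1) (leqnn _) _ => st2 [fr2 A2].
have b2 := base_frame fr2 isT isT b1.
have k2 : words st2 9 0 = k by rewrite fr2.1 // fr1.1.
have H2 i : (i < M)%N -> words st2 10 i = hsh (table M' r d bits k) i.
  by move=> iM; rewrite fr2.1 // H1.
apply: wp_seq; apply: wp_weaken (scatter_y_spec HM lr Hd MW dW pW nW Mm b2 k2 H2 A2) (leqnn _) _ => st3 [fr3 A3].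
have b3 := base_frame fr3 isT isT b2.
have k3 : words st3 9 0 = k by rewrite fr3.1.
have c3 : words st3 8 0 = c by rewrite fr3.1 // fr2.1 // fr1.1.
have A3' v : (v < 2 ^ l)%N -> reals st3 4%N (M + v)%N = 0.
  move=> vl; rewrite A3 ?ltn_add2l // big1 // => i _.
  rewrite (_ : (_ == _) = false) ?mul0r //; apply/negbTE; rewrite neq_ltn.
  by rewrite (leq_trans (ltn_ord _)) // leq_addr.
apply: wp_seq; apply: wp_weaken (scatter_x_spec HM lr Hd MW dW pW nW Mm b3 k3 c3 A3') (leqnn _) _.
move=> st4 [fr4 A4 A4']; have b4 := base_frame fr4 isT isT b3.
apply: wp_seq; apply: wp_weaken (wht_spec HM lr Hd MW dW pW nW Mm b4) (leqnn _) _ => st5 [fr5 A5].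
have b5 := base_frame fr5 isT isT b4.
apply: wp_seq; apply: wp_weaken (product_spec HM lr Hd MW dW pW nW Mm b5) (leqnn _) _ => st6 [fr6 A6].
have b6 := base_frame fr6 isT isT b5.
apply: wp_seq; apply: wp_weaken (wht_spec HM lr Hd MW dW pW nW Mm b6) (leqnn _) _ => st7 [fr7 A7].
have b7 := base_frame fr7 isT isT b6.
apply: wp_weaken (copy_spec HM lr Hd MW dW pW nW Mm b7) (leqnn _) _ => st8 [fr8 A8]; split.
  apply: frame_trans (frame_sub _ _ fr1) _ => //.
  apply: frame_trans (frame_sub _ _ fr2) _ => //.
  apply: frame_trans (frame_sub _ _ fr3) _ => //.
  apply: frame_trans (frame_sub _ _ fr4) _ => //.
  apply: frame_trans (frame_sub _ _ fr5) _ => //.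
  apply: frame_trans (frame_sub _ _ fr6) _ => //.
  by apply: frame_trans (frame_sub _ _ fr7) (frame_sub _ _ fr8).
move=> w; have wM := ltn_ord w.
(* Since [M] is a multiple of [2 ^ l], the input column, stored from cell [M] on, is an aligned
   block too, namely number [2 ^ (r - l)], as [wht_product] expects. *)
have MK : (M = 2 ^ (r - l) * 2 ^ l)%N by rewrite -expnD subnK // -HM.
have wMl : (w < M + 2 ^ l)%N by apply: leq_trans wM (leq_addr _ _).
rewrite A8 // A7 //.
rewrite (@eq_wht _ l l M _ (fun i => wht l (reals st4 4%N) i *
   wht l (reals st4 4%N) (2 ^ (r - l) * 2 ^ l + i %% 2 ^ l)%N / 2 ^+ l)) //; first last.
- move=> i iM; rewrite A6 // -MK !A5 ?natrX //; last by apply: leq_trans iM (leq_addr _ _).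
  by rewrite ltn_add2l ltn_mod expn_gt0.
- by rewrite MK dvdn_mull.
rewrite wht_product -?MK //.
pose al (i : 'I_M) := (-1) ^+ bits (sigma_at M' r d k i) * y i.
pose be (j : 'I_d) := (-1) ^+ bits (tau_at M' r d k j) * X j c.
transitivity (\sum_(v < 2 ^ l)
   (\sum_(i < M) (val (hsh (table M' r d bits k) i) == xr l w v)%:R * al i) *
   (\sum_j (gidx (gtab M' r d bits k) j == v)%:R * be j)).
  apply: eq_bigr => v _; rewrite A4' //; congr (_ * _).
  have xM : (xr l w v < M)%N by rewrite [X in (_ < X)%N]HM xr_lt // -HM.
  rewrite A4 // A3; last by apply: leq_trans xM (leq_addr _ _).
  apply: eq_bigr => i _; rewrite /al fr2.2 // fr1.2 // Y0 //.
rewrite (conv_buckets (fun i : 'I_M => hsh (table M' r d bits k) i)).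
rewrite /ystep /step /decode1; apply: eq_bigr => i _; apply: eq_bigr => j _.
rewrite /sg !ffunE /al /be /hash /table /gtab; congr (_ * _); ring.
Qed.

Definition column_time (c : 'I_n) : nat :=
  ((2 + 3 * M) + (1 + ((2 + p * (step_time c + 2)) + (2 + 3 * M))))%N.

Lemma column_spec (c : 'I_n) st : base st -> words st 8 0 = c ->
  wp W column_prog (column_time c)
    (fun st' => frame [:: 9; 10; 11; 12; 13; 14; 15] [:: 2; 3; 4; 5] st st' /\
       forall (c' : 'I_n) (i : 'I_m), reals st' 2%N (c' * m + i)%N =
         if c' == c then (if insub (val i) is Some w then ysteps p c w
                          else reals st 2%N (c' * m + i)%N)
         else reals st 2%N (c' * m + i)%N) st.
Proof.
move=> bs wc; have MW' : (M < W)%N by lia.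
apply: wp_seq; apply: wp_weaken (wp_for_setR (N := M)
  (P := fun i A => forall j, (j < i)%N -> A j = 0) MW' _ _ _) (leqnn _) _ => //.
- by move=> st1 fr1; have [_ _ []] := base_frame fr1 isT isT bs.
- by move=> i st1 iM fr1 i1 A1 j ji /=; rewrite i1; case: eqP => // ne; apply: A1; lia.
move=> st1 [fr1 Y1]; apply: wp_seq; apply: wp_setR; set st2 := State _ _.
have fr2 : frame [::] [:: 3] st1 st2 by apply: frame_setR.
have Y2 (i : 'I_M) : reals st2 3%N i = ysteps 0 c i.
  rewrite /= updateE /= -val_eqE /=; case: eqP => // ne; exact: Y1.
have b2 : base st2 by apply: base_frame fr2 isT isT (base_frame fr1 isT isT bs).
have F2 : frame [:: 9; 10; 11; 12; 13; 14; 15] [:: 3; 4; 5] st st2.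
  by apply: frame_trans (frame_sub _ _ fr1) (frame_sub _ _ fr2).
have -> : (p * (step_time c + 2) = \sum_(k < p) (step_time c + 2))%N.
  by rewrite sum_nat_const card_ord.
apply: wp_seq; apply: (wp_for (Tb := fun=> step_time c) (I := fun k st' =>
  frame [:: 9; 10; 11; 12; 13; 14; 15] [:: 3; 4; 5] st st' /\
  forall i : 'I_M, reals st' 3%N i = ysteps k c i)) => //.
- move=> st3 fr3; split; first by apply: frame_trans F2 (frame_sub _ _ fr3).
  by move=> i; rewrite fr3.2 // Y2.
- by move=> k st3 _ _ [F3 _]; have [[]] := base_frame F3 isT isT bs.
- move=> k st3 kp k3 [F3 Y3]; have b3 := base_frame F3 isT isT bs.
  apply: wp_weaken (step_spec b3 k3 _ Y3) (leqnn _) _; first by rewrite F3.1.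
  move=> st4 [fr4 Y4]; split; first by rewrite fr4.1.
  move=> st5 fr5; split; last by move=> i; rewrite fr5.2 // Y4.
  by apply: frame_trans F3 (frame_trans (frame_sub _ _ fr4) (frame_sub _ _ fr5)).
move=> st3 [F3 Y3]; have b3 := base_frame F3 isT isT bs.
apply: wp_weaken (wp_for_setR (N := M) (P := fun q A => forall (c' : 'I_n) (i : 'I_m),
   A (c' * m + i)%N = if c' == c then
      (if (i < q)%N then reals st3 3%N i else reals st 2%N (c' * m + i)%N)
    else reals st 2%N (c' * m + i)%N) MW' _ _ _) (leqnn _) _ => //.
- by move=> c' i; rewrite ltn0 F3.2 //; case: eqP.
- by move=> st4 fr4; have [_ _ []] := base_frame fr4 isT isT b3.
- move=> q st4 qM fr4 q4 A4 c' i.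
  have [[_ _ _ e3] _ _] := base_frame fr4 isT isT b3.
  have c4 : words st4 8 0 = c by rewrite fr4.1 // F3.1.
  have qm : (q < m)%N by apply: leq_trans qM Mm.
  rewrite /= e3 c4 q4 fr4.2 // A4.
  (* Both row indices are below [m], so division by [m] recovers column and row from the address. *)
  have -> : (c' * m + i == c * m + q)%N = (c' == c) && (i == q :> nat).
    apply/eqP/andP => [e|[/eqP-> /eqP->] //].
    have m0 : (0 < m)%N by apply: leq_trans qm.
    have := congr1 (divn^~ m) e; rewrite /= !divnMDl // !divn_small // !addn0 => e1.
    by split; apply/eqP; [apply: val_inj | move: e; rewrite e1 => /addnI].
  case: (c' == c) => //=; rewrite ltnS.
  by case: (ltngtP i q) => [||->].
move=> st4 [fr4 A4]; split.
  by apply: frame_trans (frame_sub _ _ F3) (frame_sub _ _ fr4).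
move=> c' i; rewrite A4; case: (c' == c) => //.
case: insubP => [w iM wi|]; last by move=> /negPf->.
by rewrite iM -wi Y3.
Qed.

Lemma columns_spec st : base st -> (forall i, reals st 2%N i = 0) ->
  wp W (For 8 (IGet 0 (INat 0)) column_prog) (2 + \sum_(c < n) (column_time c + 2))
    (fun st' => forall (c : 'I_n) (i : 'I_m), reals st' 2%N (c * m + i)%N =
         if insub (val i) is Some w then ysteps p c w else 0) st.
Proof.
move=> bs O0.
pose Tb c := if insub c is Some c' then column_time c' else 0%N.
have -> : (\sum_(c < n) (column_time c + 2) = \sum_(c < n) (Tb c + 2))%N.
  by apply: eq_bigr => c _; rewrite /Tb valK.
apply: (wp_for (Tb := Tb) (I := fun q st' =>
  frame [:: 8; 9; 10; 11; 12; 13; 14; 15] [:: 2; 3; 4; 5] st st' /\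
  forall (c : 'I_n) (i : 'I_m), reals st' 2%N (c * m + i)%N =
    if (c < q)%N then (if insub (val i) is Some w then ysteps p c w else 0) else 0)) => //.
- move=> st1 fr1; split; first by apply: frame_sub fr1.
  by move=> c i; rewrite fr1.2.
- by move=> q st1 _ _ [F1 _]; have [[]] := base_frame F1 isT isT bs.
- move=> q st1 qn q1 [F1 O1]; have b1 := base_frame F1 isT isT bs.
  rewrite /Tb insubT.
  apply: wp_weaken (column_spec (c := Ordinal qn) b1 q1) (leqnn _) _ => st2 [fr2 O2].
  split; first by rewrite fr2.1.
  move=> st3 fr3; split.
    by apply: frame_trans F1 (frame_trans (frame_sub _ _ fr2) (frame_sub _ _ fr3)).
  move=> c i; rewrite fr3.2 // O2 -val_eqE /= ltnS O1.
  case: (ltngtP c q) => // e.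
  have -> : c = Ordinal qn by apply: val_inj.
  by case: insubP.
by move=> st' [_ O'] c i; rewrite O' ltn_ord.
Qed.

End Top.

(** * Running time *)

Lemma frobenius_trmul (R : realType) D n (C E : 'M[R]_(D, n)) :
  frobenius (C^T *m E) <= frobenius C * frobenius E.
Proof.
have frE (F : 'M[R]_(D, n)) : frobenius F ^+ 2 = \sum_j \sum_k F k j ^+ 2.
  by rewrite frobenius_sqr exchange_big.
rewrite -(@ler_pXn2r _ 2) ?nnegrE ?mulr_ge0 ?frobenius_ge0 //.
rewrite exprMn !frE frobenius_sqr big_distrlr /=.
apply: ler_sum => i _; apply: ler_sum => j _.
rewrite mxE (eq_bigr (fun k => C k i * E k j)) => [|k _]; last by rewrite mxE.
exact: cauchy_schwarz_sum.
Qed.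

(** * Guarantees of the zero sketch *)

Section ZeroSketch.
Variables (R : realType) (m D : nat).
Let Z : 0.-tuple bool -> 'M[R]_(m, D) := fun=> 0.

Let all_coins (A : 0.-tuple bool -> Prop) : (forall w, A w) ->
  1 - 1 / 10 <= avg (fun w => (`[< A w >])%:R : R).
Proof.
move=> a; apply: (@le_trans _ _ 1); first lra.
have card0 : (0 < #|{: 0.-tuple bool}|)%N by rewrite card_tuple card_bool.
rewrite -[leLHS](avg_cst 1 card0); apply: le_avg => w.
by case: asboolP => // /(_ (a w)).
Qed.

Lemma zero_amp n eps : 1 <= eps -> approx_matrix_product eps (1 / 10) n (coin_law Z).
Proof.
move=> e1 C E; apply: coin_law_ge; apply: all_coins => w.
rewrite /Z !mulmx0 mul0mx sub0r.
have -> : frobenius (- (C^T *m E)) = frobenius (C^T *m E).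
  rewrite /frobenius; congr Num.sqrt; apply: eq_bigr => i _; apply: eq_bigr => j _.
  by rewrite mxE sqrrN.
apply: le_trans (frobenius_trmul _ _) _.
by rewrite -mulrA ler_peMl // mulr_ge0 ?frobenius_ge0.
Qed.

Lemma zero_ose n eps s : 1 <= eps \/ s <= eps ->
  oblivious_subspace_embedding eps (1 / 10) s n (coin_law Z).
Proof.
move=> es lambda A l0 sd; apply: coin_law_ge; apply: all_coins => w.
case: es => [e1|se]; first exact: zero_embedding_eps1.
by apply: zero_embedding => //; apply: le_trans sd se.
Qed.

End ZeroSketch.

(** * The chain on pure tensors *)

Section PureTensor.
Variables (R : realType) (M' r l n p d : nat) (X : 'M[R]_(d, n)) (bits : nat -> bool).
Local Notation M := M'.+1.

(** A step absorbs one factor and leaves a pure tensor. The program can therefore store the [M]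
    entries of [y] in place of a vector of length [d ^ p]. *)
Lemma hchain_pure q ks (c : 'I_n) (y : 'I_M -> R) w : size ks = q ->
  hchain l (p := q) [seq decode1 M' r d bits k | k <- ks]
    (fun i js => y i * \prod_(j <- js) X j c) w =
  foldl (fun y k => ystep r l X bits k c y) y ks w.
Proof.
elim: q ks y => [|q IH] [|k ks] y //= sz.
  by rewrite /hchain chain0 big_nil mulr1.
case: sz => sz; rewrite -IH // /hchain chain_cons; congr (chain _ _ _ _ w).
apply/funext => u; apply/funext => js; rewrite /ystep /step.
case: (decode1 _ _ _ _ _) => [[[g T] tau] sigma].
rewrite mulr_suml; apply: eq_bigr => i _; rewrite mulr_suml; apply: eq_bigr => j _.
by rewrite /= big_cons; ring.
Qed.

Lemma ysteps_foldl q (c : 'I_n) :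
  ysteps r l X bits q c = foldl (fun y k => ystep r l X bits k c y)
    (fun i : 'I_M => (i == ord0)%:R) (iota 0 q).
Proof.
elim: q => // q IH; have -> : iota 0 q.+1 = iota 0 q ++ [:: q] by rewrite -addn1 iotaD.
by rewrite foldl_cat -IH.
Qed.

End PureTensor.

(** * Summing up the running time *)

Section Counting.

Lemma sum_pow2 r : (\sum_(b < r) 2 ^ b < 2 ^ r)%N.
Proof.
elim: r => [|r IH]; first by rewrite big_ord0.
rewrite big_ord_recr /= expnS; move: IH; set s := (\sum_(b < r) _)%N; lia.
Qed.

Lemma sqr_le_pow2 r : (r * r <= 4 * 2 ^ r)%N.
Proof.
elim: r => // r IH; have := ltn_expl r (isT : (1 < 2)%N); rewrite expnS; lia.
Qed.

Lemma up_log_le d k : (d <= 2 ^ k)%N = (up_log 2 d <= k)%N.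
Proof.
apply/idP/idP => [|h]; first exact: up_log_min.
by apply: leq_trans (up_logP d (isT : (1 < 2)%N)) _; rewrite leq_exp2l.
Qed.

Variables (R : realType) (r n p d : nat) (X : 'M[R]_(d, n)).
Local Notation l := (minn r (up_log 2 d)).
Local Notation M' := (2 ^ r).-1.
Local Notation u := (up_log 2 d).+1.
Local Notation M := (2 ^ r)%N.

Let ME : M'.+1 = M. Proof. by rewrite prednK // expn_gt0. Qed.

(** The two transforms account for [38 * (u - 1) * M], the other work on buckets for [38 * M], with
    [r * r] absorbed by [sqr_le_pow2], and the additive constants for 20; hence 58. *)
Lemma step_time_le (c : 'I_n) :
  (step_time M' r l X c <= 58 * u * (M + size (csc_col X c)))%N.
Proof.
rewrite /step_time ME; set s := size _; set rr := if _ then _ else _.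
have rru : (rr < u)%N.
  by rewrite /rr; case: ifP => //; rewrite up_log_le => /negbT; rewrite -ltnNge; lia.
have rM : (r < M)%N by apply: ltn_expl.
have -> : (\sum_(b < r) (8 + 3 * r + 3 * 2 ^ b) =
    8 * r + 3 * (r * r) + 3 * \sum_(b < r) 2 ^ b)%N.
  by rewrite big_split /= sum_nat_const card_ord big_distrr /=; lia.
have := sum_pow2 r; have := sqr_le_pow2 r.
have lM : (2 ^ l <= M)%N by rewrite leq_exp2l // geq_minl.
have lu : (l < u)%N by rewrite ltnS geq_minr.
have : (l * (7 + 6 * (M + 2 ^ l)) <= (u - 1) * (19 * M))%N.
  by apply: leq_mul; lia.
have : (s * (7 + 3 * rr) <= s * (7 * u))%N by rewrite leq_mul2l; lia.
have : (M <= u * M)%N by apply: leq_pmull.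
rewrite mulnBl mul1n.
set P := (u * (19 * M))%N; have -> : P = (19 * (u * M))%N by rewrite /P mulnCA.
set Q := (s * (7 * u))%N; have -> : Q = (7 * (u * s))%N by rewrite /Q; lia.
have -> : (58 * u * (M + s) = 58 * (u * M) + 58 * (u * s))%N by lia.
lia.
Qed.

(** 60 covers the steps, with the overhead of their loop added to 58; the remaining [6 * M + 9] is
    at most [15 * M]. *)
Lemma column_time_le (c : 'I_n) : (0 < p)%N ->
  (column_time M' r l p X c + 2 <= 75 * (p * u * (M + size (csc_col X c))))%N.
Proof.
move=> p0; rewrite /column_time ME; have := step_time_le c.
set st := step_time _ _ _ _ _; set s := size _; move=> H.
have : (p * (st + 2) <= p * (60 * (u * (M + s))))%N.
  rewrite leq_mul2l; apply/orP; right.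
  have : (1 <= u * (M + s))%N by rewrite muln_gt0 addn_gt0 expn_gt0.
  lia.
have : (M <= p * u * (M + s))%N.
  by apply: leq_trans (leq_pmull _ _); rewrite ?muln_gt0 ?p0 // leq_addr.
have : (0 < M)%N by rewrite expn_gt0.
have -> : (p * (60 * (u * (M + s))) = 60 * (p * u * (M + s)))%N by lia.
lia.
Qed.

(** Strict, to leave room for the test at the head of the program. *)
Lemma total_time_le : (0 < n)%N -> (0 < p)%N ->
  ((1 + (1 + ((1 + \sum_(i < r) (2 + 1)) + (1 + (1 + (1 + \sum_(i < l) (2 + 1))))))) +
    (2 + \sum_(c < n) (column_time M' r l p X c + 2))
  < 90 * (u * (p * n * M + p * nnz X)))%N.
Proof.
move=> n0 p0; rewrite !sum_nat_const !card_ord.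
have : (\sum_(c < n) (column_time M' r l p X c + 2) <=
    75 * (u * (p * n * M + p * nnz X)))%N.
  apply: (@leq_trans (\sum_(c < n) 75 * (p * u * (M + size (csc_col X c))))%N).
    by apply: leq_sum => c _; apply: column_time_le.
  rewrite -!big_distrr /= big_split /= sum_nat_const card_ord sum_size_csc_col.
  by apply: eq_leq; lia.
have : (M <= u * (p * n * M + p * nnz X))%N.
  apply: leq_trans (leq_pmull _ _) => //; apply: leq_trans (leq_addr _ _).
  by rewrite leq_pmull // muln_gt0 p0.
have rM : (r < M)%N by apply: ltn_expl.
have lr : (l <= r)%N by apply: geq_minl.
lia.
Qed.

End Counting.

(** * The theorem *)

Section Sizes.
Variables (R : realType) (W n p d m : nat) (eps s : R) (X : 'M[R]_(d, n)) (omega : seq bool).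
Hypotheses (m0 : (0 < m)%N) (mW : (2 * m < W)%N).
Local Notation r := (trunc_log 2 m).
Local Notation l := (minn r (up_log 2 d)).
Local Notation st0 := (init_state p m eps s X omega).

Lemma sizes_spec :
  wp W sizes_prog
    (1 + (1 + ((1 + \sum_(i < r) (2 + 1)) + (1 + (1 + (1 + \sum_(i < l) (2 + 1)))))))
    (fun st => base (2 ^ r).-1 r l p m X (nth false omega) st /\ forall i, reals st 2%N i = 0)
    st0.
Proof.
have rm : (2 ^ r <= m)%N by apply: trunc_logP.
have rm2 : (m < 2 ^ r.+1)%N by apply: trunc_log_ltn.
have rr : (r < 2 ^ r)%N by apply: ltn_expl.
have lr : (l <= r)%N by apply: geq_minl.
apply: wp_seq; apply: wp_setI; first by rewrite /=; lia.
set st1 := State _ _; have fr1 : frame [:: 4] [::] st0 st1 by apply: frame_setI.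
apply: wp_seq; apply: wp_setI; first by rewrite /=; lia.
set st2 := State _ _; have fr2' : frame [:: 5] [::] st1 st2 by apply: frame_setI.
have fr2 : frame [:: 4; 5; 6; 7] [::] st0 st2.
  by apply: frame_trans (frame_sub _ _ fr1) (frame_sub _ _ fr2').
apply: wp_seq; apply: (wp_while (Tb := fun=> 2%N) (I := fun i st =>
  [/\ frame [:: 4; 5; 6; 7] [::] st0 st, words st 4 0 = (2 ^ i)%N & words st 5 0 = i])).
- by split.
- move=> i st ir [fr e4 e5]; rewrite /= e4 fr.1 //= -expnS; apply/idP/idP => h.
    by rewrite -(ltn_exp2l _ _ (isT : (1 < 2)%N)) -ltnS; move: h rm2; rewrite !expnS; lia.
  by apply: leq_trans rm; rewrite leq_exp2l.
- move=> i st ir [fr e4 e5].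
  have ir2 : (2 ^ i.+1 <= 2 ^ r)%N by rewrite leq_exp2l.
  apply: (@wp_seq _ _ _ _ 1 1); apply: wp_setI.
    by rewrite /= e4 -expnS; lia.
  set sa := State _ _; have fa : frame [:: 4] [::] st sa by apply: frame_setI.
  have sv : words sa 5 0 = i by rewrite fa.1.
  have sv1 : ieval sa (IAdd (iv 5) (INat 1)) = i.+1.
    by rewrite -[LHS]/(words sa 5 0 + 1)%N sv addn1.
  have sa1 : words sa 4 0 = (2 ^ i.+1)%N.
    by rewrite -[LHS]/(2 * words st 4 0)%N e4 -expnS.
  apply: wp_setI; first by rewrite sv1; lia.
  set sb := State _ _; have fb : frame [:: 5] [::] sa sb by apply: frame_setI.
  split; last exact: sv1.
    by apply: frame_trans fr (frame_trans (frame_sub _ _ fa) (frame_sub _ _ fb)).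
  by rewrite fb.1.
move=> st3 [fr3 e4 e5].
apply: wp_seq; apply: wp_setI; first by rewrite /=; lia.
set st4 := State _ _; have fr4 : frame [:: 6] [::] st3 st4 by apply: frame_setI.
apply: wp_seq; apply: wp_setI; first by rewrite /=; lia.
set st5 := State _ _; have fr5' : frame [:: 7] [::] st4 st5 by apply: frame_setI.
have fr5 : frame [:: 6; 7] [::] st3 st5.
  by apply: frame_trans (frame_sub _ _ fr4) (frame_sub _ _ fr5').
apply: (wp_while (Tb := fun=> 2%N) (I := fun i st =>
  [/\ frame [:: 6; 7] [::] st3 st, words st 6 0 = (2 ^ i)%N & words st 7 0 = i])).
- by split.
- move=> i st il [fr e6 e7]; rewrite /= e6 !fr.1 // fr3.1 //= e4 -expnS.
  (* The loop goes on while [2 ^ i < d] and [2 ^ i.+1 <= M], that is, while [i] is below both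
     [up_log 2 d] and [r]. *)
  by rewrite up_log_le -ltnNge leq_exp2l // leq_min andbC.
- move=> i st il [fr e6 e7].
  have il2 : (2 ^ i.+1 <= 2 ^ r)%N by rewrite leq_exp2l // (leq_trans il).
  have lW : (l < W)%N by lia.
  apply: (@wp_seq _ _ _ _ 1 1); apply: wp_setI.
    by rewrite /= e6 -expnS; lia.
  set sa := State _ _; have fa : frame [:: 6] [::] st sa by apply: frame_setI.
  have sv : words sa 7 0 = i by rewrite fa.1.
  have sv1 : ieval sa (IAdd (iv 7) (INat 1)) = i.+1.
    by rewrite -[LHS]/(words sa 7 0 + 1)%N sv addn1.
  have sa1 : words sa 6 0 = (2 ^ i.+1)%N.
    by rewrite -[LHS]/(2 * words st 6 0)%N e6 -expnS.
  apply: wp_setI; first by rewrite sv1; lia.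
  set sb := State _ _; have fb : frame [:: 7] [::] sa sb by apply: frame_setI.
  split; last exact: sv1.
    by apply: frame_trans fr (frame_trans (frame_sub _ _ fa) (frame_sub _ _ fb)).
  by rewrite fb.1.
move=> st [fr e6 e7]; split; last by move=> i; rewrite fr.2 // fr3.2.
split; [| |by split; rewrite // fr.1 // ?e4 ?e5 ?prednK ?expn_gt0].
  by rewrite fr.1 // fr3.1.
split=> [k kn|k|k|k]; rewrite ?fr.1 ?fr.2 // ?fr3.1 ?fr3.2 //=.
by rewrite kn.
Qed.

End Sizes.

Lemma half_le_ln2 (R : realType) : 1 / 2 <= ln (2 : R).
Proof.
have := @le_ln1Dx R (- (1 / 2)); rewrite (_ : 1 + - (1 / 2) = 2^-1); last by field.
rewrite lnV ?posrE //; lra.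
Qed.

(** With [v = up_log 2 d - 1], the bounds [2 ^ v < d <= a] and [ln 2 >= 1/2] give [v <= 2 * ln a];
    the remaining 2 is at most [4 * ln a]. *)
Lemma up_log_le_ln (R : realType) (d : nat) (a : R) : (0 < d)%N -> d%:R <= a -> 2 <= a ->
  (up_log 2 d).+1%:R <= 6 * ln a.
Proof.
move=> d0 da a2; have a0 : 0 < a by lra.
have ln2a : ln 2 <= ln a by rewrite ler_ln ?posrE.
have := half_le_ln2 R.
have [|u0] := posnP (up_log 2 d); first by move=> ->; lra.
have d1 : (1 < d)%N by case: d d0 {da} u0 => [|[|d]] //; rewrite up_log1.
have /andP[ud _] := up_log_bounds (isT : (1 < 2)%N) d1.
have : ln (2 ^+ (up_log 2 d).-1) <= ln a.
  rewrite ler_ln ?posrE ?exprn_gt0 //; apply: le_trans da.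
  by rewrite -natrX ler_nat ltnW.
set v := (up_log 2 d).-1 in ud *.
have -> : (up_log 2 d).+1%:R = v%:R + 2 :> R by rewrite -natrD /v addn2 prednK.
rewrite lnXn // -[_ *+ v]mulr_natr => h1 h2.
have : 0 <= v%:R * (ln 2 - 1 / 2) :> R by rewrite mulr_ge0 // subr_ge0.
lra.
Qed.

Theorem theorem1p4 (R : realType) :
  exists (C K : R) (c w : nat) (prog : cmd),
    0 < C /\
    forall (n p d m : nat) (eps s : R),
      (0 < n)%N -> (0 < p)%N -> (0 < d)%N -> (0 < m)%N -> 0 < eps -> 0 < s ->
      exists P : sketch_dist R m (d ^ p),
        [/\ C * p%:R * s ^+ 2 / eps ^+ 2 <= m%:R ->
              oblivious_subspace_embedding eps (1 / 10) s n P,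
            C * p%:R / eps ^+ 2 <= m%:R ->
              approx_matrix_product eps (1 / 10) n P
          & exists (L : nat) (Pi : L.-tuple bool -> 'M[R]_(m, d ^ p)),
              fair_coin_law Pi P /\
              forall (X : 'M[R]_(d, n)) (omega : L.-tuple bool),
              exists (t : nat) (st : state R),
                [/\ exec ((n * p * d * m + 2) ^ w) prog
                      (init_state p m eps s X omega) t st,
                    output_is st (Pi omega *m self_tensor_cols p X)
                  & t%:R <= K * polylog c n d eps
                            * (p * n * m + p * nnz X)%:R]].
Proof.
(* Failure probability 1/10 and variance [16 * p / M] ask for [M >= 160 * p / eps^2], and
   [2 * M > m] doubles this to 320. 540 is 90 from [total_time_le] times 6 from [up_log_le_ln]. The
   exponent 2 makes room for words up to [2 * m]. *)
exists 320, 540, 1%N, 2, sketch_prog; split; first by [].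
move=> n p d m eps s n0 p0 d0 m0 e0 s0.
have guardE (X : 'M[R]_(d, n)) (omega : seq bool) :
    beval (init_state p m eps s X omega)
      (BAnd (BNot (BLeR (RNat (INat 1)) (RGet 0 (INat 0))))
         (BLeI (IMul (INat 320) (IGet 0 (INat 1))) (IGet 0 (INat 3)))) =
    (eps < 1) && (320 * p <= m)%N by rewrite /= -ltNge.
have p1 : 0 < p%:R :> R by rewrite ltr0n.
have ee : 0 < eps ^+ 2 by rewrite exprn_gt0.
have nm0 : (0 < p * n * m)%N by rewrite !muln_gt0 p0 n0.
have [/andP[e1 pm]|small] := boolP ((eps < 1) && (320 * p <= m)%N); last first.
  (* If [m < 320 * p], the assumption of the first guarantee forces [s <= eps] and that of the
     second [1 <= eps]. The output array starts at zero, so halting at once computes the zero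
     sketch. *)
  exists (coin_law (fun _ : 0.-tuple bool => 0)); split.
  - rewrite ler_pdivrMr // => h; apply: zero_ose.
    move: small; rewrite negb_and -leNgt -ltnNge => /orP[|mp]; [by left | right].
    rewrite -(@ler_pXn2r _ 2) ?nnegrE ?(ltW s0) ?(ltW e0) //.
    have : m%:R <= 320 * p%:R :> R by rewrite -natrM ler_nat ltnW.
    move=> mp'; have : 320 * p%:R * s ^+ 2 <= 320 * p%:R * eps ^+ 2.
      by apply: le_trans h _; rewrite ler_wpM2r // ltW.
    by rewrite ler_pM2l ?mulr_gt0 //.
  - rewrite ler_pdivrMr // => h; apply: zero_amp.
    move: small; rewrite negb_and -leNgt -ltnNge => /orP[//|mp].
    have mp' : m%:R <= 320 * p%:R :> R by rewrite -natrM ler_nat ltnW.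
    have m1 : 0 < m%:R :> R by rewrite ltr0n.
    have : m%:R * 1 <= m%:R * eps ^+ 2 by rewrite mulr1; apply: le_trans h.
    by rewrite ler_pM2l // expr_ge1 // ltW.
  exists 0%N, (fun=> 0); split; first exact: fair_coin_law_coin_law.
  move=> X omega; exists 2, (init_state p m eps s X omega); split.
  - by apply: ExecIfFalse; [rewrite guardE | apply: ExecSkip].
  - by move=> i j; rewrite mul0mx mxE.
  have : 1 <= (p * n * m + p * nnz X)%:R :> R by rewrite ler1n addn_gt0 nm0.
  have : ln 2 <= polylog 1 n d eps.
    have q0 : 0 <= (n * d)%:R / eps by rewrite divr_ge0 // ltW.
    by rewrite /polylog expr1 ler_ln ?posrE; lra.
  have := half_le_ln2 R; set a := polylog _ _ _ _; set b := _%:R; nra.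
set r := trunc_log 2 m; set l := minn r (up_log 2 d).
have HM : (2 ^ r).-1.+1 = (2 ^ r)%N by rewrite prednK // expn_gt0.
have lr : (l <= r)%N by apply: geq_minl.
have Hd : if (d <= (2 ^ r).-1.+1)%N then (d <= 2 ^ l)%N else l == r.
  rewrite HM; case: ifP => h; rewrite up_log_le in h.
    by rewrite up_log_le leq_min leqnn h.
  by apply/eqP/minn_idPl; rewrite ltnW // ltnNge h.
have Mm : (2 ^ r <= m)%N by apply: trunc_logP.
have Mm' : ((2 ^ r).-1.+1 <= m)%N by rewrite HM.
have mM : (m < 2 ^ r.+1)%N by apply: trunc_log_ltn.
have [f f_bij fE] := self_tensor_index R d p.
set L := (p * step_bits (2 ^ r).-1 r d)%N.
pose Pi (w : L.-tuple bool) := sketch_mx R l m f (decode_bits w).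
have M0 : 0 < (2 ^ r)%:R :> R by rewrite ltr0n expn_gt0.
have mM' : m%:R <= 2 * (2 ^ r)%:R :> R.
  by rewrite -natrM ler_nat ltnW // -expnS.
have pM : 320 * p%:R <= 2 * (2 ^ r)%:R :> R.
  by apply: le_trans mM'; rewrite -natrM ler_nat.
(* The bound for the step randomness passes to coins along [decode_bij]; [320 * p <= m] more than
   ensures [16 * p <= M]. *)
have moment (x y : 'cV[R]_(d ^ p)) :
    avg (fun t => (\sum_w (Pi t *m x) w 0 * (Pi t *m y) w 0 - \sum_a x a 0 * y a 0) ^+ 2) <=
    16 * p%:R / (2 ^ r)%:R * ((\sum_a x a 0 ^+ 2) * (\sum_a y a 0 ^+ 2)).
  have := @sketch_moment R (2 ^ r).-1 r l d HM lr Hd m p f Mm' f_bij x y.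
  rewrite HM => /(_ ltac:(lra)).
  by rewrite -(avg_bij _ (decode_bij d HM p)).
exists (coin_law Pi); split.
- rewrite ler_pdivrMr // => h; apply: (coin_law_ose moment) => //.
  rewrite mulrAC ler_pdivrMr //.
  have : m%:R * eps ^+ 2 <= 2 * (2 ^ r)%:R * eps ^+ 2 by rewrite ler_wpM2r // ltW.
  lra.
- rewrite ler_pdivrMr // => h; apply: (coin_law_amp moment) => //.
  rewrite ler_pdivrMr //.
  have : m%:R * eps ^+ 2 <= 2 * (2 ^ r)%:R * eps ^+ 2 by rewrite ler_wpM2r // ltW.
  lra.
exists L, Pi; split; first exact: fair_coin_law_coin_law.
move=> X omega; set W := ((n * p * d * m + 2) ^ 2)%N.
have big x : (x <= n * p * d * m)%N -> (2 * x < W)%N by rewrite /W; nia.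
have npdm0 : (0 < n * p * d * m)%N by rewrite !muln_gt0 n0 p0 d0.
have mW : (2 * m < W)%N by apply: big; rewrite leq_pmull // !muln_gt0 n0 p0.
have dW : (d < W)%N.
  by apply: leq_ltn_trans (big d _); [lia | rewrite mulnAC leq_pmull // !muln_gt0 n0 p0].
have pW : (p < W)%N.
  by apply: leq_ltn_trans (big p _); [lia | rewrite -!mulnA mulnCA leq_pmulr // !muln_gt0 n0 d0].
have nW : (n < W)%N.
  by apply: leq_ltn_trans (big n _); [lia | rewrite -!mulnA leq_pmulr // !muln_gt0 p0 d0].
have MW : (2 * (2 ^ r).-1.+1 < W)%N by rewrite HM; lia.
have main : wp W (Seq sizes_prog (For 8 (IGet 0 (INat 0)) column_prog))
    ((1 + (1 + ((1 + \sum_(i < r) (2 + 1)) + (1 + (1 + (1 + \sum_(i < l) (2 + 1))))))) +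
     (2 + \sum_(c < n) (column_time (2 ^ r).-1 r l p X c + 2)))%N
    (fun st => forall (c : 'I_n) (i : 'I_m), reals st 2%N (c * m + i)%N =
      if insub (val i) is Some w then @ysteps R (2 ^ r).-1 r l n d X (nth false omega) p c w
      else 0)
    (init_state p m eps s X omega).
  apply: wp_seq; apply: wp_weaken (sizes_spec p eps s X omega m0 mW) (leqnn _) _.
  move=> st [bs O0]; exact: (columns_spec HM lr Hd MW dW pW nW Mm' bs O0).
have [t [st [ex tT out]]] := main.
exists t.+1, st; split.
- by apply: ExecIfTrue ex; rewrite guardE e1.
- move=> i c; rewrite out.
  have -> : (Pi omega *m self_tensor_cols p X) i c =
      (Pi omega *m col c (self_tensor_cols p X)) i 0.
    rewrite [LHS]mxE [RHS]mxE; apply: eq_bigr => a _; congr (_ * _).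
    by rewrite [RHS]mxE.
  (* The tensor power of column [c] at bucket 0, kept in factored form for [hchain_pure]. *)
  pose u (i' : 'I_(2 ^ r).-1.+1) (js : p.-tuple 'I_d) := (i' == ord0)%:R * \prod_(j <- js) X j c.
  have uE i' a : u i' (f a) = (i' == ord0)%:R * col c (self_tensor_cols p X) a 0.
    rewrite /u; congr (_ * _); rewrite !mxE fE; apply: eq_bigr => j _.
    by rewrite mxE.
  rewrite (sketch_mxE _ f_bij _ _ uE).
  case: insubP => // w _ _; rewrite ysteps_foldl -(@hchain_pure R (2 ^ r).-1 r l n d X (nth false omega) p _ c _ w (size_iota 0 p)).
  congr (hchain _ _ _ w).
  by rewrite /= -val_enum_ord -map_comp.
have tN : (t.+1 <= 90 * ((up_log 2 d).+1 * (p * n * 2 ^ r + p * nnz X)))%N.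
  by apply: leq_ltn_trans tT (total_time_le r X n0 p0).
apply: (@le_trans _ _ (90 * ((up_log 2 d).+1 * (p * n * m + p * nnz X)))%:R).
  rewrite ler_nat (leq_trans tN) // leq_mul2l /= leq_mul2l /= leq_add2r leq_mul2l Mm orbT //.
rewrite natrM natrM mulrA ler_wpM2r //.
(* Here [eps < 1] enters the time bound: it puts [d], and with it the number of transform stages,
   under the control of nd/eps. *)
have nd : d%:R <= (n * d)%:R / eps.
  rewrite ler_pdivlMr //; apply: (@le_trans _ _ (d%:R * 1)).
    by rewrite ler_wpM2l // ltW.
  by rewrite mulr1 ler_nat leq_pmull.
have d1 : 0 <= d%:R :> R by apply: ler0n.
have h : (up_log 2 d).+1%:R <= 6 * ln (2 + (n * d)%:R / eps) :> R.
  by apply: up_log_le_ln => //; lra.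
rewrite /polylog expr1; lra.
Qed.
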